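(* For each $n\ge1$ let $\boldsymbol d=(d_1,\dots,d_n)$ (depending on $n$) be positive integers with $\ell_n=\sum_{i\in[n]}d_i$ even, $\max_id_i=o(\ell_n)$ and $\ell_n=\omega(\log n)$. Let $\rho_n=\frac1{\sqrt{\ell_n}}\sum_{i\in[n]}\delta_{d_i/\sqrt{\ell_n}}$ and $b_n=\int_0^\infty(x\wedge1)\rho_n(dx)$. Assume that $\rho_n\to\rho$ vaguely and $b_n\to b\in\mathbb R_+$, and let $I_{\mathrm{CM}}=a^2/2$ with $a=b-\int(x\wedge1)\rho(dx)$. Then $I_{\mathrm{CM}}=0$ if and only if $\mathrm{CM}_n(\boldsymbol d)$ is uniformly tail regular a.s. $\mathbb P_{\mathrm{CM}}$. Moreover, if $I_{\mathrm{CM}}=0$ and $\int_0^\infty\int_0^\infty(1-e^{-xy})\rho_n(dx)\rho_n(dy)\to c$ as $n\to\infty$ for some $0<c<\infty$, then $\mathrm{ECM}_n(\boldsymbol d)$ is uniformly tail regular a.s. $\mathbb P_{\mathrm{ECM}}$. In this case, $\mathrm{ECM}_n(\boldsymbol d)$ converges to $W^c_{\mathrm{ECM}}$ in the stretched cut metric a.s. $\mathbb P_{\mathrm{ECM}}$, where $W^c_{\mathrm{ECM}}(x,y)=W_{\mathrm{ECM}}(\sqrt c\,x,\sqrt c\,y)$.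
   Context: $\rho_n,\rho$ are measures on $(0,\infty)$ and vague convergence is on $(0,\infty)$. $\mathrm{CM}_n(\boldsymbol d)$ is the configuration model: vertex $j$ gets $d_j$ half-edges, a uniform perfect matching of the $\ell_n$ half-edges is taken and each matched pair becomes an edge. $\mathrm{ECM}_n(\boldsymbol d)$ is obtained from it by collapsing all multiple edges to single edges (multiple loops merged into single loops, loops not deleted). $\mathbb P_{\mathrm{CM}}$, $\mathbb P_{\mathrm{ECM}}$ are the products over $n$ of the respective laws. $\bar\rho(x)=\int_x^\infty\rho(dy)$, $\bar\rho^{-1}(y)=\inf\{x\in\mathbb R_+:\bar\rho(x)\le y\}$ for $y>0$, $\bar\rho^{-1}(0)=0$; $W_{\mathrm{ECM}}(x,y)=1-e^{-\bar\rho^{-1}(x)\bar\rho^{-1}(y)}$ for $x\ne y$, $W_{\mathrm{ECM}}(x,x)=1-e^{-\bar\rho^{-1}(x)^2/2}$. Uniform tail regularity: let $d_v(G)$ be the degree of vertex $v$ in $G$ and $e(G)$ the number of non-loop edges. A sequence of (multi)graphs $(G_n)_{n\ge1}$ is uniformly tail regular if for any $\varepsilon>0$ there exists $\delta>0$ such that for all $n\ge1$, $\frac1{e(G_n)}\sum_{v:\,d_v(G_n)\le\delta\sqrt{e(G_n)}}d_v(G_n)<\varepsilon$. Stretched cut metric: for integrable symmetric measurable $W_1,W_2:\mathbb R_+^2\to[0,1]$, $$\delta_\square(W_1,W_2)=\inf_\gamma\sup_{U,V}\Big|\int_U\int_V\big(W_1(x,y)-W_2(x',y')\big)\gamma(dx,dx')\gamma(dy,dy')\Big|,$$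 with infimum over measures $\gamma$ on $\mathbb R_+^2$ both of whose marginals are Lebesgue measure and supremum over measurable $U,V\subset\mathbb R_+^2$. The stretched version of $W$ is $W^s(x,y)=W(\|W\|_1^{1/2}x,\|W\|_1^{1/2}y)$ and the stretched cut distance is $\delta^s_\square(W_1,W_2)=\delta_\square(W_1^s,W_2^s)$. A graph $G$ with $m$ vertices is identified with its canonical graphon: the function equal to $1$ on $[\frac{i-1}m,\frac im)\times[\frac{j-1}m,\frac jm)$ if $i,j$ are adjacent, and $0$ elsewhere in $\mathbb R_+^2$; $G_n$ converges to $W$ in the stretched cut metric if the stretched cut distance between the canonical graphon of $G_n$ and $W$ tends to $0$. *)

(* Defs.v *)
From HB Require Import structures.
From mathcomp Require Import all_boot all_order all_algebra.
From mathcomp Require Import all_classical all_reals all_analysis.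

Set Implicit Arguments.
Unset Strict Implicit.
Unset Printing Implicit Defensive.

Import Order.TTheory GRing.Theory Num.Theory.
Import numFieldNormedType.Exports.

Local Open Scope classical_set_scope.
Local Open Scope ring_scope.

(* A multigraph on the vertex set 'I_n is given by its symmetric matrix of
   multiplicities: G i j is the number of edges between i and j if i != j, and
   G i i is the number of loops at i.  Symmetry is not part of the type; it
   holds for every multigraph produced by [CM_graph] below. *)
Definition multigraph (n : nat) : Type := 'M[nat]_n.

(* A loop contributes 2 to the degree of its vertex. *)
Definition vdeg (n : nat) (G : multigraph n) (v : 'I_n) : nat :=
  (\sum_(j < n) G v j + G v v)%N.

Definition nb_edges (n : nat) (G : multigraph n) : nat :=
  (\sum_(i < n) \sum_(j < n | i < j) G i j)%N.

Definition collapse (n : nat) (G : multigraph n) : multigraph n :=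
  \matrix_(i, j) nat_of_bool (0 < G i j)%N.

(* If G n has no non-loop edge, then the sum is over vertices of degree 0, and
   the quotient 0 / 0 is 0. *)
Definition uniformly_tail_regular (R : realType) (G : forall n, multigraph n) :=
  forall eps : R, 0 < eps -> exists2 delta : R, 0 < delta &
    forall n, (0 < n)%N ->
      (nb_edges (G n))%:R^-1 *
      (\sum_(v < n | ((vdeg (G n) v)%:R <=
          delta * Num.sqrt (nb_edges (G n))%:R :> R)%R) (vdeg (G n) v)%:R)
      < eps.

Definition ell (n : nat) (d : n.-tuple nat) : nat := (\sum_(i < n) tnth d i)%N.

Definition max_degree (n : nat) (d : n.-tuple nat) : nat :=
  (\max_(i < n) tnth d i)%N.

Definition half_edge (n : nat) (d : n.-tuple nat) : finType :=
  {i : 'I_n & 'I_(tnth d i)}.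

Definition perfect_matchings (n : nat) (d : n.-tuple nat) :
    {set {set {set half_edge d}}} :=
  [set M | finset.partition M [set: half_edge d] & [forall e in M, #|e| == 2%N]]%SET.

(* A matched pair e is an edge between the owners of its two half-edges; the set
   of owners is a singleton exactly when e is a loop. *)
Definition CM_graph (n : nat) (d : n.-tuple nat) (M : {set {set half_edge d}}) :
    multigraph n :=
  \matrix_(i, j)
    #|[set e in M | [set tag h | h in e] == [set i; j]]%SET|.

Definition CM_law (R : realType) (n : nat) (d : n.-tuple nat)
    (A : set (multigraph n)) : R :=
  #|[set M in perfect_matchings d | CM_graph M \in A]%SET|%:R /
  #|perfect_matchings d|%:R.

Definition ECM_law (R : realType) (n : nat) (d : n.-tuple nat)
    (A : set (multigraph n)) : R :=
  CM_law R d (@collapse n @^-1` A).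

HB.instance Definition _ n := Pointed.on (multigraph n).

Definition cylinders : set_system (forall n, multigraph n) :=
  [set C | exists n (A : set (multigraph n)), C = [set G | A (G n)]].

Definition graph_seq := g_sigma_algebraType cylinders.

(* The product over n of probability laws on multigraphs is the unique
   probability with these finite-dimensional distributions.  The law on
   multigraphs with 0 vertices is trivial. *)
Definition is_product_law (R : realType) (P : probability graph_seq R)
    (law : forall n, set (multigraph n) -> R) :=
  forall (N : nat) (A : forall n, set (multigraph n)),
    P [set G : graph_seq | forall n, (n < N)%N -> A n (G n)] =
    (\prod_(n < N) law n (A n))%:E.

Section measures.
Variable R : realType.

Notation borelR := (measurableTypeR R).

Definition Rpos : set R := `]0, +oo[.
Definition Rnneg : set R := `[0, +oo[.

Definition rho_n (n : nat) (d : n.-tuple nat) : {measure set borelR -> \bar R} :=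
  mscale ((Num.sqrt (ell d)%:R)^-1)%:nng
    (msum (fun i => \d_((nth 0%N d i)%:R / Num.sqrt (ell d)%:R : borelR)) n).

(* The f's are the continuous functions with compact support in (0, oo). *)
Definition vague_cvg (mu : nat -> {measure set borelR -> \bar R})
    (nu : {measure set borelR -> \bar R}) :=
  forall (f : R -> R) (K : set R),
    continuous f -> compact K -> K `<=` Rpos ->
    (forall x, ~ K x -> f x = 0) ->
    (\int[mu n]_(x in Rpos) (f x)%:E)%E @[n --> \oo] -->
    (\int[nu]_(x in Rpos) (f x)%:E)%E.

Definition b_n (n : nat) (d : n.-tuple nat) : R :=
  \int[rho_n d]_(x in Rpos) Num.min x 1.

(* The integral against rho is finite as soon as rho is the vague limit of
   measures against which the integrals of min (x, 1) are bounded. *)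
Definition I_CM (b : R) (rho : {measure set borelR -> \bar R}) : R :=
  (b - \int[rho]_(x in Rpos) Num.min x 1) ^+ 2 / 2.

Definition edge_intensity (mu : {measure set borelR -> \bar R}) : \bar R :=
  (\int[mu]_(y in Rpos) \int[mu]_(x in Rpos) (1 - expR (- (x * y)))%:E)%E.

(* The interval is open at x so that 0 is excluded; a closed one would not change
   [rhobar_inv]. *)
Definition rhobar (rho : {measure set borelR -> \bar R}) (x : R) : \bar R :=
  rho `]x, +oo[%classic.

Definition rhobar_inv (rho : {measure set borelR -> \bar R}) (y : R) : R :=
  if y == 0 then 0
  else inf [set x : R | 0 <= x /\ (rhobar rho x <= y%:E)%E].

Definition W_ECM (rho : {measure set borelR -> \bar R}) (x y : R) : R :=
  if x == y then 1 - expR (- (rhobar_inv rho x ^+ 2 / 2))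
  else 1 - expR (- (rhobar_inv rho x * rhobar_inv rho y)).

Definition W_ECM_scaled (rho : {measure set borelR -> \bar R}) (c x y : R) : R :=
  W_ECM rho (Num.sqrt c * x) (Num.sqrt c * y).

(* A function on the quadrant is represented by a function on the plane, of
   which only the values on the quadrant matter. *)
Definition quadrant : set (borelR * borelR) := Rnneg `*` Rnneg.

Definition graphon (W : R -> R -> R) :=
  [/\ forall x y, 0 <= x -> 0 <= y -> W x y = W y x,
      forall x y, 0 <= x -> 0 <= y -> 0 <= W x y <= 1 &
      (lebesgue_measure \x lebesgue_measure)%E.-integrable quadrant
        (fun p : borelR * borelR => (W p.1 p.2)%:E)].

Definition L1norm (W : R -> R -> R) : R :=
  \int[(lebesgue_measure \x lebesgue_measure)%E]_(p in quadrant)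
    `|W p.1 p.2|.

Definition stretch (W : R -> R -> R) (x y : R) : R :=
  W (Num.sqrt (L1norm W) * x) (Num.sqrt (L1norm W) * y).

(* Both marginals are the Lebesgue measure on [0, oo), so that gamma vanishes
   outside the quadrant. *)
Definition coupling (gamma : {measure set (borelR * borelR) -> \bar R}) :=
  forall A : set borelR, measurable A ->
    gamma (A `*` setT) = lebesgue_measure (A `&` Rnneg) /\
    gamma (setT `*` A) = lebesgue_measure (A `&` Rnneg).

Definition cut_discrepancy (W1 W2 : R -> R -> R)
    (gamma : {measure set (borelR * borelR) -> \bar R})
    (U V : set (borelR * borelR)) : \bar R :=
  `| \int[gamma]_(p in U) \int[gamma]_(q in V)
       (W1 p.1 q.1 - W2 p.2 q.2)%:E |%E.

Definition cut_distance (W1 W2 : R -> R -> R) : \bar R :=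
  ereal_inf [set ereal_sup
      [set z | exists U V : set (borelR * borelR),
         [/\ measurable U, measurable V, U `<=` quadrant, V `<=` quadrant &
             z = cut_discrepancy W1 W2 gamma U V]]
    | gamma in coupling].

Definition stretched_cut_distance (W1 W2 : R -> R -> R) : \bar R :=
  cut_distance (stretch W1) (stretch W2).

(* Vertices are numbered from 0; a vertex is adjacent to itself when it carries
   a loop. *)
Definition canonical_graphon (m : nat) (G : multigraph m) (x y : R) : R :=
  [exists i : 'I_m, exists j : 'I_m,
    [&& (0 < G i j)%N,
        i%:R / m%:R <= x < i.+1%:R / m%:R &
        j%:R / m%:R <= y < j.+1%:R / m%:R]]%:R.

(* The distance is meant for graphons, so convergence to W includes that W is
   one. *)
Definition stretched_cut_cvg (G : forall n, multigraph n) (W : R -> R -> R) :=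
  graphon W /\
  stretched_cut_distance (canonical_graphon (G n)) W @[n --> \oo] --> 0%E.

End measures.

(* Main.v *)
Require Import Defs.
From HB Require Import structures.
From mathcomp Require Import all_boot all_order all_algebra.
From mathcomp Require Import all_classical all_reals all_analysis measurable_realfun.
From mathcomp Require Import ring lra.
Import Order.TTheory GRing.Theory Num.Theory.
Import numFieldNormedType.Exports.

Local Open Scope ring_scope.

Set Implicit Arguments.
Unset Strict Implicit.
Unset Printing Implicit Defensive.

(** Call the degree sequences tail regular when the half-edges at vertices of
    degree at most [delta * sqrt ell] make up, for all large [n], a fraction of
    the [ell] half-edges that vanishes as [delta] goes to 0.

    The vanishing of [I_CM] is tail regularity in disguise.  The measure
    [x rho_n(dx)] has total mass 1, so [min (x, 1) rho_n(dx)] puts mass at most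
    [1 / K] on [x >= K] and none of it escapes to infinity.  What the vague limit
    loses, namely [a = b - \int min (x, 1) rho(dx)], is therefore lost at 0, where
    [min (x, 1) = x], and it is the limiting fraction of half-edges at vertices
    of degree [o (sqrt ell)] ([I_CM_tail_regular]).

    For the configuration model the degrees are deterministic, and the only
    randomness in uniform tail regularity is the number of non-loop edges, which
    enters through its order of magnitude.  The mean number of loops is at most
    twice the maximal degree, which is [o (ell)], and the number of loops
    concentrates exponentially, so that there are almost surely between
    [ell / 8] and [ell] non-loop edges for all large [n] ([CM_ae_good_degrees]);
    then the graphs are uniformly tail regular exactly when the degrees are tail
    regular ([tail_regular_CM]).

    Concentration for a uniform matching is proved by pairing off one half-edge
    at a time: changing its partner can be undone by switching two edges
    ([avg_switch]), so the exponential moments of a function of the matching are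
    controlled by induction on the number of half-edges ([avg_expR]).  The same
    recursion shows that the vertices [i] and [j] are linked with probability
    close to [1 - exp (- d_i d_j / ell)] ([no_crossing_expR]).

    For the erased model, fix [delta].  At most [sqrt ell / delta] vertices have
    degree above [delta * sqrt ell], so there are only [exp (O (sqrt ell))] pairs
    of sets [S], [T] of such vertices, and concentration at rate [exp (- C ell)]
    makes the numbers of links between [S] and [T] close to their means for all
    these pairs at once.  Under tail regularity the remaining vertices carry few
    half-edges, hence few links; so almost surely the adjacency matrix is within
    [o (ell)] in cut norm of the matrix of the [1 - exp (- d_i d_j / ell)]
    ([ECM_uniform_links]).  Taking all pairs of vertices, the number of links is
    [c * ell] up to [o (ell)], which transfers tail regularity from the degrees
    to the erased graph ([ECM_uniformly_tail_regular]).

    It remains to pass to graphons.  After sorting the vertices by decreasing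
    degree and scaling, the matrix of linking probabilities is the kernel
    [1 - exp (- D_n(x) D_n(y))], where the profile [D_n] is the generalized
    inverse of the tail function of [rho_n].  Vague convergence makes [D_n]
    converge outside a countable set to [rhobar_inv rho (sqrt c * x)]
    ([profile_cvg]); the kernels converge in L1 by dominated convergence on
    boxes, the far region being uniformly negligible by tail regularity
    ([profile_graphon_cvg_L1]).  The limit has integral 1, so it is its own
    stretched version.  The sorting of the vertices is realized by a measure
    preserving map that permutes the blocks of the canonical graphon, and the
    coupling carried by the graph of this map bounds the cut distance by the cut
    norm error of the matrices plus the L1 error of the kernels
    ([cut_discrepancy_le]). *)

(** * Averages over perfect matchings *)

Section Matchings.
Import boot.fintype boot.finset.
Local Open Scope set_scope.
Local Open Scope ring_scope.
Variable T : finType.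
Implicit Types (X A B e : {set T}) (M : {set {set T}}).

(** Matchings of an arbitrary finite set [X], so that inductions can remove one
    matched pair at a time; [perfect_matchings d] is the case of all half-edges. *)
Definition matchings X : {set {set {set T}}} :=
  [set M | finset.partition M X & [forall e in M, #|e| == 2%N]]%SET.

Lemma matching_block M X e : M \in matchings X -> e \in M -> #|e| = 2%N.
Proof. by rewrite inE => /andP[_ /forall_inP h] /h /eqP. Qed.

Lemma matching_partner M X x : M \in matchings X -> x \in X ->
  exists2 y, y \in X :\ x & [set x; y] \in M.
Proof.
move=> Mp xX; have := Mp; rewrite inE => /andP[pM _].
have xc : x \in cover M by rewrite (cover_partition pM).
have eM := pblock_mem xc.
have /eqP/cards2P[a [b [ab E]]] := matching_block Mp eM.
have sub : pblock M x \subset X.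
  exact: partitionS pM eM.
have := mem_pblock M x; rewrite xc E !inE => /orP[] /eqP xE.
- exists b; first by rewrite !inE xE eq_sym ab (subsetP sub) // E !inE eqxx orbT.
  by rewrite xE -E.
- exists a; first by rewrite !inE xE ab (subsetP sub) // E !inE eqxx.
  by rewrite xE setUC -E.
Qed.

Lemma matching_partner_uniq M X x y z : M \in matchings X ->
  [set x; y] \in M -> [set x; z] \in M -> y = z.
Proof.
move=> Mp yM zM; have := Mp; rewrite inE => /andP[/and3P[_ tM _] _].
have : [set x; y] = [set x; z].
  by rewrite -(def_pblock tM yM (set21 _ _)) (def_pblock tM zM) // set21.
move=> E; have := matching_block Mp yM; have := matching_block Mp zM.
rewrite !cards2; case: eqP => // /eqP xz _; case: eqP => // /eqP xy _.
have : y \in [set x; z] by rewrite -E set22.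
by rewrite !inE eq_sym (negbTE xy) /= => /eqP.
Qed.

Lemma matching_sub M X e : M \in matchings X -> e \in M -> e \subset X.
Proof.
by rewrite inE => /andP[pM _]; exact: partitionS.
Qed.

Lemma matching_setU1 X x y M : x \in X -> y \in X :\ x ->
  M \in matchings (X :\: [set x; y]) -> [set x; y] |: M \in matchings X.
Proof.
move=> xX; rewrite !inE => /andP[yx yX] /andP[pM cM]; apply/andP; split.
  have -> : X = [set x; y] :|: X :\: [set x; y].
    apply/setP => z; rewrite !inE.
    by case: eqP => [->|]; case: eqP => [->|].
  apply: partitionU1 => //.
    by apply/set0Pn; exists x; rewrite set21.
  by rewrite -setI_eq0; apply/eqP/setP => z; rewrite !inE; case: orP.
apply/forall_inP => e; rewrite !inE => /orP[/eqP->|]; last exact: (forall_inP cM).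
by rewrite cards2 (eq_sym x) yx.
Qed.

Lemma matching_setD1 X x y M : M \in matchings X -> [set x; y] \in M ->
  M :\ [set x; y] \in matchings (X :\: [set x; y]).
Proof.
rewrite !inE => /andP[pM /forall_inP cM] eM; rewrite partitionD1 //=.
by apply/forall_inP => e; rewrite !inE => /andP[_ /cM].
Qed.

Lemma matching_notin X x y z M : M \in matchings (X :\: [set x; y]) -> [set x; z] \notin M.
Proof.
move=> Mp; apply/negP => /(matching_sub Mp)/subsetP/(_ x).
by rewrite !inE eqxx => /(_ isT).
Qed.

(** The basic recursion: a matching of [X] is the choice of a partner [y] of the
    point [x] together with a matching of the other points. *)
Lemma sum_matchings (V : nmodType) X x (F : {set {set T}} -> V) : x \in X ->
  \sum_(M in matchings X) F M =
  \sum_(y in X :\ x) \sum_(M in matchings (X :\: [set x; y])) F ([set x; y] |: M).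
Proof.
move=> xX.
transitivity (\sum_(M in matchings X) \sum_(y in X :\ x | [set x; y] \in M) F M).
  apply: eq_bigr => M Mp; have [y yX yM] := matching_partner Mp xX.
  rewrite (big_pred1 y) // => z; apply/andP/eqP => [[_ zM]|-> //].
  exact: matching_partner_uniq Mp zM yM.
rewrite (exchange_big_dep (mem (X :\ x))) /=; last by move=> M z _ /andP[].
apply: eq_bigr => y yX.
rewrite (reindex_onto (fun M => [set x; y] |: M) (fun M => M :\ [set x; y])) /=.
  apply: eq_bigl => M; rewrite yX setU11 !andbT /=.
  apply/andP/idP => [[h /eqP <-]|Mp].
    by apply: matching_setD1 => //; rewrite setU11.
  split; first exact: matching_setU1.
  by rewrite setU1K // (matching_notin _ Mp).
by move=> M /andP[_ /andP[_ h]]; rewrite finset.setD1K.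
Qed.

(** The double factorial [(n - 1) (n - 3) ...], or 0 for odd [n]. *)
Fixpoint nb_matchings (n : nat) : nat := match n with
  | 0 => 1 | 1 => 0 | (m.+1 as k).+1 => k * nb_matchings m end%N.

Lemma cardsD2 X x y : x \in X -> y \in X :\ x -> #|X| = #|X :\: [set x; y]|.+2.
Proof.
move=> xX yX; rewrite (cardsD1 x) xX (cardsD1 y) yX finset.setDDl.
by [].
Qed.

Lemma card_matchings X : #|matchings X| = nb_matchings #|X|.
Proof.
have [k] := ubnP #|X|; elim: k X => // k IH X Xk.
have [->|[x xX]] := set_0Vmem X.
  rewrite cards0 /=; apply/eqP/cards1P; exists set0; apply/setP => M; rewrite !inE.
  rewrite partition_set0; apply: andb_idr => /eqP->.
  by apply/forall_inP => e; rewrite inE.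
have {}Xk : (#|X :\ x| < k)%N by move: Xk; rewrite (cardsD1 x) xX.
rewrite -sum1_card (sum_matchings _ xX).
under eq_bigr => y yX do rewrite sum1_card.
rewrite (cardsD1 x X) xX add1n.
have [E|[z zX]] := set_0Vmem (X :\ x); first by rewrite E big_set0 cards0.
rewrite (eq_bigr (fun=> nb_matchings #|X :\ x|.-1)).
  by rewrite sum_nat_const; case: #|_| (cardsD1 z (X :\ x)); rewrite ?zX.
move=> y yX; have c := cardsD2 xX yX; rewrite (cardsD1 x) xX add1n in c.
move/eqP: c; rewrite eqSS => /eqP c; rewrite c IH //.
by move: Xk; rewrite c => /ltnW.
Qed.

Lemma nb_matchings_gt0 n : ~~ odd n -> (0 < nb_matchings n)%N.
Proof.
have [k] := ubnP n; elim: k n => // k IH [|[|n]] //= nk.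
by rewrite negbK => o; rewrite muln_gt0 /= IH // -ltnS ltnW.
Qed.

Variable R : realType.
Implicit Types (c l eps K : R) (F G : {set {set T}} -> R).

Definition avg X (F : {set {set T}} -> R) : R :=
  (\sum_(M in matchings X) F M) / #|matchings X|%:R.

Lemma card_matchings_gt0 X : ~~ odd #|X| -> (0 < #|matchings X|%:R :> R).
Proof. by move=> o; rewrite ltr0n card_matchings nb_matchings_gt0. Qed.

Lemma avg_rec X x F : ~~ odd #|X| -> x \in X ->
  avg X F = #|X|.-1%:R^-1 * \sum_(y in X :\ x)
    avg (X :\: [set x; y]) (fun M => F ([set x; y] |: M)).
Proof.
move=> oX xX; rewrite /avg (sum_matchings _ xX) mulr_suml mulr_sumr.
apply: eq_bigr => y yX; have c := cardsD2 xX yX.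
have -> : (#|matchings X| = #|X|.-1 * #|matchings (X :\: [set x; y])|)%N.
  by rewrite !card_matchings c.
by rewrite natrM invfM mulrCA mulrA.
Qed.

Lemma avg_const X (c : R) : ~~ odd #|X| -> avg X (fun=> c) = c.
Proof.
move=> o; rewrite /avg sumr_const -[c *+ _]mulr_natr mulfK //.
by rewrite gt_eqF // card_matchings_gt0.
Qed.

Lemma avgD X F G : avg X (fun M => F M + G M) = avg X F + avg X G.
Proof. by rewrite /avg big_split mulrDl. Qed.

Lemma avgZ X c F : avg X (fun M => c * F M) = c * avg X F.
Proof. by rewrite /avg -mulr_sumr mulrA. Qed.

Lemma avg_sum X (I : Type) (r : seq I) (P : pred I) (F : I -> {set {set T}} -> R) :
  avg X (fun M => \sum_(i <- r | P i) F i M) = \sum_(i <- r | P i) avg X (F i).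
Proof. by rewrite /avg exchange_big mulr_suml. Qed.

Lemma eq_avg X F G : {in matchings X, F =1 G} -> avg X F = avg X G.
Proof. by move=> h; congr (_ / _); apply: eq_bigr. Qed.

Lemma ler_avg X F G : {in matchings X, forall M, F M <= G M} -> avg X F <= avg X G.
Proof.
by move=> h; rewrite ler_wpM2r ?invr_ge0 //; apply: ler_sum.
Qed.

Lemma avg_dist X F G K : ~~ odd #|X| ->
  {in matchings X, forall M, `|F M - G M| <= K} -> `|avg X F - avg X G| <= K.
Proof.
move=> oX h; rewrite ler_distl lerBlDr -[X in _ + X](avg_const K oX) -avgD.
rewrite -[X in _ <= _ + X](avg_const K oX) -avgD.
by apply/andP; split; apply: ler_avg => M /h; rewrite ler_distl lerBlDr => /andP[].
Qed.

(** Stated for the insertion of one edge into an arbitrary set of edges; replacing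
    one edge of a matching by another then costs at most [2 * c]. *)
Definition edge_lipschitz (c : R) (F : {set {set T}} -> R) :=
  forall e M, `|F (e |: M) - F M| <= c.

Lemma odd_setD2 X x y : x \in X -> y \in X :\ x -> ~~ odd #|X| ->
  ~~ odd #|X :\: [set x; y]|.
Proof. by move=> xX yX; rewrite (cardsD2 xX yX) /= negbK. Qed.

(** Revealing the partner of [x] has a bounded effect on the mean: matchings
    containing [xy] and [y'z] correspond to matchings containing [xy'] and [yz],
    for a uniform [z], and corresponding matchings differ in four edges. *)
Lemma avg_switch X x y y' c F : ~~ odd #|X| -> 0 <= c -> edge_lipschitz c F ->
  x \in X -> y \in X :\ x -> y' \in X :\ x ->
  `|avg (X :\: [set x; y]) (fun M => F ([set x; y] |: M)) -
    avg (X :\: [set x; y']) (fun M => F ([set x; y'] |: M))| <= 4 * c.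
Proof.
move=> oX c0 lF xX yX y'X; have [->|yy'] := eqVneq y y'.
  by rewrite subrr normr0 mulr_ge0.
have oy := odd_setD2 xX yX oX; have oy' := odd_setD2 xX y'X oX.
have y'Y : y' \in X :\: [set x; y].
  by move: y'X; rewrite !inE negb_or (eq_sym y' y) yy' => /andP[-> ->].
have yY : y \in X :\: [set x; y'].
  by move: yX; rewrite !inE negb_or yy' => /andP[-> ->].
have EY : (X :\: [set x; y']) :\ y = (X :\: [set x; y]) :\ y'.
  by apply/setP => z; rewrite !inE; do 3![case: eqP => //=].
have cE : #|X :\: [set x; y']| = #|X :\: [set x; y]|.
  by apply/eqP; have := cardsD2 xX yX; rewrite (cardsD2 xX y'X) => /eqP; rewrite !eqSS.
rewrite (avg_rec _ oy y'Y) (avg_rec _ oy' yY) EY cE -mulrBr -sumrB normrM.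
rewrite ger0_norm ?invr_ge0 //.
have -> : #|X :\: [set x; y]|.-1 = #|(X :\: [set x; y]) :\ y'|.
  by rewrite (cardsD1 y' (X :\: _)) y'Y.
apply: (@le_trans _ _ (#|(X :\: [set x; y]) :\ y'|%:R^-1 *
   \sum_(z in (X :\: [set x; y]) :\ y') 4 * c)).
  rewrite ler_wpM2l ?invr_ge0 // (le_trans (ler_norm_sum _ _ _)) // ler_sum // => z zY.
  have -> : (X :\: [set x; y']) :\: [set y; z] = (X :\: [set x; y]) :\: [set y'; z].
    by apply/setP => w; rewrite !inE; do 4![case: eqP => //=].
  apply: avg_dist => [|M _]; first by apply: odd_setD2.
  have := lF [set x; y] ([set y'; z] |: M); have := lF [set y'; z] M.
  have := lF [set x; y'] ([set y; z] |: M); have := lF [set y; z] M.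
  rewrite !ler_norml; move=> /andP[? ?] /andP[? ?] /andP[? ?] /andP[? ?].
  by apply/andP; split; lra.
rewrite sumr_const -[(4 * c) *+ _]mulr_natl.
have [->|k0] := eqVneq #|(X :\: [set x; y]) :\ y'| 0%N.
  by rewrite mul0r mulr0 mulr_ge0.
by rewrite mulKf // pnatr_eq0.
Qed.

(** From [expR u * (1 - u) <= 1], since [1 - u <= expR (- u)]. *)
Lemma expR_le_quad (u : R) : `|u| <= 2^-1 -> expR u <= 1 + u + 2 * u ^+ 2.
Proof.
rewrite ler_norml => /andP[u1 u2].
have e1 := expR_ge1Dx (- u); have e0 := expR_gt0 u.
have E : expR u * expR (- u) = 1 by rewrite -expRD subrr expR0.
have h : expR u * (1 - u) <= 1 by rewrite -[leRHS]E ler_wpM2l // ltW.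
have h2 : 1 <= (1 + u + 2 * u ^+ 2) * (1 - u).
  have : 0 <= u ^+ 2 * (1 - 2 * u) by rewrite mulr_ge0 ?sqr_ge0 //; lra.
  by move=> ?; nra.
rewrite -(ler_pM2r (_ : 0 < 1 - u)); last by lra.
exact: le_trans h h2.
Qed.

(** Azuma's argument: conditionally on the partner of one half-edge, the mean moves
    by at most [4 * c], with average 0, and the induction hypothesis handles the
    remaining matching, for which the function is still Lipschitz. *)
Lemma avg_expR k X F c l : #|X| = k.*2 -> 0 <= c -> edge_lipschitz c F ->
  4 * c * `|l| <= 2^-1 ->
  avg X (fun M => expR (l * (F M - avg X F))) <= expR (32 * c ^+ 2 * l ^+ 2 * k%:R).
Proof.
move=> Xk c0 lF hl; elim: k X F Xk lF => [|k IH] X F Xk lF.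
  have /eqP X0 : #|X| == 0%N by rewrite Xk.
  have oX : ~~ odd #|X| by rewrite X0.
  rewrite mulr0 expR0 -[leRHS](avg_const 1 oX); apply: ler_avg => M MX.
  have N0 : matchings X = [set M].
    apply/eqP; rewrite eq_sym eqEcard sub1set MX card_matchings X0.
    by rewrite cards1.
  by rewrite [avg X F]/avg N0 big_set1 cards1 divr1 subrr mulr0 expR0.
have oX : ~~ odd #|X| by rewrite Xk odd_double.
have [x xX] : exists x, x \in X by apply/set0Pn; rewrite -card_gt0 Xk.
pose g y := avg (X :\: [set x; y]) (fun M => F ([set x; y] |: M)).
have cX : #|X|.-1 = #|X :\ x| by rewrite (cardsD1 x X) xX.
have c1 : 0 < #|X|.-1%:R :> R by rewrite ltr0n Xk doubleS.
have gE : avg X F = #|X|.-1%:R^-1 * \sum_(y in X :\ x) g y by exact: avg_rec.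
have gd y : y \in X :\ x -> `|g y - avg X F| <= 4 * c.
  move=> yX; rewrite gE.
  have -> : g y = #|X|.-1%:R^-1 * \sum_(z in X :\ x) g y.
    by rewrite sumr_const -cX -[g y *+ _]mulr_natl mulKf // gt_eqF.
  rewrite -mulrBr -sumrB normrM ger0_norm ?invr_ge0 // mulrC ler_pdivrMr //.
  rewrite (le_trans (ler_norm_sum _ _ _)) // cX mulr_natr -sumr_const.
  by apply: ler_sum => z zX; apply: avg_switch.
rewrite (avg_rec _ oX xX).
pose s := 2 * (4 * c * `|l|) ^+ 2.
have sE : s = 32 * c ^+ 2 * l ^+ 2.
  by rewrite /s !exprMn real_normK ?num_real // -!natrX; ring.
have step y : y \in X :\ x ->
   avg (X :\: [set x; y]) (fun M => expR (l * (F ([set x; y] |: M) - avg X F))) <=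
   (1 + l * (g y - avg X F) + s) * expR (s * k%:R).
  move=> yX.
  have -> : avg (X :\: [set x; y]) (fun M => expR (l * (F ([set x; y] |: M) - avg X F)))
    = expR (l * (g y - avg X F)) *
      avg (X :\: [set x; y]) (fun M => expR (l * (F ([set x; y] |: M) - g y))).
    rewrite -avgZ; apply: eq_avg => M _; rewrite -expRD; congr expR; ring.
  have lu : `|l * (g y - avg X F)| <= 4 * c * `|l|.
    by rewrite normrM mulrC ler_wpM2r // gd.
  (* The linear term is kept since it cancels when averaged over y. *)
  have e1 : expR (l * (g y - avg X F)) <= 1 + l * (g y - avg X F) + s.
    apply: (le_trans (expR_le_quad (le_trans lu hl))).
    rewrite lerD2l ler_pM2l // -real_normK ?num_real //.
    by rewrite lerXn2r // nnegrE ?normr_ge0 // mulr_ge0 // mulr_ge0.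
  apply: ler_pM => //.
    rewrite -[leLHS](avg_const 0 (odd_setD2 xX yX oX)).
    by apply: ler_avg => M _; exact: expR_ge0.
  rewrite sE; apply: IH.
    by apply/eqP; have := cardsD2 xX yX; rewrite Xk doubleS => /eqP; rewrite !eqSS eq_sym.
  by move=> e M; rewrite setUCA; apply: lF.
rewrite mulrC ler_pdivrMr //.
apply: (le_trans (ler_sum _ step)).
rewrite -mulr_suml big_split /= big_split /= !sumr_const -mulr_sumr sumrB sumr_const -!cX.
have -> : \sum_(i in X :\ x) g i = avg X F *+ #|X|.-1.
  by rewrite gE -[RHS]mulr_natl mulVKf // gt_eqF.
rewrite subrr mulr0 addr0 -mulrnDl -[(1 + s) *+ _]mulr_natr mulrAC.
rewrite ler_pM2r // -sE -[k.+1]addn1 natrD mulrDr mulr1 expRD mulrC.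
rewrite ler_wpM2l ?expR_ge0 //.
exact: expR_ge1Dx.
Qed.

(** Chernoff's bound, with the optimal [l] in [avg_expR]; the condition
    [eps <= 4 * c] keeps [l] in the range allowed there. *)
Lemma avg_tail X F c eps : ~~ odd #|X| -> 0 < c -> edge_lipschitz c F ->
  0 < eps -> eps <= 4 * c ->
  avg X (fun M => (eps * #|X|%:R <= F M - avg X F)%R%:R) <=
    expR (- (eps ^+ 2 / (64 * c ^+ 2) * #|X|%:R)).
Proof.
move=> oX c0 lF e0 ec.
pose l := eps / (32 * c ^+ 2).
have c2 : 0 < c ^+ 2 by rewrite exprn_gt0.
have l0 : 0 < l by rewrite divr_gt0 // mulr_gt0.
have XE : #|X| = (#|X|./2).*2 by rewrite even_halfK.
have hl : 4 * c * `|l| <= 2^-1.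
  rewrite (ger0_norm (ltW l0)) /l.
  have -> : 4 * c * (eps / (32 * c ^+ 2)) = eps / (8 * c).
    by field; rewrite gt_eqF.
  by rewrite ler_pdivrMr ?mulr_gt0 //; lra.
have h := avg_expR XE (ltW c0) lF hl.
have m : avg X (fun M => (eps * #|X|%:R <= F M - avg X F)%R%:R) <=
   avg X (fun M => expR (- (l * (eps * #|X|%:R))) * expR (l * (F M - avg X F))).
  apply: ler_avg => M _; rewrite -expRD.
  case: (boolP (_ <= _ - _)) => /= hM; last exact: expR_ge0.
  rewrite -[leLHS]expR0 ler_expR addrC subr_ge0 ler_pM2l //.
rewrite avgZ in m; apply: (le_trans m).
apply: (le_trans (ler_wpM2l (expR_ge0 _) h)).
rewrite -expRD ler_expR.
have -> : #|X|%:R = 2 * #|X|./2%:R :> R by rewrite {1}XE -muln2 natrM mulrC.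
rewrite /l -subr_ge0.
have -> : - (eps ^+ 2 / (64 * c ^+ 2) * (2 * #|X|./2%:R)) -
  (- (eps / (32 * c ^+ 2) * (eps * (2 * #|X|./2%:R))) +
   32 * c ^+ 2 * (eps / (32 * c ^+ 2)) ^+ 2 * #|X|./2%:R) = 0 :> R.
  by field; rewrite gt_eqF.
by [].
Qed.

Lemma avg_tail_norm X F c eps : ~~ odd #|X| -> 0 < c -> edge_lipschitz c F ->
  0 < eps -> eps <= 4 * c ->
  avg X (fun M => (eps * #|X|%:R <= `|F M - avg X F|)%R%:R) <=
    2 * expR (- (eps ^+ 2 / (64 * c ^+ 2) * #|X|%:R)).
Proof.
move=> oX c0 lF e0 ec.
have lF' : edge_lipschitz c (fun M => -1 * F M).
  by move=> e M; rewrite -mulrBr normrM normrN1 mul1r.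
have h1 := avg_tail oX c0 lF e0 ec.
have h2 := avg_tail oX c0 lF' e0 ec.
rewrite mulr2n mulrDl mul1r; apply: le_trans (lerD h1 h2); rewrite -avgD.
apply: ler_avg => M _; rewrite avgZ -mulrBr mulN1r.
case: (boolP (_ <= `|_|)) => /=; last by rewrite addr_ge0.
by rewrite ler_normr => /orP[->|->] /=; rewrite ?lerDl ?lerDr.
Qed.

Lemma avg_pair X x y : ~~ odd #|X| -> x \in X -> y \in X :\ x ->
  avg X (fun M => ([set x; y] \in M)%:R) = #|X|.-1%:R^-1.
Proof.
move=> oX xX yX; rewrite (avg_rec _ oX xX) -[RHS]mulr1; congr (_ * _).
rewrite (bigD1 y) //= [X in _ + X]big1 => [|z /andP[zX zy]].
  rewrite addr0 -[RHS](avg_const 1 (odd_setD2 xX yX oX)).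
  by apply: eq_avg => M _; rewrite setU11.
rewrite -[RHS](avg_const 0 (odd_setD2 xX zX oX)); apply: eq_avg => M Mp.
rewrite !inE (negbTE (matching_notin _ Mp)) orbF; case: eqP => // E.
have : y \in [set x; z] by rewrite -E set22.
by rewrite !inE (eq_sym y z) (negbTE zy) orbF => /eqP yx; move: yX; rewrite yx !inE eqxx.
Qed.

(** * Probability that two sets of half-edges are linked *)

Definition crossing A B M := [exists a in A, exists b in B, [set a; b] \in M].

Lemma crossing_rec X A B x y M : x \in A -> [disjoint A & B] ->
  y \in X :\ x -> M \in matchings (X :\: [set x; y]) ->
  crossing A B ([set x; y] |: M) = (y \in B) || crossing (A :\: [set x; y]) B M.
Proof.
move=> xA dAB yX Mp; apply/idP/orP => [|[yB|]].
- move=> /exists_inP[a aA /exists_inP[b bB]]; rewrite !inE => /orP[/eqP E|abM].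
    left; have : b \in [set x; y] by rewrite -E set22.
    rewrite !inE => /orP[/eqP bx|/eqP <- //].
    by have := disjointFr dAB xA; rewrite -bx bB.
  right; apply/exists_inP; exists a; last by apply/exists_inP; exists b.
  have /subsetP/(_ a) := matching_sub Mp abM.
  by rewrite !inE eqxx aA andbT => /(_ isT)/andP[].
- by apply/exists_inP; exists x => //; apply/exists_inP; exists y; rewrite // setU11.
- move=> /exists_inP[a]; rewrite !inE => /andP[_ aA] /exists_inP[b bB abM].
  by apply/exists_inP; exists a => //; apply/exists_inP; exists b; rewrite // inE abM orbT.
Qed.

Definition no_crossing X A B : R := avg X (fun M => (~~ crossing A B M)%:R).

Lemma sumr_mem_card X A : \sum_(y in X) (y \in A)%:R = #|X :&: A|%:R :> R.
Proof.
rewrite -natr_sum; congr (_%:R).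
rewrite -sum1_card [RHS](eq_bigl (fun i => (i \in X) && (i \in A))); last by move=> i; rewrite inE.
by rewrite [RHS]big_mkcondr; apply: eq_bigr => i _; case: ifP.
Qed.

(** The points of [A] are matched one after the other.  The partner of a point is
    outside [B] with probability [1 - #|B| / (m - 1)], where [m] is the number of
    points left, which decreases from [#|X|] to at least [#|X| - 2 #|A|]; this
    suggests the geometric bounds.  In the upper bound a partner in [A] uses up
    two points of [A] at the price of one factor [u]; the slack [#|A| + #|B|] in
    the hypothesis on [u] pays for it. *)
Lemma no_crossing_bounds X A B (p u : R) : ~~ odd #|X| -> A \subset X -> B \subset X ->
  [disjoint A & B] -> 0 <= p <= 1 -> 0 <= u <= 1 ->
  (1 - u) * (#|X| + #|A| + #|B|)%:R <= #|B|%:R ->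
  #|B|%:R <= (1 - p) * (#|X|%:R - #|A|.*2%:R) ->
  p ^+ #|A| <= no_crossing X A B <= u ^+ #|A|.
Proof.
move=> oX AX BX dAB /andP[p0 p1] /andP[u0 u1].
have [k] := ubnP #|A|; elim: k X A oX AX BX dAB => // k IH X A oX AX BX dAB Ak hu hp.
have [A0|[x xA]] := set_0Vmem A.
  rewrite A0 cards0 !expr0 /no_crossing.
  have -> : avg X (fun M => (~~ crossing set0 B M)%:R) = 1.
    rewrite -[RHS](avg_const 1 oX); apply: eq_avg => M _.
    suff -> : crossing set0 B M = false by [].
    by apply/exists_inP => -[a]; rewrite inE.
  by rewrite lexx.
have xX := subsetP AX _ xA.
have cA : #|A| = #|A :\ x|.+1 by rewrite (cardsD1 x) xA.
have cX : #|X| = #|X :\ x|.+1 by rewrite (cardsD1 x) xX.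
have X2 : (0 < #|X :\ x|)%N by move: oX; rewrite cX; case: #|_|.
have X2' : 0 < #|X :\ x|%:R :> R by rewrite ltr0n.
have xB : x \notin B by rewrite (disjointFr dAB xA).
have IH' y : y \in X :\ x -> y \notin B ->
  p ^+ #|A :\: [set x; y]| <= no_crossing (X :\: [set x; y]) (A :\: [set x; y]) B
    <= u ^+ #|A :\: [set x; y]|.
  move=> yX yB; have c2 := cardsD2 xX yX.
  have cA' : #|A :\ x| = ((y \in A) + #|A :\: [set x; y]|)%N.
    rewrite (cardsD1 y (A :\ x)) finset.setDDl !inE; congr (_ + _)%N.
    by move: yX; rewrite !inE => /andP[->].
  apply: IH.
  - exact: odd_setD2.
  - by apply: setSD.
  - apply/subsetP => z zB; rewrite !inE (subsetP BX) // andbT negb_or.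
    by apply/andP; split; apply: contraTneq zB => ->.
  - by apply: disjointWl dAB; apply: subsetDl.
  - by move: Ak; rewrite cA cA' ltnS; apply: leq_ltn_trans; rewrite leq_addl.
  - apply: le_trans hu; rewrite ler_wpM2l ?subr_ge0 // ler_nat.
    by rewrite leq_add2r leq_add // ?subset_leq_card // subsetDl.
  - apply: (le_trans hp); rewrite ler_wpM2l ?subr_ge0 // c2 cA cA'.
    set m := #|X :\: _|; set n := #|A :\: _|.
    have -> : m.+2%:R = m%:R + 2 :> R by rewrite -addn2 natrD.
    have -> : (((y \in A) + n).+1.*2)%:R = 2 * ((y \in A)%:R + n%:R + 1) :> R.
      by rewrite -muln2 natrM -addn1 !natrD mulrC.
    have -> : n.*2%:R = 2 * n%:R :> R by rewrite -muln2 natrM mulrC.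
    by have : 0 <= (y \in A)%:R :> R by []; lra.
rewrite /no_crossing (avg_rec _ oX xX).
rewrite (eq_bigr (fun y => if y \in B then 0 else
   no_crossing (X :\: [set x; y]) (A :\: [set x; y]) B)); last first.
  move=> y yX; case: ifP => yB.
    rewrite -[RHS](avg_const 0 (odd_setD2 xX yX oX)); apply: eq_avg => M Mp.
    by rewrite (crossing_rec xA dAB yX Mp) yB.
  by apply: eq_avg => M Mp; rewrite (crossing_rec xA dAB yX Mp) yB.
have sB : \sum_(y in X :\ x) (y \in B)%:R = #|B|%:R :> R.
  rewrite sumr_mem_card.
  suff -> : (X :\ x) :&: B = B by [].
  apply/setIidPr/subsetP => z zB.
  rewrite !inE (subsetP BX) // andbT; by apply: contraTneq zB => ->.
have sA : \sum_(y in X :\ x) (y \in A)%:R = #|A :\ x|%:R :> R.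
  rewrite sumr_mem_card.
  suff -> : (X :\ x) :&: A = A :\ x by [].
  apply/setP => z.
  rewrite !inE; case: eqP => //= _; apply: andb_idl; exact: (subsetP AX).
have cAy y : y \in X :\ x -> #|A :\: [set x; y]| = (#|A :\ x| - (y \in A))%N.
  move=> yX; rewrite (cardsD1 y (A :\ x)) finset.setDDl !inE.
  by move: yX; rewrite !inE => /andP[-> _]; rewrite addKn.
rewrite cX /= cA !exprS.
apply/andP; split.
- rewrite ler_pdivlMl //.
  apply: (@le_trans _ _ (\sum_(y in X :\ x) (1 - (y \in B)%:R) * p ^+ #|A :\ x|)); last first.
    apply: ler_sum => y yX; case: ifPn => yB; first by rewrite subrr mul0r.
    have /andP[+ _] := IH' y yX yB; apply: le_trans.
    by rewrite subr0 mul1r cAy // ler_wiXn2l // leq_subr.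
  rewrite -mulr_suml sumrB sB sumr_const mulrA ler_wpM2r ?exprn_ge0 //.
  have hn : (1 - p) * (#|X|%:R - #|A|.*2%:R) <= (1 - p) * #|X :\ x|%:R.
    rewrite ler_wpM2l ?subr_ge0 // cX cA doubleS -natr1 lerBlDr lerD2l.
    by rewrite (_ : 1 = 1%:R :> R) // ler_nat.
  by have := le_trans hp hn; lra.
- rewrite ler_pdivrMl //.
  apply: (@le_trans _ _ (\sum_(y in X :\ x) ((1 - (y \in B)%:R) * u ^+ #|A :\ x| +
      (y \in A)%:R * (u ^+ #|A :\ x|.-1 - u ^+ #|A :\ x|)))).
    apply: ler_sum => y yX; case: ifPn => yB.
      by rewrite (disjointFl dAB yB) subrr !mul0r addr0.
    have /andP[_ h] := IH' y yX yB; apply: (le_trans h).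
    rewrite subr0 mul1r cAy //; case: (y \in A); first by rewrite subn1 mul1r subrKC.
    by rewrite subn0 mul0r addr0.
  rewrite big_split /= -!mulr_suml sumrB sB sA sumr_const.
  have nS (m : nat) : m.+1%:R = m%:R + 1 :> R by rewrite natr1.
  move: hu; rewrite cX cA !natrD (nS #|X :\ x|) (nS #|A :\ x|).
  rewrite -[1 *+ _]/(#|X :\ x|%:R).
  case: #|A :\ x| => [|a] /=.
    rewrite !expr0 subrr !mulr0 addr0 !mulr1 => hu.
    have : 0 <= (1 - u) * (2 + #|B|%:R) by rewrite mulr_ge0 ?subr_ge0 ?addr_ge0.
    by lra.
  rewrite exprS (nS a); set w := u ^+ a => hu; have w0 : 0 <= w by exact: exprn_ge0.
  set b := #|B|%:R; set n := #|X :\ x|%:R in hu *.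
  have -> : (n - b) * (u * w) + (a%:R + 1) * (w - u * w) =
            w * ((n - b) * u + (a%:R + 1) * (1 - u)) by ring.
  have -> : n * (u * (u * w)) = w * (n * u ^+ 2) by ring.
  rewrite ler_wpM2l //.
  have : 0 <= n * (1 - u) ^+ 2 by rewrite mulr_ge0 ?sqr_ge0.
  rewrite -/b in hu; nra.
Qed.

(** The derivative of [expR (- s)] with respect to [ln s] is [- s * expR (- s)], of
    absolute value at most 1, so a relative error [th] in [s] is harmless. *)
Lemma expR_sub_le (s t th : R) : 0 <= s -> s <= t -> 0 <= th -> t <= (1 + th) * s ->
  0 <= expR (- s) - expR (- t) <= th.
Proof.
move=> s0 st th0 tth; rewrite subr_ge0 ler_expR lerN2 st /=.
have -> : - t = - s + (s - t) by ring.
rewrite expRD -[X in X - _]mulr1 -mulrBr.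
have h1 : 1 - expR (s - t) <= th * s by have := expR_ge1Dx (s - t); lra.
have h2 : expR (- s) * s <= 1.
  have := expR_ge1Dx s; have := expR_gt0 (- s).
  have E : expR (- s) * expR s = 1 by rewrite -expRD addrC subrr expR0.
  by move=> e0 e1; nra.
apply: (le_trans (ler_wpM2l (expR_ge0 _) h1)).
rewrite mulrCA -[leRHS]mulr1 ler_wpM2l //.
Qed.

(** Both geometric bounds of [no_crossing_bounds] are exponentials up to a relative
    error [O (eta)] in the exponent. *)
Lemma no_crossing_expR X A B (eta : R) : ~~ odd #|X| -> A \subset X -> B \subset X ->
  [disjoint A & B] -> (0 < #|X|)%N -> eta <= 6^-1 ->
  #|A|%:R <= eta * #|X|%:R -> #|B|%:R <= eta * #|X|%:R ->
  `|no_crossing X A B - expR (- (#|A|%:R * #|B|%:R / #|X|%:R))| <= 6 * eta.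
Proof.
move=> oX AX BX dAB X0 eta6 hA hB.
have N0 : 0 < #|X|%:R :> R by rewrite ltr0n.
set N := #|X|%:R in hA hB N0 *; set a := #|A|%:R in hA *; set b := #|B|%:R in hB *.
have a0 : 0 <= a by []. have b0 : 0 <= b by [].
have eta0 : 0 <= eta by rewrite -(pmulr_lge0 _ N0) (le_trans b0).
have D1 : 0 < N + a + b by lra.
have eN : eta * N <= 6^-1 * N by rewrite ler_wpM2r // ltW.
have D2 : 0 < N - a *+ 2 by rewrite mulr2n; lra.
have D3 : 0 < N - a *+ 2 - b by rewrite mulr2n; lra.
(* The values for which the two hypotheses of no_crossing_bounds are equalities. *)
pose u := 1 - b / (N + a + b); pose p := 1 - b / (N - a *+ 2).
have hu1 : 0 <= b / (N + a + b) by rewrite divr_ge0 // ltW.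
have hp1 : 0 <= b / (N - a *+ 2) by rewrite divr_ge0 // ltW.
have hu2 : b / (N + a + b) <= 1 by rewrite ler_pdivrMr // mul1r; lra.
have hp2 : b / (N - a *+ 2) <= 1 by rewrite ler_pdivrMr // mul1r; lra.
have := @no_crossing_bounds X A B p u oX AX BX dAB.
rewrite /p /u !subKr !subr_ge0 hp2 hu2 !gerBl hp1 hu1 !natrD -/N -/a -/b.
rewrite divfK ?gt_eqF // lexx -muln2 natrM mulr_natr -/a divfK ?gt_eqF // lexx.
move=> /(_ isT isT isT isT)/andP[lo up].
have up' : no_crossing X A B <= expR (- (a * b / (N + a + b))).
  apply: (le_trans up); have e := expR_ge1Dx (- (b / (N + a + b))).
  apply: (@le_trans _ _ (expR (- (b / (N + a + b))) ^+ #|A|)).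
    by apply: lerXn2r; rewrite ?nnegrE ?expR_ge0 // subr_ge0.
  by rewrite -expRM_natl // mulrN -/a mulrA.
have lo' : expR (- (a * b / (N - a *+ 2 - b))) <= no_crossing X A B.
  apply: le_trans lo; rewrite -mulrA -mulrN -/a expRM_natl.
  apply: lerXn2r; rewrite ?nnegrE ?expR_ge0 // ?subr_ge0 //.
  have e := expR_ge1Dx (b / (N - a *+ 2 - b)).
  have E : expR (- (b / (N - a *+ 2 - b))) * expR (b / (N - a *+ 2 - b)) = 1.
    by rewrite -expRD addrC subrr expR0.
  have E2 : (1 - b / (N - a *+ 2)) * (1 + b / (N - a *+ 2 - b)) = 1.
    move: (N - a *+ 2) D2 D3 => D D2 D3.
    by field; rewrite !gt_eqF.
  have q0 : 0 < 1 + b / (N - a *+ 2 - b) by rewrite ltr_pwDl // divr_ge0 // ltW.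
  by rewrite -(ler_pM2r q0) E2 -[leRHS]E ler_wpM2l ?expR_ge0.
have t0 : 0 <= a * b / N by rewrite divr_ge0 ?mulr_ge0 // ltW.
have /andP[_ h1] : 0 <= expR (- (a * b / (N + a + b))) - expR (- (a * b / N)) <= 2 * eta.
  apply: expR_sub_le.
  - by rewrite divr_ge0 ?mulr_ge0 // ltW.
  - by rewrite ler_wpM2l ?mulr_ge0 // lef_pV2 ?posrE //; lra.
  - by rewrite mulr_ge0.
  rewrite mulrCA ler_wpM2l ?mulr_ge0 // ler_pdivlMr // ler_pdivrMl //; nra.
have /andP[_ h2] : 0 <= expR (- (a * b / N)) - expR (- (a * b / (N - a *+ 2 - b))) <= 6 * eta.
  apply: expR_sub_le => //.
  - by rewrite ler_wpM2l ?mulr_ge0 // lef_pV2 ?posrE //; rewrite mulr2n; lra.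
  - by rewrite mulr_ge0.
  rewrite mulrCA ler_wpM2l ?mulr_ge0 // ler_pdivlMr // ler_pdivrMl //.
  rewrite mulr2n; nra.
by rewrite ler_norml; apply/andP; split; lra.
Qed.

End Matchings.

(** * The configuration model *)

Section ConfigurationModel.
Import boot.fintype boot.finset.
Local Open Scope set_scope.
Local Open Scope ring_scope.
Variables (R : realType) (n : nat) (d : n.-tuple nat).
Notation H := (half_edge d).
Implicit Types (i j v : 'I_n) (e : {set H}) (M : {set {set H}}).

Definition owned i : {set H} := [set h | tag h == i].

Lemma card_owned i : #|owned i| = tnth d i.
Proof.
have inj : injective (fun k : 'I_(tnth d i) => Tagged (fun j => 'I_(tnth d j)) k).
  by move=> x y /eqP; rewrite eq_Tagged => /eqP.
rewrite -[RHS](card_ord (tnth d i)) -(card_imset predT inj).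
apply: eq_card => h; rewrite inE; apply/eqP/imsetP => [E|[k _ ->] //].
by case: h E => j k /= E; subst j; exists k.
Qed.

Lemma sum_half_edge (V : nmodType) (F : 'I_n -> V) :
  \sum_(h : H) F (tag h) = \sum_i F i *+ tnth d i.
Proof.
rewrite (partition_big (fun h : H => tag h) predT) //=; apply: eq_bigr => i _.
rewrite (eq_bigr (fun=> F i)) => [|h /eqP-> //].
by rewrite -card_owned -sumr_const; apply: eq_bigl => h; rewrite inE.
Qed.

Lemma card_half_edge : #|H| = ell d.
Proof.
rewrite -sum1_card; apply: etrans (sum_half_edge (fun=> 1%N)) _.
by apply: eq_bigr => i _; rewrite -[LHS]/(_ *+ _) natn.
Qed.

Definition owners e : {set 'I_n} := [set tag h | h in e].

Lemma owners2 a b : owners [set a; b] = [set tag a; tag b].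
Proof. by rewrite /owners imsetU1 imset_set1. Qed.

Lemma eq_set2 (T : finType) (x y i j : T) :
  ([set x; y] == [set i; j]) = (x == i) && (y == j) || (y == i) && (x == j).
Proof.
apply/eqP/orP => [E|[/andP[/eqP-> /eqP->] //|/andP[/eqP-> /eqP->]]]; last exact: setUC.
have : x \in [set i; j] by rewrite -E set21.
have : y \in [set i; j] by rewrite -E set22.
have : i \in [set x; y] by rewrite E set21.
have : j \in [set x; y] by rewrite E set22.
rewrite !inE (eq_sym j x) (eq_sym j y) (eq_sym i x) (eq_sym i y).
by case: (x == i); case: (x == j); case: (y == i); case: (y == j) => //=; auto.
Qed.

Lemma matching_set2 X M e : M \in matchings X -> e \in M ->
  exists a b, a != b /\ e = [set a; b].
Proof. by move=> Mp eM; apply/cards2P; rewrite (matching_block Mp eM). Qed.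

Lemma CM_graphE M i j : CM_graph M i j = (\sum_(e in M) (owners e == [set i; j]))%N.
Proof.
rewrite mxE -sum1_card (eq_bigl (fun e => (e \in M) && (owners e == [set i; j]))).
  by rewrite big_mkcondr; apply: eq_bigr => e _; case: eqP.
by move=> e; rewrite !inE.
Qed.

Lemma CM_graph_sym M i j : CM_graph M i j = CM_graph M j i.
Proof. by rewrite !CM_graphE setUC. Qed.

Lemma CM_graph_gt0 M i j :
  (0 < CM_graph M i j)%N = [exists e in M, owners e == [set i; j]].
Proof.
rewrite mxE card_gt0; apply/set0Pn/exists_inP => [[e]|[e eM h]].
  by rewrite !inE => /andP[eM h]; exists e.
by exists e; rewrite !inE eM.
Qed.

Lemma CM_graph_crossing X M i j : M \in matchings X -> i != j ->
  (0 < CM_graph M i j)%N = crossing (owned i) (owned j) M.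
Proof.
move=> Mp ij; rewrite CM_graph_gt0; apply/exists_inP/exists_inP => [[e eM]|[a]].
  have [a [b [_ E]]] := matching_set2 Mp eM; rewrite E owners2 eq_set2 => h; subst e.
  case/orP: h => /andP[/eqP ha /eqP hb].
    by exists a; rewrite ?inE ?ha //; apply/exists_inP; exists b; rewrite ?inE ?hb.
  by exists b; rewrite ?inE ?ha //; apply/exists_inP; exists a; rewrite ?inE ?hb // setUC.
rewrite inE => /eqP ha /exists_inP[b]; rewrite inE => /eqP hb eM.
by exists [set a; b] => //; rewrite owners2 ha hb.
Qed.

Lemma sum_matching_block X M (F : H -> nat) : M \in matchings X ->
  (\sum_(h in X) F h = \sum_(e in M) \sum_(h in e) F h)%N.
Proof. by rewrite inE => /andP[pM _]; rewrite (set_partition_big _ pM). Qed.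

(** Both half-edges of a loop belong to the same vertex, which is why a loop
    counts twice in [vdeg]. *)
Lemma CM_vdeg M v : M \in perfect_matchings d -> vdeg (CM_graph M) v = tnth d v.
Proof.
move=> Mp; rewrite -card_owned -sum1_card.
transitivity (\sum_(h in [set: H]) (tag h == v))%N; last first.
  rewrite big_mkcond [RHS]big_mkcond; apply: eq_bigr => h _; rewrite !inE.
  by case: eqP.
rewrite (sum_matching_block _ Mp) /vdeg.
rewrite (eq_bigr _ (fun j _ => CM_graphE M v j)) CM_graphE exchange_big /= -big_split /=; apply: eq_bigr => e eM.
have [a [b [ab ->]]] := matching_set2 Mp eM.
rewrite owners2 big_setU1 ?inE //= big_set1.
under eq_bigr => j _ do rewrite eq_set2.
rewrite eq_set2.
have [av|av] := eqVneq (tag a) v; have [bv|bv] := eqVneq (tag b) v => /=.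
- rewrite av bv (bigD1 v) //= eqxx big1 // => j; rewrite eq_sym => /negbTE ->.
  by [].
- rewrite (bigD1 (tag b)) //= eqxx big1 // => j; rewrite eq_sym => /negbTE ->.
  by [].
- rewrite (bigD1 (tag a)) //= eqxx big1 // => j; rewrite eq_sym => /negbTE ->.
  by [].
- by rewrite big1.
Qed.

Lemma nb_edges_sym (G : multigraph n) : (forall i j, G i j = G j i) ->
  (\sum_i \sum_j G i j = (nb_edges G).*2 + \sum_i G i i)%N.
Proof.
move=> sG.
have -> : (\sum_i \sum_j G i j = \sum_(i < n) (\sum_(j < n | i < j) G i j +
     (\sum_(j < n | j < i) G i j + G i i)))%N.
  apply: eq_bigr => i _; rewrite (bigID (fun j : 'I_n => (i < j)%N)) /=; congr (_ + _)%N.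
  rewrite (bigID (fun j : 'I_n => (j < i)%N)) /=; congr (_ + _)%N.
    by apply: eq_bigl => j; case: ltngtP.
  rewrite (big_pred1 i) // => j; rewrite -!leqNgt -eqn_leq eq_sym.
  by [].
rewrite big_split /= big_split /= addnA -addnn; congr (_ + _ + _)%N.
rewrite (exchange_big_dep predT) //=; apply: eq_bigr => i _.
by apply: eq_bigr => j _; rewrite sG.
Qed.

Definition loops (G : multigraph n) : nat := (\sum_i G i i)%N.

Lemma CM_nb_edges M : M \in perfect_matchings d ->
  ell d = ((nb_edges (CM_graph M)).*2 + (loops (CM_graph M)).*2)%N.
Proof.
move=> Mp; rewrite /ell; under eq_bigr => v _ do rewrite -(CM_vdeg v Mp) /vdeg.
rewrite big_split /= nb_edges_sym; last by move=> i j; rewrite CM_graph_sym.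
by rewrite -addnA addnn.
Qed.

Lemma CM_lawE (A : set (multigraph n)) :
  CM_law R d A = avg [set: H] (fun M => (CM_graph M \in A)%:R).
Proof.
rewrite /CM_law /avg; congr (_ / _); rewrite -natr_sum -sum1_card; congr (_%:R).
rewrite (eq_bigl (fun M => (M \in matchings [set: H]) && (CM_graph M \in A))).
  by rewrite big_mkcondr; apply: eq_bigr => e _; case: ifP.
by move=> M; rewrite !inE.
Qed.

Hypothesis ell_even : ~~ odd (ell d).

Lemma odd_half_edges : ~~ odd #|[set: H]|.
Proof. by rewrite cardsT card_half_edge. Qed.

Lemma CM_lawT : CM_law R d classical_sets.setT = 1.
Proof.
rewrite CM_lawE -[RHS](avg_const 1 odd_half_edges); apply: eq_avg => M _.
by rewrite mem_setT.
Qed.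

(** An edge links at most one unordered pair of vertices, hence at most two ordered
    pairs. *)
Lemma sum_owners_le e : \sum_i \sum_j (owners e == [set i; j])%:R <= 2 :> R.
Proof.
have [/existsP[x /existsP[y /eqP ->]]|] := boolP [exists x, exists y, owners e == [set x; y]].
  apply: (@le_trans _ _ (\sum_i \sum_j (((x == i)%:R * (y == j)%:R) + ((y == i)%:R * (x == j)%:R) : R))).
    apply: ler_sum => i _; apply: ler_sum => j _; rewrite eq_set2.
    by do 4![case: eqP => _ /=]; rewrite ?(mulr0, mul0r, mulr1, addr0, add0r) ?lerDl.
  have E (z : 'I_n) : \sum_i (z == i)%:R = 1 :> R.
    by rewrite (bigD1 z) //= eqxx big1 ?addr0 // => i; rewrite eq_sym => /negbTE ->.
  under eq_bigr do rewrite big_split -!mulr_sumr !E.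
  by rewrite big_split -!mulr_suml !E !mulr1.
rewrite negb_exists => /forallP h; rewrite big1 // => i _; rewrite big1 // => j _.
by have := h i; rewrite negb_exists => /forallP/(_ j)/negbTE ->.
Qed.

Definition links (S T : {set 'I_n}) M : R :=
  \sum_(i in S) \sum_(j in T) (0 < CM_graph M i j)%N%:R.

Lemma links_lipschitz S T : edge_lipschitz 2 (links S T).
Proof.
move=> e M; rewrite /links -sumrB (le_trans (ler_norm_sum _ _ _)) //.
apply: le_trans (sum_owners_le e); rewrite big_mkcond /=; apply: ler_sum => i _.
case: ifP => _; last by apply: sumr_ge0.
rewrite -sumrB (le_trans (ler_norm_sum _ _ _)) // big_mkcond /=; apply: ler_sum => j _.
case: ifP => _ //.
rewrite !CM_graph_gt0.
have -> : [exists e0 in e |: M, owners e0 == [set i; j]] =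
  (owners e == [set i; j]) || [exists e0 in M, owners e0 == [set i; j]].
  apply/exists_inP/orP => [[e0]|[h|/exists_inP[e0 e0M h]]].
  - by rewrite !inE => /orP[/eqP -> ->|e0M h]; [left|right; apply/exists_inP; exists e0].
  - by exists e; rewrite ?setU11.
  - by exists e0; rewrite // inE e0M orbT.
case: (owners e == _) => /=; last by rewrite subrr normr0.
by case: [exists _ in _, _]; rewrite ?subrr ?subr0 ?normr0 ?normr1.
Qed.

Lemma loops_lipschitz : edge_lipschitz 1 (fun M => (loops (CM_graph M))%:R : R).
Proof.
move=> e M; have [eM|eM] := boolP (e \in M).
  have -> : e |: M = M by apply/setUidPr; rewrite sub1set.
  by rewrite subrr normr0.
have -> : loops (CM_graph (e |: M)) =
   (\sum_i (owners e == [set i; i]) + loops (CM_graph M))%N.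
  rewrite /loops -big_split; apply: eq_bigr => i _.
  by rewrite !CM_graphE big_setU1.
rewrite natrD addrK normr_nat (_ : 1 = 1%:R) // ler_nat.
have [/existsP[x /eqP E]|] := boolP [exists i, owners e == [set i; i]].
  rewrite (bigD1 x) //= big1; first by rewrite addn0 leq_b1.
  by move=> i ix; rewrite E eq_set2 eq_sym (negbTE ix).
by rewrite negb_exists => /forallP h; rewrite big1 // => i _; rewrite (negbTE (h i)).
Qed.

(** Each loop is found from either of its half-edges, so the right-hand side counts
    it twice; it is written so that its mean is a sum of pair probabilities. *)
Lemma loops_le M : M \in perfect_matchings d ->
  (loops (CM_graph M) <= \sum_(x : H) \sum_(y in [set: H] :\ x | tag y == tag x)
     ([set x; y] \in M))%N.
Proof.
move=> Mp; rewrite /loops; rewrite (eq_bigr _ (fun i _ => CM_graphE M i i)).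
rewrite exchange_big /=.
have -> : (\sum_(x : H) \sum_(y in [set: H] :\ x | tag y == tag x) ([set x; y] \in M) =
  \sum_(e in M) \sum_(x : H) \sum_(y in [set: H] :\ x | tag y == tag x) ([set x; y] == e))%N.
  rewrite [RHS]exchange_big; apply: eq_bigr => x _.
  rewrite [RHS]exchange_big; apply: eq_bigr => y _ /=.
  have [xyM|xyM] := boolP (_ \in M).
    by rewrite (bigD1 [set x; y]) //= eqxx big1 // => e /andP[_]; rewrite eq_sym => /negbTE ->.
  by rewrite big1 // => e eM; case: eqP => // E; rewrite E eM in xyM.
apply: leq_sum => e eM; have [a [b [ab ->]]] := matching_set2 Mp eM.
rewrite owners2; have [tab|tab] := eqVneq (tag a) (tag b).
  rewrite [X in (_ <= X)%N](bigD1 a) //= [X in (_ <= X + _)%N](bigD1 b) /=; last first.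
    by rewrite !inE eq_sym ab tab eqxx.
  rewrite eqxx -addnA; apply: leq_trans (leq_addr _ _).
  rewrite (bigD1 (tag a)) //= big1 ?addn0 ?leq_b1 // => i ia.
  by rewrite eq_set2 -tab (eq_sym (tag a)) (negbTE ia).
rewrite big1 // => i _; rewrite eq_set2 [X in _ || X]andbC orbb.
by case: (tag a =P i) => // <-; rewrite (eq_sym (tag b)) (negbTE tab).
Qed.

Hypothesis ell_gt0 : (0 < ell d)%N.

Lemma avg_loops : avg [set: H] (fun M => (loops (CM_graph M))%:R) <= 2 * (max_degree d)%:R :> R.
Proof.
have o := odd_half_edges.
have cH : #|[set: H]| = ell d by rewrite cardsT card_half_edge.
have e1 : 0 < (ell d).-1%:R :> R by rewrite ltr0n; move: ell_gt0 ell_even; case: ell => [|[]].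
have e2 : (ell d)%:R <= 2 * (ell d).-1%:R :> R.
  rewrite -natrM ler_nat; move: ell_gt0 ell_even; case: ell => [|[|k]] //= _ _; by rewrite mulSn mul1n addSn addnS !ltnS leq_addl.
apply: (@le_trans _ _ (avg [set: H] (fun M => \sum_(x : H) \sum_(y in [set: H] :\ x | tag y == tag x)
     ([set x; y] \in M)%:R))).
  apply: ler_avg => M Mp; have := loops_le Mp.
  rewrite -(ler_nat R) => /le_trans; apply; by rewrite natr_sum ler_sum // => x _; rewrite natr_sum.
rewrite avg_sum.
apply: (@le_trans _ _ (\sum_(x : H) (max_degree d)%:R * (ell d).-1%:R^-1)).
  apply: ler_sum => x _; rewrite avg_sum.
  rewrite (eq_bigr (fun=> (ell d).-1%:R^-1)) => [|y /andP[yx _]]; last first.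
    by rewrite avg_pair // cH.
  rewrite sumr_const -[_ *+ _]mulr_natl ler_wpM2r ?invr_ge0 ?ler_nat //.
  apply: leq_trans (leq_bigmax (tag x)); rewrite -card_owned; apply: subset_leq_card.
  by apply/subsetP => y; rewrite !inE => /andP[_].
rewrite sumr_const -cardsT cH -[_ *+ _]mulr_natl mulrCA mulrC ler_wpM2r //.
by rewrite ler_pdivrMr.
Qed.

(** The degrees never fail, and there are [ell / 2] edges in all: too few
    non-loop edges means more than [3 / 8 * ell] loops, whereas their mean is at
    most [ell / 8]. *)
Lemma CM_law_bad_le : 16 * (max_degree d)%:R <= (ell d)%:R :> R ->
  CM_law R d [set G | ~ (8^-1 * (ell d)%:R <= (nb_edges G)%:R :> R /\
                        forall v, vdeg G v = tnth d v)]%classic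
  <= expR (- (2 ^- 10 * (ell d)%:R)).
Proof.
move=> hmax; have o := odd_half_edges.
have cH : #|[set: H]| = ell d by rewrite cardsT card_half_edge.
have := avg_tail o ltr01 loops_lipschitz (_ : 0 < 4^-1).
rewrite cH => /(_ ltac:(lra) ltac:(lra)) h.
have E : 4^-1 ^+ 2 / (64 * 1 ^+ 2) = 2 ^- 10 :> R by rewrite expr1n; field.
rewrite E in h; apply: le_trans h; rewrite CM_lawE; apply: ler_avg => M Mp.
case: (boolP (_ \in _)) => //; rewrite in_setE /= => bad.
have -> : 4^-1 * (ell d)%:R <=
  (loops (CM_graph M))%:R - avg [set: H] (fun M => (loops (CM_graph M))%:R) :> R; last by [].
have hav := avg_loops.
have hE : (ell d)%:R = 2 * (nb_edges (CM_graph M))%:R + 2 * (loops (CM_graph M))%:R :> R.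
  by rewrite {1}(CM_nb_edges Mp) -!muln2 natrD !natrM ![_ * 2]mulrC.
have [hn|hn] := leP (8^-1 * (ell d)%:R : R) (nb_edges (CM_graph M))%:R.
  by exfalso; apply: bad; split=> // v; exact: CM_vdeg.
lra.
Qed.

Definition link_prob i j : R := 1 - expR (- ((tnth d i)%:R * (tnth d j)%:R / (ell d)%:R)).

Lemma link_prob01 i j : 0 <= link_prob i j <= 1.
Proof.
rewrite subr_ge0 gerBl expR_ge0 andbT -expR0 ler_expR oppr_le0.
by rewrite divr_ge0 ?mulr_ge0.
Qed.

Lemma link_mean i j (eta : R) : i != j -> eta <= 6^-1 ->
  (max_degree d)%:R <= eta * (ell d)%:R ->
  `|avg [set: H] (fun M => (0 < CM_graph M i j)%N%:R) - link_prob i j| <= 6 * eta.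
Proof.
move=> ij eta6 hm; have o := odd_half_edges.
have cH : #|[set: H]| = ell d by rewrite cardsT card_half_edge.
have hd k : (tnth d k)%:R <= eta * (ell d)%:R.
  by apply: le_trans hm; rewrite ler_nat; exact: leq_bigmax.
have dis : [disjoint owned i & owned j].
  rewrite -setI_eq0; apply/eqP/setP => h; rewrite !inE.
  by apply/andP => -[/eqP-> /eqP E]; rewrite E eqxx in ij.
have := @no_crossing_expR _ R [set: H] (owned i) (owned j) eta o (subsetT _) (subsetT _) dis.
rewrite !card_owned cH => /(_ ell_gt0 eta6 (hd i) (hd j)).
have -> : avg [set: H] (fun M => (0 < CM_graph M i j)%N%:R) =
   1 - no_crossing R [set: H] (owned i) (owned j).
  rewrite -[X in X - _](avg_const 1 o) -[X in _ - X]mul1r -mulNr -avgZ -avgD.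
  apply: eq_avg => M Mp; rewrite (CM_graph_crossing Mp ij).
  by case: crossing; rewrite ?mulr1 ?mulr0 ?subrr ?addr0.
rewrite /link_prob distrC; congr (_ <= _); congr (`|_|); ring.
Qed.

(** The pairs [i = j] are not covered by [link_mean], and each of the at most
    [#|V|] such pairs contributes at most 1. *)
Lemma links_mean (V S T : {set 'I_n}) (eta : R) : S \subset V -> T \subset V ->
  0 <= eta -> eta <= 6^-1 -> (max_degree d)%:R <= eta * (ell d)%:R ->
  `|avg [set: H] (links S T) - \sum_(i in S) \sum_(j in T) link_prob i j| <=
   6 * eta * #|V|%:R ^+ 2 + #|V|%:R.
Proof.
move=> SV TV eta0 eta6 hm; have o := odd_half_edges.
rewrite /links avg_sum -sumrB (le_trans (ler_norm_sum _ _ _)) //.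
apply: (@le_trans _ _ (\sum_(i in V) (6 * eta * #|V|%:R + 1))); last first.
  by rewrite sumr_const -[_ *+ _]mulr_natr mulrDl mul1r expr2 mulrA.
rewrite [leRHS](big_setID S) /= (setIidPr SV); apply: ler_wpDr.
  by apply: sumr_ge0 => i _; rewrite addr_ge0 ?mulr_ge0.
apply: ler_sum => i iS; rewrite avg_sum -sumrB (le_trans (ler_norm_sum _ _ _)) //.
apply: (@le_trans _ _ (\sum_(j in V) (6 * eta + (j == i)%:R))); last first.
  rewrite big_split /= sumr_const -[_ *+ _]mulr_natr lerD2l.
  by rewrite (bigD1 i) ?(subsetP SV) //= eqxx big1 ?addr0 // => j /andP[_ /negbTE->].
rewrite [leRHS](big_setID T) /= (setIidPr TV); apply: ler_wpDr.
  by apply: sumr_ge0 => j _; rewrite addr_ge0 ?mulr_ge0.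
apply: ler_sum => j jT; have [->|ij] := eqVneq j i; last first.
  by rewrite addr0; apply: link_mean; rewrite // eq_sym.
apply: ler_wpDl; first by rewrite mulr_ge0.
have /andP[p0 p1] := link_prob01 i i.
have a0 : 0 <= avg [set: H] (fun M => (0 < CM_graph M i i)%N%:R) :> R.
  by rewrite -[leLHS](avg_const 0 o); apply: ler_avg.
have a1 : avg [set: H] (fun M => (0 < CM_graph M i i)%N%:R) <= 1 :> R.
  by rewrite -[leRHS](avg_const 1 o); apply: ler_avg => M _; case: ltnP.
by rewrite ler_norml -[true%:R]/(1 : R); apply/andP; split; lra.
Qed.

(** A union bound over the [4 ^ #|V|] pairs of subsets of [V]; it is useful for [V]
    of size [o (ell)], against the rate [ell] of the exponential. *)
Lemma ECM_law_bad_le (V : {set 'I_n}) (eta eps : R) : 0 <= eta -> eta <= 6^-1 ->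
  (max_degree d)%:R <= eta * (ell d)%:R -> 0 < eps -> eps <= 8 ->
  6 * eta * #|V|%:R ^+ 2 + #|V|%:R < eps / 2 * (ell d)%:R ->
  ECM_law R d [set G | ~ ((exists2 M, M \in perfect_matchings d & G = collapse (CM_graph M)) /\
     forall S T : {set 'I_n}, S \subset V -> T \subset V ->
     `|\sum_(i in S) \sum_(j in T) ((G i j)%:R - link_prob i j)| <= eps * (ell d)%:R)]%classic
  <= 2 * 4 ^+ #|V| * expR (- (eps ^+ 2 / 2 ^+ 10 * (ell d)%:R)).
Proof.
move=> eta0 eta6 hm eps0 eps8 hV; have o := odd_half_edges.
have cH : #|[set: H]| = ell d by rewrite cardsT card_half_edge.
pose bad S T M := (eps / 2 * #|[set: H]|%:R <=
   `|links S T M - avg [set: H] (links S T)|) : bool.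
rewrite /ECM_law CM_lawE.
apply: (@le_trans _ _ (avg [set: H] (fun M => \sum_(S in powerset V) \sum_(T in powerset V)
   (bad S T M)%:R))).
  apply: ler_avg => M Mp; case: (boolP (_ \in _)) => [|_]; last first.
    by apply: sumr_ge0 => S _; apply: sumr_ge0.
  rewrite in_setE /= => nG.
  have [S [T [SV TV hb]]] : exists S T : {set 'I_n},
     [/\ S \subset V, T \subset V & bad S T M].
    apply: contrapT => nb; apply: nG; split; first by exists M.
    move=> S T SV TV.
    have -> : \sum_(i in S) \sum_(j in T) ((collapse (CM_graph M) i j)%:R - link_prob i j) =
       links S T M - \sum_(i in S) \sum_(j in T) link_prob i j.
      rewrite /links -sumrB; apply: eq_bigr => i _; rewrite -sumrB; apply: eq_bigr => j _.
      by rewrite mxE.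
    have : ~~ bad S T M by apply/negP => hb; apply: nb; exists S, T.
    rewrite /bad -ltNge cH => h1; have := links_mean SV TV eta0 eta6 hm => h2.
    have h3 := le_lt_trans h2 hV.
    have := le_lt_trans (ler_normD _ _) (ltrD h1 h3).
    rewrite subrKA; set a := `|_| => h4; apply: ltW; apply: lt_le_trans h4 _.
    by rewrite -mulrDl -splitr.
  rewrite (bigD1 S) ?inE //= (bigD1 T) ?inE //= hb -addrA lerDl addr_ge0 //.
    by apply: sumr_ge0.
  by apply: sumr_ge0 => ? _; apply: sumr_ge0.
rewrite avg_sum; under eq_bigr do rewrite avg_sum.
have e1 : 0 < eps / 2 by rewrite divr_gt0.
have e2 : eps / 2 <= 4 * 2 by lra.
have K : (eps / 2) ^+ 2 / (64 * 2 ^+ 2) = eps ^+ 2 / 2 ^+ 10 by field.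
apply: (@le_trans _ _ (\sum_(S in powerset V) \sum_(T in powerset V)
   2 * expR (- (eps ^+ 2 / 2 ^+ 10 * (ell d)%:R)))).
  apply: ler_sum => S _; apply: ler_sum => T _.
  have := avg_tail_norm o (_ : 0 < 2) (links_lipschitz S T) e1 e2.
  by rewrite K -cH => h; exact: (h (ltr0n _ 2)).
rewrite !sumr_const !card_powerset -[_ *+ _ *+ _]mulr_natr -[(2 * _) *+ _]mulr_natr.
rewrite (_ : (2 ^ #|V|)%:R = 2 ^+ #|V| :> R) ?natrX //.
rewrite -mulrA -exprMn -[2 * 2]natrM mulrAC.
by [].
Qed.

End ConfigurationModel.

Local Open Scope classical_set_scope.
Local Open Scope ring_scope.
(** * Product laws *)

Section BorelCantelli.
Variable R : realType.
Variables (law : forall n, set (multigraph n) -> R) (P : probability graph_seq R).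
Hypothesis Plaw : is_product_law P law.
Hypothesis lawT : forall n, law (n := n) setT = 1.

Lemma product_law_marginal n (A : set (multigraph n)) :
  P [set G : graph_seq | A (G n)] = (law A)%:E.
Proof.
pose B m : set (multigraph m) :=
  match boolp.pselect (n = m) with
  | left e => ecast m (set (multigraph m)) e A | right _ => setT end.
have Bn : B n = A.
  by rewrite /B; case: boolp.pselect => // e; rewrite (eq_irrelevance e erefl).
have Bm m : n <> m -> B m = setT by rewrite /B; case: boolp.pselect.
have := Plaw n.+1 B; rewrite big_ord_recr /= Bn big1 ?mul1r => [<-|m _].
  congr (P _); apply/seteqP; split => G /= h.
    move=> m _; have [e|e] := boolp.pselect (n = m); last by rewrite Bm.
    by subst m; rewrite Bn.
  by rewrite -Bn; apply: h.
by rewrite Bm ?lawT // => e; have := ltn_ord m; rewrite -e ltnn.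
Qed.

Lemma measurable_cylinder n (A : set (multigraph n)) :
  measurable ([set G | A (G n)] : set graph_seq).
Proof. by apply: sub_sigma_algebra; exists n, A. Qed.

(** The probabilities of the bad events are summable, and each concerns a single
    graph of the sequence. *)
Lemma borel_cantelli_product_law (bad : forall n, set (multigraph n)) (C k : R) :
  0 < k -> (\forall n \near \oo, law (bad n) <= C * expR (- (k * n%:R))) ->
  {ae P, forall G : graph_seq, \forall n \near \oo, ~ bad n (G n)}.
Proof.
move=> k0 [N _ hN].
pose F n : set graph_seq := [set G | (N <= n)%N /\ bad n (G n)].
have mF n : measurable (F n).
  rewrite /F; case: (leqP N n) => Nn.
    rewrite (_ : [set _ | _] = [set G : graph_seq | bad n (G n)]); last first.
      by apply/seteqP; split=> G /= => [[]|].
    exact: measurable_cylinder.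
  rewrite (_ : [set _ | _] = set0); last by apply/seteqP; split=> G /= => [[]|].
  exact: measurable0.
have q0 : 0 < expR (- k) by exact: expR_gt0.
have q1 : `|expR (- k)| < 1 by rewrite ger0_norm ?expR_ge0 // -expR0 ltr_expR oppr_lt0.
have PF n : (P (F n) <= (`|C| * expR (- k) ^+ n)%:E)%E.
  have [Nn|Nn] := leqP N n.
    rewrite (_ : F n = [set G : graph_seq | bad n (G n)]); last first.
      by apply/seteqP; split=> G /= => [[]|].
    rewrite product_law_marginal lee_fin; apply: (le_trans (hN n Nn)).
    by rewrite -mulNr expRM_natr ler_wpM2r ?exprn_ge0 ?expR_ge0 // ler_norm.
  rewrite (_ : F n = set0); last first.
    by apply/seteqP; split=> G //= [] ; rewrite leqNgt Nn.
  by rewrite measure0 lee_fin mulr_ge0 ?exprn_ge0 ?expR_ge0.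
have S : (\sum_(n <oo) P (F n) < +oo)%E.
  apply: (@le_lt_trans _ _ (`|C| * (1 - expR (- k))^-1)%:E); last exact: ltry.
  apply: lime_le; first by apply: is_cvg_nneseries.
  apply: nearW => n.
  apply: (@le_trans _ _ (\sum_(0 <= i < n) (`|C| * expR (- k) ^+ i)%:E)%E).
    by apply: lee_sum => i _.
  rewrite sumEFin lee_fin; have := geometric_le_lim n (normr_ge0 C) q0 q1.
  by rewrite /series /=.
exists (lim_sup_set F); split.
- by apply: bigcap_measurable => // n _; apply: bigcup_measurable.
- exact: (lim_sup_set_cvg0 mF S).
move=> G /= nG; rewrite /lim_sup_set => m _; apply: contrapT => h; apply: nG.
exists (maxn N m) => // n /=; rewrite geq_max => /andP[Nn mn] b.
by apply: h; exists n.
Qed.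

End BorelCantelli.

(** * Tail regularity and numbers of links *)

Section Asymptotics.
Variables (R : realType) (d : forall n : nat, n.-tuple nat).
Hypothesis d_pos : forall (n : nat) (i : 'I_n), (0 < tnth (d n) i)%N.
Hypothesis ell_even : forall n : nat, ~~ odd (ell (d n)).
Hypothesis max_degree_small :
    (fun n : nat => (max_degree (d n))%:R : R) =o_\oo
    (fun n : nat => (ell (d n))%:R : R).

Lemma leq_ell n : (n <= ell (d n))%N.
Proof.
rewrite -[leqLHS]card_ord -sum1_card; apply: leq_sum => i _; exact: d_pos.
Qed.

Lemma max_degree_near eps : 0 < eps ->
  \forall n \near \oo, (max_degree (d n))%:R <= eps * (ell (d n))%:R :> R.
Proof.
move=> e0; have /eqoP/(_ _ e0) := max_degree_small.
by apply: filterS => n; rewrite !normr_nat.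
Qed.

Lemma sqrt_ell_near (K : R) : \forall n \near \oo, K <= Num.sqrt (ell (d n))%:R.
Proof.
have /= := @nbhs_infty_ger R (K ^+ 2).
apply: filterS => n /= hn; have [K0|K0] := leP 0 K; last exact: le_trans (ltW K0) (sqrtr_ge0 _).
rewrite -(ger0_norm K0) -sqrtr_sqr ler_sqrt //; apply: (le_trans hn).
by rewrite ler_nat leq_ell.
Qed.

Lemma ell_gt0 n : (0 < n)%N -> (0 < ell (d n))%N.
Proof. by move=> n0; apply: leq_trans n0 (leq_ell n). Qed.

Definition tail_regular := forall eps : R, 0 < eps -> exists2 delta : R, 0 < delta &
  \forall n \near \oo,
    \sum_(i < n | (tnth (d n) i)%:R <= delta * Num.sqrt (ell (d n))%:R :> R)
       (tnth (d n) i)%:R <= eps * (ell (d n))%:R.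

Definition uniform_links_near (G : forall n, multigraph n) := forall eps : R, 0 < eps ->
  \forall n \near \oo, forall S T : {set 'I_n},
   `|\sum_(i in S) \sum_(j in T) ((G n i j)%:R - link_prob R (d n) i j)|
      <= eps * (ell (d n))%:R.

(** Finitely many graphs can be dealt with by shrinking [delta] until no vertex of
    positive degree is counted in any of them. *)
Lemma uniformly_tail_regular_near (G : forall n, multigraph n) :
  (forall eps : R, 0 < eps -> exists2 delta : R, 0 < delta &
    \forall n \near \oo, (nb_edges (G n))%:R^-1 *
      (\sum_(v < n | ((vdeg (G n) v)%:R <=
          delta * Num.sqrt (nb_edges (G n))%:R :> R)%R) (vdeg (G n) v)%:R) < eps) ->
  uniformly_tail_regular R G.
Proof.
move=> h eps e0; have [delta d0 [N _ hN]] := h _ e0.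
pose B : R := 1 + \sum_(n < N) (nb_edges (G n))%:R.
have B0 : 0 < B by rewrite ltr_wpDr // sumr_ge0.
exists (Num.min delta (B^-1 / 2)); first by rewrite lt_min d0 divr_gt0 ?invr_gt0.
move=> n n0; have [Nn|nN] := leqP N n.
  apply: le_lt_trans (hN n Nn); rewrite ler_wpM2l ?invr_ge0 //.
  rewrite big_mkcond [leRHS]big_mkcond /=; apply: ler_sum => v _.
  case: ifPn => [h1|_]; last by case: ifP.
  by rewrite ifT //; apply: (le_trans h1); rewrite ler_wpM2r ?sqrtr_ge0 // ge_min lexx.
rewrite big1 ?mulr0 // => v hv; apply/eqP; rewrite pnatr_eq0 -leqn0 -ltnS -(ltr_nat R).
apply: (le_lt_trans hv).
apply: (@le_lt_trans _ _ (B^-1 / 2 * Num.sqrt (nb_edges (G n))%:R)).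
  by rewrite ler_wpM2r ?sqrtr_ge0 // ge_min lexx orbT.
have nB : 1 + (nb_edges (G n))%:R <= B.
  by rewrite lerD2l (bigD1 (Ordinal nN)) //= lerDl sumr_ge0.
have sB : Num.sqrt (nb_edges (G n))%:R <= B.
  apply: le_trans nB; set x := _%:R; have x0 : 0 <= x by [].
  have := sqr_sqrtr x0; have := sqrtr_ge0 x; nra.
rewrite mulrAC -mulrA ltr_pdivrMl // mulr1 -ltr_pdivlMr // (le_lt_trans sB) //.
by rewrite ltr_pdivlMr // ; lra.
Qed.

Definition good_degrees n (H : multigraph n) : Prop :=
  8^-1 * (ell (d n))%:R <= (nb_edges H)%:R :> R /\
  forall v, vdeg H v = tnth (d n) v.

Section CMdegrees.
Variable G : forall n, multigraph n.
Hypothesis good : \forall n \near \oo, good_degrees (G n).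

Lemma nb_edges_le n (H : multigraph n) : (forall v, vdeg H v = tnth (d n) v) ->
  (nb_edges H <= ell (d n))%N.
Proof.
move=> h; rewrite /ell /nb_edges; apply: leq_sum => v _; rewrite -h /vdeg.
apply: leq_trans (leq_addr _ _); rewrite big_mkcond; apply: leq_sum => j _.
by case: ifP.
Qed.

(** The numbers of edges and of half-edges are within constant factors of each
    other, which only changes [eps] and [delta] by constant factors. *)
Lemma tail_regular_CM : tail_regular <-> uniformly_tail_regular R G.
Proof.
have n0 : \forall n \near \oo, (0 < n)%N by exists 1%N.
split => [tr|utr].
  apply: uniformly_tail_regular_near => eps e0.
  have [delta d0 hd] := tr (eps / 16) (divr_gt0 e0 (ltr0n _ 16)).
  exists delta => //; near=> n.
  have [nb vd] : good_degrees (G n) by near: n.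
  have l0 : 0 < (ell (d n))%:R :> R by rewrite ltr0n ell_gt0 //; near: n.
  have nb0 : 0 < (nb_edges (G n))%:R :> R by apply: lt_le_trans nb; rewrite mulr_gt0.
  have hn : \sum_(i < n | (tnth (d n) i)%:R <= delta * Num.sqrt (ell (d n))%:R :> R)
       (tnth (d n) i)%:R <= eps / 16 * (ell (d n))%:R by near: n.
  rewrite mulrC ltr_pdivrMr //.
  apply: (@le_lt_trans _ _ (eps / 16 * (ell (d n))%:R)); last by nra.
  apply: le_trans hn; rewrite big_mkcond [leRHS]big_mkcond /=; apply: ler_sum => v _.
  rewrite vd; case: ifPn => [h1|_]; last by case: ifP.
  rewrite ifT //; apply: (le_trans h1); rewrite ler_wpM2l ?(ltW d0) // ler_wsqrtr // ler_nat.
  exact: nb_edges_le.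
move=> eps e0; have [delta d0 hd] := utr _ e0.
exists (delta / 3); first by rewrite divr_gt0.
near=> n.
have [nb vd] : good_degrees (G n) by near: n.
have np : (0 < n)%N by near: n.
have l0 : 0 < (ell (d n))%:R :> R by rewrite ltr0n ell_gt0.
have nb0 : 0 < (nb_edges (G n))%:R :> R by apply: lt_le_trans nb; rewrite mulr_gt0.
have := hd n np; rewrite mulrC ltr_pdivrMr // => h.
apply: (@le_trans _ _ (eps * (nb_edges (G n))%:R)); last first.
  by rewrite ler_wpM2l ?(ltW e0) // ler_nat nb_edges_le.
apply: le_trans (ltW h); rewrite big_mkcond [leRHS]big_mkcond /=; apply: ler_sum => v _.
rewrite vd; case: ifPn => [h1|_]; last by case: ifP.
rewrite ifT //; apply: (le_trans h1); rewrite -mulrA ler_wpM2l ?(ltW d0) //.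
rewrite ler_pdivrMl //; set x := Num.sqrt _; set y := Num.sqrt _.
have x0 : 0 <= x by exact: sqrtr_ge0. have y0 : 0 <= y by exact: sqrtr_ge0.
have xE : x ^+ 2 = (ell (d n))%:R by rewrite sqr_sqrtr.
have yE : y ^+ 2 = (nb_edges (G n))%:R by rewrite sqr_sqrtr.
rewrite -(@ler_pXn2r _ 2) ?nnegrE ?mulr_ge0 // exprMn xE yE; lra.
Unshelve. all: by end_near. Qed.

End CMdegrees.

Lemma CM_ae_good_degrees (P : probability graph_seq R) :
  is_product_law P (fun n => CM_law R (d n)) ->
  {ae P, forall G : graph_seq, \forall n \near \oo, good_degrees (G n)}.
Proof.
move=> hP.
have hT n : CM_law R (d n) setT = 1 by apply: CM_lawT.
have := @borel_cantelli_product_law R _ P hP hT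
  (fun n => [set G | ~ good_degrees G]) 1 (2 ^- 10).
rewrite invr_gt0 exprn_gt0 // => /(_ isT) h.
apply: filterS (h _) => [G|]; first by apply: filterS => n /= /contrapT.
near=> n.
have n0 : (0 < n)%N by near: n; exists 1%N.
apply: (le_trans (CM_law_bad_le _ (ell_gt0 n0) _)) => //.
  rewrite -ler_pdivlMl //; near: n; exact: max_degree_near.
have k0 : 0 <= 2 ^- 10 :> R by rewrite invr_ge0 exprn_ge0.
rewrite mul1r ler_expR lerN2; apply: (ler_wpM2l k0); rewrite ler_nat; exact: leq_ell.
Unshelve. all: by end_near. Qed.

Lemma expR2_ge4 : 4 <= expR 2 :> R.
Proof.
have := expR_ge1Dx (1 : R); have -> : expR (2 : R) = expR 1 * expR 1 by rewrite -expRD.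
by nra.
Qed.

Definition big_vertices n k : {set 'I_n} :=
  [set i | k.+1%:R^-1 * Num.sqrt (ell (d n))%:R < (tnth (d n) i)%:R :> R]%SET.

(** Markov's inequality: the degrees add up to [ell]. *)
Lemma card_above n (delta : R) : 0 < delta -> (0 < n)%N ->
  #|[set i : 'I_n | (delta * Num.sqrt (ell (d n))%:R < (tnth (d n) i)%:R)%R]%SET|%:R * delta
     <= Num.sqrt (ell (d n))%:R :> R.
Proof.
move=> d0 n0; set V := [set i | _]%SET.
have l0 : 0 < (ell (d n))%:R :> R by rewrite ltr0n ell_gt0.
have s0 : 0 < Num.sqrt (ell (d n))%:R :> R by rewrite sqrtr_gt0.
rewrite -(ler_pM2r s0) -mulrA -expr2 sqr_sqrtr // mulr_natl -sumr_const.
rewrite [leRHS](_ : _ = \sum_i (tnth (d n) i)%:R); last by rewrite -natr_sum.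
rewrite [leRHS](bigID (mem V)) /= ler_wpDr ?sumr_ge0 //.
by apply: ler_sum => i; rewrite inE => /ltW.
Qed.

(** Levels [1 / (k + 1)] instead of arbitrary real [delta] and [eps], so that the
    almost sure statement is a countable intersection. *)
Definition good_links n k (H : multigraph n) : Prop :=
  (exists2 M, M \in perfect_matchings (d n) & H = collapse (CM_graph M)) /\
  forall S T : {set 'I_n}, S \subset big_vertices n k -> T \subset big_vertices n k ->
    `|\sum_(i in S) \sum_(j in T) ((H i j)%:R - link_prob R (d n) i j)|
      <= k.+1%:R^-1 * (ell (d n))%:R.

(** There are [O (sqrt ell)] big vertices, so the number of pairs of sets in
    [ECM_law_bad_le] is [exp (O (sqrt ell))], and the error in [links_mean] is
    [O (eta * ell + sqrt ell)]; both are negligible for large [n]. *)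
Lemma ECM_ae_good_links (P : probability graph_seq R) :
  is_product_law P (fun n => ECM_law R (d n)) ->
  {ae P, forall G : graph_seq, forall k : nat, \forall n \near \oo,
     good_links k (G n)}.
Proof.
move=> hP; apply: ae_foralln => k.
have hT n : ECM_law R (d n) setT = 1 by rewrite /ECM_law preimage_setT; apply: CM_lawT.
pose e : R := k.+1%:R^-1; have e0 : 0 < e by rewrite invr_gt0.
have e1 : e <= 1 by rewrite invf_le1 // ler1n.
have [K K0 hK] : exists2 K : R, 0 < K & K = 2 ^+ 10 by exists (2 ^+ 10); rewrite // exprn_gt0.
have := @borel_cantelli_product_law R _ P hP hT
  (fun n => [set G | ~ good_links k G]) 2 (e ^+ 2 / (2 * K)).
move=> h; apply: filterS (h _ _) => [G| |].
- by apply: filterS => n /= /contrapT.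
- by rewrite divr_gt0 ?exprn_gt0 ?mulr_gt0.
near=> n.
have n0 : (0 < n)%N by near: n; exists 1%N.
set s : R := Num.sqrt (ell (d n))%:R.
have sE : s ^+ 2 = (ell (d n))%:R by rewrite sqr_sqrtr.
have sK : 8 * K * e ^- 3 + 8 * e ^- 2 <= s.
  by rewrite /s; near: n; exact: sqrt_ell_near.
have s0 : 0 < s.
  by apply: lt_le_trans sK; rewrite addr_gt0 // !mulr_gt0 // invr_gt0 exprn_gt0.
have cV : #|big_vertices n k|%:R * e <= s by exact: card_above.
have e30 : 0 < e ^+ 3 by rewrite exprn_gt0. have e20 : 0 < e ^+ 2 by rewrite exprn_gt0.
have s1 : 8 * K <= s * e ^+ 3.
  rewrite -ler_pdivrMr //; apply: le_trans sK; by rewrite lerDl ltW // divr_gt0.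
have s2 : 8 <= s * e ^+ 2.
  rewrite -ler_pdivrMr //; apply: le_trans sK; by rewrite lerDr ltW // divr_gt0 // mulr_gt0.
have Vs : #|big_vertices n k|%:R <= s / e by rewrite ler_pdivlMr.
have Vs2 : #|big_vertices n k|%:R <= e ^+ 2 / (4 * K) * (ell (d n))%:R.
  apply: (le_trans Vs); rewrite ler_pdivrMr // -sE.
  have -> : e ^+ 2 / (4 * K) * s ^+ 2 * e = s * (s * e ^+ 3 / (4 * K)) by ring.
  rewrite -[leLHS]mulr1 ler_pM2l // ler_pdivlMr ?mulr_gt0 // mul1r.
  by apply: le_trans s1; rewrite ler_pM2r // ler_nat.
apply: (@le_trans _ _ (2 * 4 ^+ #|big_vertices n k| * expR (- (e ^+ 2 / K * (ell (d n))%:R)))).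
  rewrite hK; apply: (@ECM_law_bad_le _ _ _ _ _ _ (e ^+ 3 / 48)) => //.
  - exact: ell_gt0.
  - by rewrite divr_ge0 // ltW.
  - have : e ^+ 3 <= 1 by rewrite exprn_ile1 // ltW.
    lra.
  - near: n; apply: max_degree_near; by rewrite divr_gt0 // exprn_gt0.
  - by apply: le_trans e1 _; rewrite ler1n.
  - have : #|big_vertices n k|%:R ^+ 2 * e ^+ 2 <= s ^+ 2.
      by rewrite -exprMn lerXn2r // nnegrE ?mulr_ge0 // ltW.
    have : #|big_vertices n k|%:R * 8 <= s * (s * e).
      apply: (@le_trans _ _ (#|big_vertices n k|%:R * (s * e ^+ 2))).
        by rewrite ler_wpM2l.
      have -> : #|big_vertices n k|%:R * (s * e ^+ 2) = (#|big_vertices n k|%:R * e) * (s * e) by ring.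
      by rewrite ler_wpM2r // mulr_ge0 // ltW.
    rewrite -sE; set V : R := _%:R => h8 hV.
    have : e * (V ^+ 2 * e ^+ 2) <= e * s ^+ 2 by rewrite ler_pM2l.
    have : 0 < s * (s * e) by rewrite !mulr_gt0.
    have -> : 6 * (e ^+ 3 / 48) * V ^+ 2 = e * (V ^+ 2 * e ^+ 2) / 8 by field.
    have -> : e / 2 * s ^+ 2 = s * (s * e) / 2 by field.
    have -> : e * s ^+ 2 = s * (s * e) by ring.
    by move: h8; clear => h8 h9 h10; lra.
have h4 : 4 ^+ #|big_vertices n k| <= expR (2 * #|big_vertices n k|%:R) :> R.
  rewrite expRM_natr lerXn2r ?nnegrE ?expR_ge0 //.
  exact: expR2_ge4.
rewrite -mulrA ler_pM2l //.
apply: (le_trans (ler_wpM2r (expR_ge0 _) h4)); rewrite -expRD ler_expR.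
have ln : n%:R <= (ell (d n))%:R :> R by rewrite ler_nat leq_ell.
have K2 : 0 < 2 * K by rewrite mulr_gt0.
have : e ^+ 2 / (2 * K) * n%:R <= e ^+ 2 / (2 * K) * (ell (d n))%:R.
  by rewrite ler_wpM2l // ltW // divr_gt0.
have -> : e ^+ 2 / K * (ell (d n))%:R = 2 * (e ^+ 2 / (2 * K) * (ell (d n))%:R).
  by field; rewrite gt_eqF.
have : e ^+ 2 / (4 * K) * (ell (d n))%:R = (e ^+ 2 / (2 * K) * (ell (d n))%:R) / 2.
  by field; rewrite gt_eqF.
move: Vs2; clear => Vs2 h5 h6; lra.
Unshelve. all: by end_near. Qed.

Lemma sum_link_prob n (i : 'I_n) : \sum_j link_prob R (d n) i j <= (tnth (d n) i)%:R.
Proof.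
have n0 : (0 < n)%N by apply: leq_ltn_trans (ltn_ord i).
have l0 : 0 < (ell (d n))%:R :> R by rewrite ltr0n ell_gt0.
apply: (@le_trans _ _ (\sum_j (tnth (d n) i)%:R * (tnth (d n) j)%:R / (ell (d n))%:R)).
  apply: ler_sum => j _; rewrite /link_prob.
  by set x := _ / _; have := expR_ge1Dx (- x); lra.
by rewrite -mulr_suml -mulr_sumr -natr_sum mulfK // gt_eqF.
Qed.

Lemma link_prob_sym n (i j : 'I_n) : link_prob R (d n) i j = link_prob R (d n) j i.
Proof. by rewrite /link_prob [_%:R * _]mulrC. Qed.

Lemma collapseE n (H : multigraph n) i j : collapse H i j = (0 < H i j)%N.
Proof. by rewrite mxE. Qed.

Section ECMgraph.
Variables (n : nat) (M : {set {set half_edge (d n)}}).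
Hypothesis Mp : M \in perfect_matchings (d n).

Lemma collapse_sym i j : collapse (CM_graph M) i j = collapse (CM_graph M) j i.
Proof. by rewrite !collapseE CM_graph_sym. Qed.

Lemma collapse_vdeg v : (vdeg (collapse (CM_graph M)) v <= tnth (d n) v)%N.
Proof.
rewrite -(CM_vdeg v Mp) /vdeg; apply: leq_add; last by rewrite collapseE; case: (CM_graph M v v).
by apply: leq_sum => j _; rewrite collapseE; case: (CM_graph M v j).
Qed.

Lemma collapse_row v : (\sum_j collapse (CM_graph M) v j <= tnth (d n) v)%N.
Proof. by apply: leq_trans (collapse_vdeg v); exact: leq_addr. Qed.

(** A row of the adjacency matrix and a row of linking probabilities each sum to at
    most the degree, so the rows and columns outside [V] contribute little when
    the vertices outside [V] carry few half-edges. *)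
Lemma links_discrepancy_restrict (S T V : {set 'I_n}) :
  `|\sum_(i in S) \sum_(j in T) ((collapse (CM_graph M) i j)%:R - link_prob R (d n) i j)|
  <= `|\sum_(i in S :&: V) \sum_(j in T :&: V)
        ((collapse (CM_graph M) i j)%:R - link_prob R (d n) i j)|
     + 4 * \sum_(i | i \notin V) (tnth (d n) i)%:R.
Proof.
pose D i j : R := (collapse (CM_graph M) i j)%:R - link_prob R (d n) i j.
rewrite -/(D _ _).
have Drow i : \sum_j `|D i j| <= 2 * (tnth (d n) i)%:R.
  apply: (@le_trans _ _ (\sum_j ((collapse (CM_graph M) i j)%:R + link_prob R (d n) i j))).
    apply: ler_sum => j _; have /andP[p0 _] := link_prob01 R (d n) i j.
    by apply: (le_trans (ler_normB _ _)); rewrite normr_nat (ger0_norm p0).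
  rewrite big_split /= mulr2n mulrDl mul1r lerD ?sum_link_prob //.
  by rewrite -natr_sum ler_nat collapse_row.
have Dsym i j : D i j = D j i by rewrite /D collapse_sym link_prob_sym.
have -> : \sum_(i in S) \sum_(j in T) D i j =
   \sum_(i in S :&: V) \sum_(j in T :&: V) D i j +
   (\sum_(i in S :&: V) \sum_(j in T :\: V) D i j + \sum_(i in S :\: V) \sum_(j in T) D i j).
  rewrite (finset.big_setID V) /= addrA; congr (_ + _); rewrite -big_split /=.
  by apply: eq_bigr => i _; rewrite (finset.big_setID V).
have sub (A B : {set 'I_n}) : \sum_(i in A :\: V) \sum_(j in B) `|D i j| <=
    2 * \sum_(i | i \notin V) (tnth (d n) i)%:R.
  rewrite mulr_sumr big_mkcond [leRHS]big_mkcond /=; apply: ler_sum => i _.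
  rewrite finset.in_setD; case: (i \in V) => //=; case: ifP => _; last by rewrite mulr_ge0.
  apply: le_trans (Drow i); rewrite [leRHS](bigID (mem B)) /= ler_wpDr // sumr_ge0 //.
apply: (le_trans (ler_normD _ _)); rewrite lerD2l.
apply: (le_trans (ler_normD _ _)).
have -> : 4 = 2 + 2 :> R by rewrite -natrD.
rewrite mulrDl lerD //.
  rewrite exchange_big /=; apply: le_trans (sub T (S :&: V)%SET).
  apply: (le_trans (ler_norm_sum _ _ _)); apply: ler_sum => i _.
  apply: (le_trans (ler_norm_sum _ _ _)); apply: ler_sum => j _.
  by rewrite Dsym.
apply: le_trans (sub S T).
by apply: (le_trans (ler_norm_sum _ _ _)); apply: ler_sum => i _; exact: ler_norm_sum.
Qed.

End ECMgraph.

Section ECMseq.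
Variable G : forall n, multigraph n.
Hypothesis tr : tail_regular.
Hypothesis good : forall k : nat, \forall n \near \oo, good_links k (G n).

Lemma ECM_collapse : \forall n \near \oo,
  exists2 M, M \in perfect_matchings (d n) & G n = collapse (CM_graph M).
Proof. by apply: filterS (good 0) => n []. Qed.

Lemma ECM_uniform_links : uniform_links_near G.
Proof.
move=> eps e0; have [delta d0 hd] := tr (divr_gt0 e0 (ltr0n _ 8)).
pose k := Num.truncn (Num.max delta^-1 (2 / eps)).
have hk : Num.max delta^-1 (2 / eps) < k.+1%:R.
  by rewrite truncnS_gt.
have [hk1 hk2] : delta^-1 < k.+1%:R /\ 2 / eps < k.+1%:R.
  by move: hk; rewrite gt_max => /andP[].
have k1 : k.+1%:R^-1 <= delta by rewrite -[delta]invrK lef_pV2 ?posrE ?invr_gt0 // ltW.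
have k2 : k.+1%:R^-1 <= eps / 2.
  by rewrite -[eps / 2]invrK lef_pV2 ?posrE ?invr_gt0 ?divr_gt0 // invf_div ltW.
near=> n => S T.
have [[M Mp GE] h] : good_links k (G n) by near: n; exact: good.
have hn : \sum_(i < n | (tnth (d n) i)%:R <= delta * Num.sqrt (ell (d n))%:R :> R)
       (tnth (d n) i)%:R <= eps / 8 * (ell (d n))%:R by near: n.
have h2 := h (S :&: big_vertices n k)%SET (T :&: big_vertices n k)%SET
  (finset.subsetIr _ _) (finset.subsetIr _ _).
rewrite GE in h2 *.
apply: (le_trans (links_discrepancy_restrict Mp S T (big_vertices n k))).
have h1 : \sum_(i | i \notin big_vertices n k) (tnth (d n) i)%:R <= eps / 8 * (ell (d n))%:R.
  apply: le_trans hn; rewrite big_mkcond [leRHS]big_mkcond /=; apply: ler_sum => i _.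
  rewrite inE -leNgt; case: ifPn => [h1|_]; last by case: ifP.
  by rewrite ifT // (le_trans h1) // ler_wpM2r ?sqrtr_ge0.
have h3 : k.+1%:R^-1 * (ell (d n))%:R <= eps / 2 * (ell (d n))%:R by rewrite ler_wpM2r.
have h4 : 0 <= 4 :> R by [].
apply: (le_trans (lerD (le_trans h2 h3) (ler_wpM2l h4 h1))).
by rewrite le_eqVlt; apply/orP; left; apply/eqP; field.
Unshelve. all: by end_near. Qed.

Variable c : R.
Hypothesis c0 : 0 < c.
Hypothesis link_prob_cvg :
  (\sum_(i < n) \sum_(j < n) link_prob R (d n) i j) / (ell (d n))%:R @[n --> \oo] --> c.

Definition nb_links n (H : multigraph n) : nat := (\sum_i \sum_j (0 < H i j))%N.

(** The case [S = T = setT] of [ECM_uniform_links]. *)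
Lemma nb_links_cvg : (nb_links (G n))%:R / (ell (d n))%:R @[n --> \oo] --> c.
Proof.
apply/cvgrPdist_le => eps e0; have e2 : 0 < eps / 2 by rewrite divr_gt0.
have := ECM_uniform_links e2.
move/cvgrPdist_le : link_prob_cvg => /(_ _ e2) hc hG.
near=> n.
have h1 : `|c - (\sum_(i < n) \sum_(j < n) link_prob R (d n) i j) / (ell (d n))%:R| <= eps / 2.
  by near: n.
have n0 : (0 < n)%N by near: n; exists 1%N.
have l0 : 0 < (ell (d n))%:R :> R by rewrite ltr0n ell_gt0.
have h2 : forall S T : {set 'I_n}, 
   `|\sum_(i in S) \sum_(j in T) ((G n i j)%:R - link_prob R (d n) i j)|
      <= eps / 2 * (ell (d n))%:R by near: n.
have [M Mp GE] : exists2 M, M \in perfect_matchings (d n) & G n = collapse (CM_graph M).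
  by near: n; exact: ECM_collapse.
have := h2 [set: 'I_n]%SET [set: 'I_n]%SET.
have -> : \sum_(i in [set: 'I_n]%SET) \sum_(j in [set: 'I_n]%SET) ((G n i j)%:R - link_prob R (d n) i j) =
  (nb_links (G n))%:R - (\sum_(i < n) \sum_(j < n) link_prob R (d n) i j).
  rewrite /nb_links natr_sum -sumrB; apply: eq_big => [i|i _]; first by rewrite inE.
  rewrite natr_sum -sumrB; apply: eq_big => [j|j _]; first by rewrite inE.
  by rewrite GE !collapseE; case: (0 < CM_graph M i j)%N.
move=> h4.
have h3 : `|(nb_links (G n))%:R / (ell (d n))%:R -
  (\sum_(i < n) \sum_(j < n) link_prob R (d n) i j) / (ell (d n))%:R| <= eps / 2.
  by rewrite -mulrBl normrM normfV (gtr0_norm l0) ler_pdivrMr.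
rewrite [eps]splitr; apply: le_trans (lerD h1 h3).
rewrite -[X in _ <= _ + X]normrN; apply: le_trans (ler_normD _ _).
by rewrite opprB addrA subrK.
Unshelve. all: by end_near. Qed.

(** Since [nb_links] counts each non-loop edge twice and each loop once, and the
    loops are [o (ell)] after erasure, there are at least [c / 4 * ell] non-loop
    edges.  A vertex of small degree in the erased graph either has small [d_i],
    and then tail regularity applies, or belongs to the [O (sqrt ell)] vertices
    of large [d_i], which contribute at most [O (sqrt ell)] times their degree
    bound. *)
Lemma ECM_uniformly_tail_regular : uniformly_tail_regular R G.
Proof.
apply: uniformly_tail_regular_near => eps e0.
have c8 : 0 < c / 8 by rewrite divr_gt0.
have [d1 d10 hd1] := tr c8.
have [d2 d20 hd2] := tr (mulr_gt0 e0 (divr_gt0 c8 (ltr0n _ 2))).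
exists (d2 * (eps * (c / 8 / 4))); first by rewrite !mulr_gt0 // ?divr_gt0.
move/cvgrPdist_le : nb_links_cvg => /(_ _ (divr_gt0 c0 (ltr0n _ 4))) hc.
near=> n.
have [M Mp GE] : exists2 M, M \in perfect_matchings (d n) & G n = collapse (CM_graph M).
  by near: n; exact: ECM_collapse.
have n0 : (0 < n)%N by near: n; exists 1%N.
have l0 : 0 < (ell (d n))%:R :> R by rewrite ltr0n ell_gt0.
have h1 : `|c - (nb_links (G n))%:R / (ell (d n))%:R| <= c / 4 by near: n.
have hn1 : \sum_(i < n | (tnth (d n) i)%:R <= d1 * Num.sqrt (ell (d n))%:R :> R)
       (tnth (d n) i)%:R <= c / 8 * (ell (d n))%:R by near: n.
have hn2 : \sum_(i < n | (tnth (d n) i)%:R <= d2 * Num.sqrt (ell (d n))%:R :> R)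
       (tnth (d n) i)%:R <= eps * (c / 8 / 2) * (ell (d n))%:R by near: n.
have hs : 8 / (c * d1) <= Num.sqrt (ell (d n))%:R by near: n; exact: sqrt_ell_near.
set s := Num.sqrt (ell (d n))%:R in hs hn1 hn2.
have s0 : 0 < s by rewrite sqrtr_gt0.
have sE : s ^+ 2 = (ell (d n))%:R by rewrite sqr_sqrtr.
set V1 := [set i : 'I_n | (d1 * s < (tnth (d n) i)%:R)%R]%SET.
set V2 := [set i : 'I_n | (d2 * s < (tnth (d n) i)%:R)%R]%SET.
have cV1 : #|V1|%:R * d1 <= s by exact: card_above.
have cV2 : #|V2|%:R * d2 <= s by exact: card_above.
have vd v : (vdeg (G n) v <= tnth (d n) v)%N by rewrite GE; exact: collapse_vdeg.
have mE : nb_links (G n) = ((nb_edges (G n)).*2 + \sum_i G n i i)%N.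
  rewrite -nb_edges_sym; last by move=> i j; rewrite GE collapse_sym.
  apply: eq_bigr => i _; apply: eq_bigr => j _; rewrite GE !collapseE.
  by case: (0 < CM_graph M i j)%N.
(* At most one loop at each of the few vertices of V1, and at most d_i elsewhere. *)
have diag : (\sum_i G n i i)%:R <= c / 4 * (ell (d n))%:R.
  rewrite natr_sum (bigID (mem V1)) /=.
  have -> : c / 4 * (ell (d n))%:R = c / 8 * s ^+ 2 + c / 8 * (ell (d n))%:R by rewrite sE; field.
  apply: lerD.
    apply: (@le_trans _ _ (\sum_(i in V1) 1)).
      by apply: ler_sum => i _; rewrite GE collapseE lern1 leq_b1.
    rewrite sumr_const.
    have : #|V1|%:R * d1 <= (c / 8 * s ^+ 2) * d1.
      apply: (le_trans cV1); have := hs; rewrite ler_pdivrMr ?mulr_gt0 // => h8.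
      have : 8 * s <= s * (c * d1) * s by rewrite ler_pM2r.
      have -> : c / 8 * s ^+ 2 * d1 = (s * (c * d1) * s) / 8 by field.
      lra.
    by rewrite (ler_pM2r d10).
  apply: le_trans hn1; rewrite big_mkcond [leRHS]big_mkcond /=; apply: ler_sum => i _.
  rewrite inE -leNgt; case: ifP => // _; rewrite ler_nat; apply: leq_trans (vd i).
  by rewrite /vdeg leq_addl.
have nb : c / 4 * (ell (d n))%:R <= (nb_edges (G n))%:R.
  move: h1; rewrite ler_distlC => /andP[h1 _].
  have : (c - c / 4) * (ell (d n))%:R <= (nb_links (G n))%:R by rewrite -ler_pdivlMr.
  rewrite mE natrD -muln2 natrM; lra.
have nb0 : 0 < (nb_edges (G n))%:R :> R by apply: lt_le_trans nb; rewrite mulr_gt0 // divr_gt0.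
have nble : (nb_edges (G n) <= ell (d n))%N.
  rewrite /ell /nb_edges; apply: leq_sum => v _; apply: leq_trans (vd v); rewrite /vdeg.
  by apply: leq_trans (leq_addr _ _); rewrite big_mkcond; apply: leq_sum => j _; case: ifP.
have snb : Num.sqrt (nb_edges (G n))%:R <= s by rewrite ler_wsqrtr // ler_nat.
rewrite mulrC ltr_pdivrMr //.
apply: (@lt_le_trans _ _ (eps * (c / 4 * (ell (d n))%:R))); last by rewrite ler_pM2l.
rewrite big_mkcond /= (bigID (mem V2)) /=.
apply: (@le_lt_trans _ _ (\sum_(i in V2) d2 * (eps * (c / 8 / 4)) * s + eps * (c / 8 / 2) * (ell (d n))%:R)).
  apply: lerD.
    apply: ler_sum => v _; case: ifPn => h; first apply: (le_trans h); last first.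
      by rewrite !mulr_ge0 ?(ltW d20) ?(ltW e0) ?(ltW s0) ?(ltW c0).
    by rewrite ler_wpM2l // !mulr_ge0 ?(ltW d20) ?(ltW e0) ?(ltW c0).
  apply: le_trans hn2; rewrite big_mkcond [leRHS]big_mkcond /=; apply: ler_sum => i _.
  rewrite inE -leNgt; case: ifP => // _; case: ifP => // _.
  by rewrite ler_nat.
rewrite sumr_const -[_ *+ _]mulr_natl.
have -> : #|V2|%:R * (d2 * (eps * (c / 8 / 4)) * s) = (#|V2|%:R * d2) * (eps * (c / 8 / 4) * s) by ring.
have q0 : 0 < eps * (c / 8 / 4) by rewrite !mulr_gt0 // ?divr_gt0.
have : (#|V2|%:R * d2) * (eps * (c / 8 / 4) * s) <= s * (eps * (c / 8 / 4) * s).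
  by rewrite ler_wpM2r // mulr_ge0 // ltW.
have -> : s * (eps * (c / 8 / 4) * s) = eps * (c / 8 / 4) * (ell (d n))%:R by rewrite -sE; ring.
have : 0 < eps * c * (ell (d n))%:R by rewrite !mulr_gt0.
lra.
Unshelve. all: by end_near. Qed.

End ECMseq.
End Asymptotics.

(** * Empirical degree measures and their vague limit *)

Lemma RposE (R : realType) : @Rpos R = [set x | 0 < x].
Proof. by apply/funext => x; rewrite /Rpos /= in_itv /= andbT. Qed.

Lemma RnnegE (R : realType) : @Rnneg R = [set x | 0 <= x].
Proof. by apply/funext => x; rewrite /Rnneg /= in_itv /= andbT. Qed.

Section EmpiricalMeasure.
Variables (R : realType) (n : nat) (d : n.-tuple nat).
Hypothesis d_pos : forall i : 'I_n, (0 < tnth d i)%N.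
Hypothesis ell_pos : (0 < ell d)%N.

Let s : R := Num.sqrt (ell d)%:R.

Let s_gt0 : 0 < s. Proof. by rewrite sqrtr_gt0 ltr0n. Qed.

Lemma measurable_Rpos : measurable (@Rpos R : set (measurableTypeR R)).
Proof. exact: measurable_itv. Qed.

(** The integral of [h] against [rho_n]. *)
Definition emp (h : R -> R) : R := s^-1 * \sum_(i < n) h ((tnth d i)%:R / s).

Lemma emp_ge0 h : (forall x, 0 < x -> 0 <= h x) -> 0 <= emp h.
Proof.
move=> h0; rewrite mulr_ge0 ?invr_ge0 ?(ltW s_gt0) // sumr_ge0 // => i _.
by rewrite h0 // divr_gt0 // ltr0n.
Qed.

Lemma emp_le h k : (forall x, 0 < x -> h x <= k x) -> emp h <= emp k.
Proof.
move=> hk; rewrite ler_wpM2l ?invr_ge0 ?(ltW s_gt0) // ler_sum // => i _.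
by rewrite hk // divr_gt0 // ltr0n.
Qed.

Lemma empD h k : emp (fun x => h x + k x) = emp h + emp k.
Proof. by rewrite /emp big_split mulrDr. Qed.

Lemma empZ c h : emp (fun x => c * h x) = c * emp h.
Proof. by rewrite /emp -mulr_sumr mulrCA. Qed.

(** The normalization behind all compactness arguments: [x rho_n(dx)] is a
    probability. *)
Lemma emp_id : emp id = 1.
Proof.
rewrite /emp -mulr_suml mulrCA -invfM -expr2 sqr_sqrtr // -natr_sum.
by rewrite divff // gt_eqF // ltr0n.
Qed.

Lemma ge0_integral_rho_n (h : R -> \bar R) : measurable_fun (@Rpos R) h ->
  (forall x : R, 0 < x -> (0 <= h x)%E) ->
  (\int[rho_n R d]_(x in @Rpos R) h x =
   (s^-1)%:E * \sum_(i < n) h ((tnth d i)%:R / s)%R)%E.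
Proof.
move=> mh h0; have mR := measurable_Rpos.
have h0' x : @Rpos R x -> (0 <= h x)%E by rewrite RposE /=; exact: h0.
rewrite /rho_n ge0_integral_mscale //; congr (_ * _)%E.
rewrite ge0_integral_measure_sum //; apply: eq_bigr => i _.
rewrite integral_dirac // (tnth_nth 0%N) diracE mem_set ?mul1e //.
rewrite RposE /= divr_gt0 // ltr0n -tnth_nth; exact: d_pos.
Qed.

Lemma integral_rho_nE (h : R -> R) : measurable_fun (@Rpos R) h ->
  (forall x, 0 < x -> 0 <= h x) ->
  (\int[rho_n R d]_(x in @Rpos R) (h x)%:E = (emp h)%:E)%E.
Proof.
move=> mh h0; rewrite ge0_integral_rho_n //.
- by rewrite sumEFin -EFinM.
- by apply/measurable_EFinP.
Qed.

Lemma measurable_min1 (D : set (measurableTypeR R)) : measurable D ->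
  measurable_fun D (fun x : R => Num.min x 1).
Proof. by move=> mD; apply: measurable_minr. Qed.

Lemma b_nE : b_n R d = emp (fun x => Num.min x 1).
Proof.
rewrite /b_n /Rintegral integral_rho_nE //.
  by apply: measurable_min1; exact: measurable_Rpos.
by move=> x x0; rewrite le_min ltW //=.
Qed.

(** Convergence of [edge_intensity] to [c] thus says that the linking probabilities
    add up to about [c * ell]. *)
Lemma edge_intensityE : edge_intensity (rho_n R d) =
  ((\sum_(i < n) \sum_(j < n) link_prob R d i j) / (ell d)%:R)%:E.
Proof.
have mR := measurable_Rpos.
have h0 (y x : R) : 0 < y -> 0 < x -> 0 <= 1 - expR (- (x * y)).
  by move=> y0 x0; rewrite subr_ge0 -expR0 ler_expR oppr_le0 mulr_ge0 // ltW.
have mx (y : R) : measurable_fun (@Rpos R) (fun x : R => 1 - expR (- (x * y))).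
  apply: measurable_funTS; apply: measurable_funB => //.
  apply: measurableT_comp => //; apply: measurableT_comp => //.
  by apply: measurable_funM.
have inner (y : R) : 0 < y ->
   (\int[rho_n R d]_(x in @Rpos R) (1 - expR (- (x * y)))%:E =
     (emp (fun x => 1 - expR (- (x * y))))%:E)%E.
  by move=> y0; rewrite integral_rho_nE // => x x0; exact: h0.
rewrite /edge_intensity.
have -> : (\int[rho_n R d]_(y in @Rpos R) \int[rho_n R d]_(x in @Rpos R) (1 - expR (- (x * y)))%:E
   = \int[rho_n R d]_(y in @Rpos R) (emp (fun x => 1 - expR (- (x * y))))%:E)%E.
  by apply: eq_integral => y; rewrite inE => Ry; apply: inner; move: Ry; rewrite RposE.
rewrite integral_rho_nE; first last.
- by move=> y y0; apply: emp_ge0 => x x0; exact: h0.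
- apply: measurable_funTS; apply: measurable_funM => //.
  apply: measurable_sum => i; apply: measurable_funB => //.
  by apply: measurableT_comp => //; apply: measurableT_comp.
congr (_%:E); rewrite /emp -mulr_sumr mulrA -invfM -expr2 sqr_sqrtr // mulrC.
congr (_ / _); rewrite exchange_big; apply: eq_bigr => i _; apply: eq_bigr => j _.
rewrite /link_prob mulrACA -invfM -expr2 sqr_sqrtr //.
Qed.

End EmpiricalMeasure.

Section Bump.
Variable R : realType.
Implicit Types (t x : R) (k : nat).

(** A continuous function with compact support in the open half-line, equal to 1
    on [t + 1 / (k + 1), t + k + 1] and to 0 outside
    [t + 1 / (2 (k + 1)), 2 (t + k + 1)], for [t >= 0]; it increases to the
    indicator of the half-line above [t], so that vague convergence can be
    applied to tails. *)
Definition bump t k x : R :=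
  Num.max 0 (Num.min 1 (Num.min ((x - t) * (2 * k.+1%:R) - 1) (2 - x / (t + k.+1%:R)))).

Lemma bump_ge0 t k x : 0 <= bump t k x.
Proof. by rewrite /bump le_max lexx. Qed.

Lemma bump_le1 t k x : bump t k x <= 1.
Proof. by rewrite /bump ge_max ler01 ge_min lexx. Qed.

Lemma bump_continuous t k : continuous (bump t k).
Proof.
pose f : R -> R^o := fun x => (x - t) * (2 * k.+1%:R) - 1.
pose g : R -> R^o := fun x => 2 - x / (t + k.+1%:R).
have cf : continuous f.
  move=> x; apply: cvgB; last exact: cvg_cst.
  by apply: cvgM; [apply: cvgB; [exact: cvg_id|exact: cvg_cst]|exact: cvg_cst].
have cg : continuous g.
  by move=> x; apply: cvgB; [exact: cvg_cst|apply: cvgM; [exact: cvg_id|exact: cvg_cst]].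
have -> : bump t k = (cst 0 : R -> R^o) \max ((cst 1 : R -> R^o) \min (f \min g)) by [].
move=> x; apply: (@continuous_max R R); first exact: cvg_cst.
apply: (@continuous_min R R); first exact: cvg_cst.
by apply: (@continuous_min R R); [exact: cf|exact: cg].
Qed.

Lemma bump_left t k x : x <= t + (2 * k.+1%:R)^-1 -> bump t k x = 0.
Proof.
move=> h; have k0 : 0 < 2 * k.+1%:R :> R by rewrite mulr_gt0.
apply/max_idPl; rewrite ge_min; apply/orP; right; rewrite ge_min; apply/orP; left.
by rewrite subr_le0 -ler_pdivlMr // mul1r lerBlDl.
Qed.

Lemma bump_right t k x : 0 <= t -> 2 * (t + k.+1%:R) <= x -> bump t k x = 0.
Proof.
move=> t0 h; have k0 : 0 < t + k.+1%:R by rewrite ltr_wpDl.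
apply/max_idPl; rewrite ge_min; apply/orP; right; rewrite ge_min; apply/orP; right.
by rewrite subr_le0 ler_pdivlMr.
Qed.

Lemma bump_mid t k x : 0 <= t -> t + k.+1%:R^-1 <= x <= t + k.+1%:R -> bump t k x = 1.
Proof.
move=> t0 /andP[h1 h2]; have k0 : 0 < t + k.+1%:R by rewrite ltr_wpDl.
have -> : bump t k x = Num.max 0 1.
  rewrite /bump; congr (Num.max _ _); apply/min_idPl; rewrite le_min; apply/andP; split.
    have : k.+1%:R^-1 * k.+1%:R <= (x - t) * k.+1%:R by rewrite ler_wpM2r // lerBrDl.
    by rewrite mulVf // => h; lra.
  have : x / (t + k.+1%:R) <= 1 by rewrite ler_pdivrMr // mul1r.
  lra.
by apply/max_idPr.
Qed.

Lemma bump_homo t x : 0 <= t -> 0 <= x -> {homo (fun k => bump t k x) : k l / (k <= l)%N >-> k <= l}.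
Proof.
move=> t0 x0 k l kl; have [xt|tx] := leP x t.
  by rewrite bump_left ?bump_ge0 // (le_trans xt) // lerDl invr_ge0 mulr_ge0.
have kl' : k.+1%:R <= l.+1%:R :> R by rewrite ler_nat.
have tk : 0 < t + k.+1%:R by rewrite ltr_wpDl.
have h1 : (x - t) * (2 * k.+1%:R) - 1 <= (x - t) * (2 * l.+1%:R) - 1.
  by rewrite lerD2r ler_wpM2l ?subr_ge0 ?(ltW tx) // ler_pM2l.
have h2 : 2 - x / (t + k.+1%:R) <= 2 - x / (t + l.+1%:R).
  by rewrite lerD2l lerN2 ler_wpM2l // lef_pV2 ?posrE ?lerD2l // ltr_wpDl.
apply: le_max2 => //; apply: le_min2 => //; exact: le_min2.
Qed.

Lemma bump_near t x : 0 <= t -> t < x -> \forall k \near \oo, bump t k x = 1.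
Proof.
move=> t0 tx; have x0 : 0 < x - t by rewrite subr_gt0.
near=> k; apply: bump_mid => //; apply/andP; split.
  by rewrite -lerBrDl; apply: ltW; near: k; exact: (near_infty_natSinv_lt (PosNum x0)).
rewrite -lerBlDl; apply: (@le_trans _ _ k%:R); last by rewrite ler_nat.
by near: k; exact: nbhs_infty_ger.
Unshelve. all: by end_near. Qed.

End Bump.

Section VagueLimit.
Variables (R : realType) (d : forall n : nat, n.-tuple nat)
  (rho : {measure set (measurableTypeR R) -> \bar R}).
Hypothesis d_pos : forall (n : nat) (i : 'I_n), (0 < tnth (d n) i)%N.
Hypothesis rho_cvg : vague_cvg (fun n => rho_n R (d n)) rho.

Let dn_pos n : (0 < n)%N -> (0 < ell (d n))%N.
Proof. by move=> n0; apply: leq_trans n0 (leq_ell d_pos n). Qed.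

Let near_pos : \forall n \near \oo, (0 < n)%N. Proof. by exists 1%N. Qed.

Lemma measurable_continuous (f : R -> R) (D : set (measurableTypeR R)) : continuous f ->
  measurable_fun D f.
Proof. by move=> cf; apply: measurable_funTS; apply: continuous_measurable_fun. Qed.

(** The finiteness of the limit comes from [emp_id], as [f] is dominated by a
    multiple of the identity. *)
Lemma emp_cvg (f : R -> R) (a B C : R) : 0 < a -> continuous f ->
  (forall x, 0 < x -> 0 <= f x <= C * x) -> (forall x, x <= a \/ B <= x -> f x = 0) ->
  exists I : R, (\int[rho]_(x in @Rpos R) (f x)%:E = I%:E)%E /\
     emp (d n) f @[n --> \oo] --> I.
Proof.
move=> a0 cf f0 fK.
have f00 x : 0 < x -> 0 <= f x by move=> /f0 /andP[].
have h : (emp (d n) f)%:E @[n --> \oo] --> (\int[rho]_(x in @Rpos R) (f x)%:E)%E.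
  have : (\int[rho_n R (d n)]_(x in @Rpos R) (f x)%:E)%E @[n --> \oo] -->
     (\int[rho]_(x in @Rpos R) (f x)%:E)%E.
    apply: (rho_cvg (K := `[a, B]%classic)) => //.
    - exact: segment_compact.
    - move=> x /=; rewrite /Rpos /= !in_itv /= andbT => /andP[ax _].
      exact: lt_le_trans ax.
    - move=> x /=; rewrite in_itv /= => /negP; rewrite negb_and -!ltNge.
      by case/orP => hx; apply: fK; [left|right]; exact: ltW.
  apply: cvg_trans; apply: near_eq_cvg; near=> n.
  have n0 : (0 < n)%N by near: n.
  rewrite integral_rho_nE //; first exact: dn_pos.
  exact: measurable_continuous.
have fin : (\int[rho]_(x in @Rpos R) (f x)%:E)%E \is a fin_num.
  rewrite ge0_fin_numE; last first.
    apply: integral_ge0 => x; rewrite RposE /= => x0.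
    by rewrite lee_fin f00.
  apply: (@le_lt_trans _ _ C%:E); last exact: ltry.
  rewrite -(cvg_lim _ h) //; apply: lime_le; first by apply/cvg_ex; eexists; exact: h.
  near=> n; have n0 : (0 < n)%N by near: n.
  rewrite lee_fin -[leRHS]mulr1 -(emp_id R (dn_pos n0)) -empZ.
  by apply: emp_le => //; [exact: dn_pos|move=> x /f0 /andP[]].
exists (fine (\int[rho]_(x in @Rpos R) (f x)%:E)%E); rewrite fineK //; split => //.
by rewrite -(fineK fin) in h; exact: (fine_cvg h).
Unshelve. all: by end_near. Qed.

Lemma bump_le_lin t k (x : R) : 0 <= t -> 0 < x -> bump t k x <= 2 * k.+1%:R * x.
Proof.
move=> t0 x0; have k0 : 0 < 2 * k.+1%:R :> R by rewrite mulr_gt0.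
have [h|h] := leP x (2 * k.+1%:R)^-1.
  by rewrite bump_left ?mulr_ge0 ?(ltW x0) // (le_trans h) // lerDr.
apply: (le_trans (bump_le1 _ _ _)).
by rewrite -ler_pdivrMl // mulr1 ltW.
Qed.

Lemma bump_support t k (x : R) : 0 <= t ->
  x <= (2 * k.+1%:R)^-1 \/ 2 * (t + k.+1%:R) <= x -> bump t k x = 0.
Proof.
move=> t0 [h|h]; last exact: bump_right.
by apply: bump_left; rewrite (le_trans h) // lerDr.
Qed.

Lemma emp_bump t k : 0 <= t ->
  exists I : R, (\int[rho]_(x in @Rpos R) (bump t k x)%:E = I%:E)%E /\
     emp (d n) (bump t k) @[n --> \oo] --> I.
Proof.
move=> t0; apply: (@emp_cvg _ (2 * k.+1%:R)^-1 (2 * (t + k.+1%:R)) (2 * k.+1%:R)).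
- by rewrite invr_gt0 mulr_gt0.
- exact: bump_continuous.
- by move=> x x0; rewrite bump_ge0 bump_le_lin.
- by move=> x; exact: bump_support.
Qed.

(** The part of [min (x, 1)] that vague convergence sees. *)
Definition trunc_min k (x : R) : R := Num.min x 1 * bump 0 k x.

Lemma min1_ge0 (x : R) : 0 < x -> 0 <= Num.min x 1.
Proof. by move=> x0; rewrite le_min ltW //=. Qed.

Lemma trunc_min_continuous k : continuous (trunc_min k).
Proof.
move=> x; apply: cvgM; last exact: bump_continuous.
by apply: (@continuous_min R R id (cst 1)); [exact: cvg_id|exact: cvg_cst].
Qed.

Lemma trunc_min_le k (x : R) : 0 < x -> 0 <= trunc_min k x <= Num.min x 1.
Proof.
move=> x0; rewrite mulr_ge0 ?min1_ge0 ?bump_ge0 //=.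
by rewrite -[leRHS]mulr1 ler_wpM2l ?min1_ge0 ?bump_le1.
Qed.

Lemma emp_trunc_min k :
  exists I : R, (\int[rho]_(x in @Rpos R) (trunc_min k x)%:E = I%:E)%E /\
     emp (d n) (trunc_min k) @[n --> \oo] --> I.
Proof.
apply: (@emp_cvg _ (2 * k.+1%:R)^-1 (2 * (0 + k.+1%:R)) 1).
- by rewrite invr_gt0 mulr_gt0.
- exact: trunc_min_continuous.
- move=> x x0; have /andP[-> h] := trunc_min_le k x0; rewrite (le_trans h) // mul1r.
  by rewrite ge_min lexx.
- by move=> x h; rewrite /trunc_min bump_support ?mulr0.
Qed.

Lemma integral_trunc_min_cvg :
  (\int[rho]_(x in @Rpos R) (trunc_min k x)%:E)%E @[k --> \oo] -->
  (\int[rho]_(x in @Rpos R) (Num.min x 1)%:E)%E.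
Proof.
have -> : (\int[rho]_(x in @Rpos R) (Num.min x 1)%:E =
  \int[rho]_(x in @Rpos R) limn (fun k => (trunc_min k x)%:E))%E.
  apply: eq_integral => x; rewrite inE RposE /= => x0.
  apply/esym/cvg_lim => //; apply: cvg_near_cst.
  apply: filterS (bump_near (lexx 0) x0) => k; rewrite /trunc_min => ->.
  by rewrite mulr1.
apply: cvg_monotone_convergence => //; first exact: measurable_Rpos.
- move=> k; apply/measurable_EFinP; apply: measurable_continuous.
  exact: trunc_min_continuous.
- move=> k x; rewrite RposE /= => x0.
  by rewrite lee_fin; have /andP[] := trunc_min_le k x0.
move=> x; rewrite RposE /= => x0 k l kl.
rewrite lee_fin /trunc_min ler_wpM2l ?min1_ge0 //.
by apply: bump_homo => //; exact: ltW.
Qed.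

Lemma emp_small n delta : (0 < n)%N -> emp (d n) (fun x : R => if x <= delta then x else 0) =
  (\sum_(i < n | ((tnth (d n) i)%:R <= delta * Num.sqrt (ell (d n))%:R :> R))
     (tnth (d n) i)%:R) / (ell (d n))%:R.
Proof.
move=> n0; have s0 : 0 < Num.sqrt (ell (d n))%:R :> R by rewrite sqrtr_gt0 ltr0n dn_pos.
rewrite /emp [in RHS]big_mkcond mulr_suml mulr_sumr; apply: eq_bigr => i _.
rewrite ler_pdivrMr //; case: ifP => _; last by rewrite mulr0 mul0r.
by rewrite mulrCA -invfM -expr2 sqr_sqrtr.
Qed.

Lemma small_le_trunc k (x : R) : 0 < x ->
  (if x <= (2 * k.+1%:R)^-1 then x else 0) <= Num.min x 1 - trunc_min k x.
Proof.
move=> x0; case: ifPn => h; last by rewrite subr_ge0; have /andP[] := trunc_min_le k x0.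
rewrite /trunc_min bump_support ?lexx //; last by left.
rewrite mulr0 subr0 le_min lexx /= (le_trans h) // invf_le1 ?mulr_gt0 //.
by rewrite -natrM ler1n.
Qed.

(** Truncation near infinity costs little because there [1 <= x / (k + 1)], and the
    identity has [rho_n]-integral 1. *)
Lemma trunc_le_small k (x : R) : 0 < x ->
  Num.min x 1 - trunc_min k x <= (if x <= k.+1%:R^-1 then x else 0) + k.+1%:R^-1 * x.
Proof.
move=> x0; have /andP[t0 _] := trunc_min_le k x0.
have k0 : 0 < k.+1%:R :> R by [].
have p : 0 <= k.+1%:R^-1 * x by rewrite mulr_ge0 // ltW.
have m1 : Num.min x 1 <= x by rewrite ge_min lexx.
have m2 : Num.min x 1 <= 1 by rewrite ge_min lexx orbT.
case: ifPn => h.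
  by rewrite (le_trans _ (_ : x <= _)) ?lerDl // (le_trans _ m1) // gerBl.
rewrite -ltNge in h; have [xk|xk] := leP x k.+1%:R.
  by rewrite /trunc_min bump_mid ?lexx // ?add0r ?(ltW h) // mulr1 subrr.
have h1 : 1 <= k.+1%:R^-1 * x by rewrite ler_pdivlMl // mulr1 ltW.
by rewrite add0r (le_trans _ h1) // (le_trans _ m2) // gerBl.
Qed.

Variable b : R.
Hypothesis b_cvg : b_n R (d n) @[n --> \oo] --> b.

Lemma emp_min_cvg : emp (d n) (fun x : R => Num.min x 1) @[n --> \oo] --> b.
Proof.
apply: cvg_trans b_cvg; apply: near_eq_cvg; near=> n.
by rewrite b_nE //; apply: dn_pos; near: n.
Unshelve. all: by end_near. Qed.

Lemma trunc_min_limits : exists2 I_ : nat -> R,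
   forall k, emp (d n) (trunc_min k) @[n --> \oo] --> I_ k &
   I_ @ \oo --> (\int[rho]_(x in @Rpos R) Num.min x 1).
Proof.
have /boolp.choice[I_ hI] := emp_trunc_min; exists I_; first by move=> k; have [] := hI k.
have Ib k : I_ k <= b.
  have [_ h] := hI k; apply: (ler_cvg_to h emp_min_cvg); near=> n.
  by apply: emp_le => //; [apply: dn_pos; near: n|move=> x /(trunc_min_le k) /andP[]].
have := integral_trunc_min_cvg.
under eq_fun do rewrite (hI _).1.
move=> h; have fin : (\int[rho]_(x in @Rpos R) (Num.min x 1)%:E)%E \is a fin_num.
  rewrite ge0_fin_numE; last first.
    by apply: integral_ge0 => x; rewrite RposE /= => /min1_ge0; rewrite lee_fin.
  apply: (@le_lt_trans _ _ b%:E); last exact: ltry.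
  rewrite -(cvg_lim _ h) //; apply: lime_le; first by apply/cvg_ex; eexists; exact: h.
  by apply: nearW => k; rewrite lee_fin.
by rewrite -(fineK fin) in h; exact: (fine_cvg h).
Unshelve. all: by end_near. Qed.

(** For fixed [k] the integral against [rho_n] of [min (x, 1) - trunc_min k x]
    converges to [b - I_ k].  By [small_le_trunc] and [trunc_le_small] this
    difference is the mass [x rho_n(dx)] near 0, up to [1 / (k + 1)], and [I_ k]
    increases to the [rho]-integral of [min (x, 1)]. *)
Lemma I_CM_tail_regular : I_CM b rho = 0 <-> tail_regular R d.
Proof.
have [I_ hI I_cvg] := trunc_min_limits.
set I := \int[rho]_(x in @Rpos R) _ in I_cvg.
have bn := emp_min_cvg.
have diff k : emp (d n) (fun x => Num.min x 1 - trunc_min k x) @[n --> \oo] --> b - I_ k.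
  rewrite (_ : (fun n => _) = (fun n => emp (d n) (fun x : R => Num.min x 1) - emp (d n) (trunc_min k))).
    exact: cvgB.
  apply/funext => n; rewrite empD; congr (_ + _).
  by rewrite /emp sumrN mulrN.
have -> : I_CM b rho = 0 <-> b = I.
  rewrite /I_CM -/I; split => [/eqP|->]; last by rewrite subrr expr0n mul0r.
  by rewrite mulf_eq0 invr_eq0 pnatr_eq0 orbF sqrf_eq0 subr_eq0 => /eqP.
split => [bI eps e0|tr].
  have := I_cvg; move/cvgrPdist_lt => /(_ _ (divr_gt0 e0 (ltr0n _ 2)))[k _ /(_ k (leqnn k))] hk.
  exists (2 * k.+1%:R)^-1; first by rewrite invr_gt0 mulr_gt0.
  have := diff k; move/cvgrPdist_lt => /(_ _ (divr_gt0 e0 (ltr0n _ 2))) hd.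
  near=> n; have n0 : (0 < n)%N by near: n.
  have l0 : 0 < (ell (d n))%:R :> R by rewrite ltr0n dn_pos.
  rewrite -ler_pdivrMr // -emp_small //.
  apply: (@le_trans _ _ (emp (d n) (fun x => Num.min x 1 - trunc_min k x))).
    by apply: emp_le => //; [exact: dn_pos|move=> x; exact: small_le_trunc].
  have h1 : `|b - I_ k - emp (d n) (fun x => Num.min x 1 - trunc_min k x)| < eps / 2 by near: n.
  move: h1; rewrite ltr_distlC => /andP[_ h1].
  move: hk; rewrite -bI /= ltr_norml => /andP[_ h2].
  by apply: ltW; move: h1 h2; set q := emp _ _; lra.
apply/eqP; rewrite eq_le; apply/andP; split; last first.
  apply: (ler_cvg_to I_cvg (cvg_cst b)); apply: nearW => k.
  apply: (ler_cvg_to (hI k) bn); near=> n.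
  by apply: emp_le => //; [apply: dn_pos; near: n|move=> x /(trunc_min_le k) /andP[]].
apply/ler_addgt0Pr => eps e0.
have [delta d0 hd] := tr _ (divr_gt0 e0 (ltr0n _ 2)).
rewrite -lerBlDl.
apply: (ler_cvg_to (cvgB (cvg_cst b) I_cvg) (cvg_cst eps)); near=> k.
have k1 : k.+1%:R^-1 <= delta.
  by apply: ltW; near: k; exact: (near_infty_natSinv_lt (PosNum d0)).
have k2 : k.+1%:R^-1 <= eps / 2.
  by apply: ltW; near: k; exact: (near_infty_natSinv_lt (PosNum (divr_gt0 e0 (ltr0n _ 2)))).
apply: (ler_cvg_to (diff k) (cvg_cst eps)); near=> n.
have n0 : (0 < n)%N by near: n.
have l0 : 0 < (ell (d n))%:R :> R by rewrite ltr0n dn_pos.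
apply: (@le_trans _ _ (emp (d n) (fun x => (if x <= k.+1%:R^-1 then x else 0) + k.+1%:R^-1 * x))).
  by apply: emp_le => //; [exact: dn_pos|exact: trunc_le_small].
rewrite empD empZ emp_id ?dn_pos // mulr1 [leRHS]splitr lerD //.
apply: (@le_trans _ _ (emp (d n) (fun x => if x <= delta then x else 0))).
  apply: emp_le => //; first exact: dn_pos.
  move=> x x0; case: ifPn => h; last by case: ifP => // _; exact: ltW.
  by rewrite (le_trans h k1).
rewrite emp_small // ler_pdivrMr //; near: n; exact: hd.
Unshelve. all: by end_near. Qed.

(** The tail function of [rho_n]. *)
Definition rhobar_n n (t : R) : R := emp (d n) (fun x => (t < x)%R%:R).

Lemma rhobar_bump_cvg t : 0 <= t ->
  (\int[rho]_(x in @Rpos R) (bump t k x)%:E)%E @[k --> \oo] --> rhobar rho t.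
Proof.
move=> t0.
have mI : measurable (`]t, +oo[%classic : set (measurableTypeR R)) by exact: measurable_itv.
have -> : rhobar rho t = (\int[rho]_(x in @Rpos R) limn (fun k => (bump t k x)%:E))%E.
  rewrite /rhobar -[in LHS](setIidl (_ : `]t, +oo[ `<=` @Rpos R)); last first.
    by move=> x /=; rewrite /Rpos /= !in_itv /= !andbT => /(le_lt_trans t0).
  rewrite -integral_indic //; last exact: measurable_Rpos.
  apply: eq_integral => x; rewrite inE RposE /= => x0.
  apply/esym/cvg_lim => //; apply: cvg_near_cst; rewrite indicE.
  have [tx|xt] := ltP t x.
    rewrite mem_set; last by rewrite /= in_itv /= andbT.
    by apply: filterS (bump_near t0 tx) => k ->.
  rewrite memNset; last by rewrite /= in_itv /= andbT; apply/negP; rewrite -leNgt.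
  by apply: nearW => k; rewrite bump_left // (le_trans xt) // lerDl invr_ge0 mulr_ge0.
apply: cvg_monotone_convergence => //; first exact: measurable_Rpos.
- move=> k; apply/measurable_EFinP; apply: measurable_continuous.
  exact: bump_continuous.
- by move=> k x _; rewrite lee_fin bump_ge0.
move=> x; rewrite RposE /= => x0 k l kl.
by rewrite lee_fin; apply: bump_homo => //; exact: ltW.
Qed.

(** A test function below the indicator of the half-line with [rho]-integral above
    [y]. *)
Lemma rhobar_n_gt_near t y : 0 <= t -> (y%:E < rhobar rho t)%E ->
  \forall n \near \oo, y < rhobar_n n t.
Proof.
move=> t0 h; have c := rhobar_bump_cvg t0.
have [k hk] : exists k, (y%:E < \int[rho]_(x in @Rpos R) (bump t k x)%:E)%E.
  apply: contrapT => nk; move: h; apply/negP; rewrite -leNgt -(cvg_lim _ c) //.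
  apply: lime_le; first by apply/cvg_ex; eexists; exact: c.
  by apply: nearW => k; rewrite leNgt; apply/negP => hk; apply: nk; exists k.
have [I [IE cI]] := emp_bump k t0; rewrite IE lte_fin in hk.
have := cI; move/cvgrPdist_lt => /(_ (I - y)); rewrite subr_gt0 => /(_ hk) hn.
near=> n; have n0 : (0 < n)%N by near: n.
have : `|I - emp (d n) (bump t k)| < I - y by near: n.
rewrite ltr_norml => /andP[_]; rewrite ltrD2l ltrN2 => /lt_le_trans; apply.
apply: emp_le => //; first exact: dn_pos.
move=> x x0; case: ltP => tx; first exact: bump_le1.
by rewrite bump_left // (le_trans tx) // lerDl invr_ge0 mulr_ge0.
Unshelve. all: by end_near. Qed.

(** A test function above the indicator of the half-line on bounded sets; the far
    tail is at most [1 / (k + 1)] since [x rho_n(dx)] has mass 1.  The gap between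
    [t0] and [t] leaves room for continuity. *)
Lemma rhobar_n_lt_near t0 t y : 0 <= t0 -> t0 < t -> (rhobar rho t0 < y%:E)%E ->
  \forall n \near \oo, rhobar_n n t < y.
Proof.
move=> t00 tt h.
have fin : rhobar rho t0 \is a fin_num.
  by rewrite ge0_fin_numE ?measure_ge0 // (lt_le_trans h) // leey.
set r := fine (rhobar rho t0); have rE : rhobar rho t0 = r%:E by rewrite fineK.
have ry : r < y by rewrite rE lte_fin in h.
have [k [k1 k2]] : exists k, k.+1%:R^-1 <= t - t0 /\ k.+1%:R^-1 < (y - r) / 2.
  have yr : 0 < (y - r) / 2 by rewrite divr_gt0 // subr_gt0.
  have tt0 : 0 < t - t0 by rewrite subr_gt0.
  near \oo => k; exists k; split.
    by apply: ltW; near: k; exact: (near_infty_natSinv_lt (PosNum tt0)).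
  by near: k; exact: (near_infty_natSinv_lt (PosNum yr)).
have [I [IE cI]] := emp_bump k t00.
have Ir : I <= r.
  rewrite -lee_fin -IE -rE; have c := @rhobar_bump_cvg _ t00.
  rewrite -(cvg_lim _ c) //; apply: lime_ge; first by apply/cvg_ex; eexists; exact: c.
  near=> l; apply: ge0_le_integral => //.
  - exact: measurable_Rpos.
  - by move=> x _; rewrite lee_fin bump_ge0.
  - by apply/measurable_EFinP; apply: measurable_continuous; exact: bump_continuous.
  - by apply/measurable_EFinP; apply: measurable_continuous; exact: bump_continuous.
  move=> x; rewrite RposE /= => x0; rewrite lee_fin.
  by apply: bump_homo => //; [exact: ltW|near: l; exact: nbhs_infty_ge].
have := cI; move/cvgrPdist_lt => /(_ ((y - r) / 2)); rewrite divr_gt0 ?subr_gt0 // => /(_ isT) hn.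
near=> n; have n0 : (0 < n)%N by near: n.
have h1 : `|I - emp (d n) (bump t0 k)| < (y - r) / 2 by near: n.
apply: (@le_lt_trans _ _ (emp (d n) (fun x => bump t0 k x + k.+1%:R^-1 * x))).
  apply: emp_le => //; first exact: dn_pos.
  move=> x x0; case: ltP => tx; last by rewrite addr_ge0 ?bump_ge0 // mulr_ge0 // ltW.
  have [xk|xk] := leP x (t0 + k.+1%:R).
    rewrite bump_mid //; first by rewrite lerDl mulr_ge0 // ltW.
    by rewrite xk andbT -lerBrDl (le_trans k1) // lerD2r ltW.
  apply: ler_wpDl; first exact: bump_ge0.
  by rewrite ler_pdivlMl // mulr1 ltW // (le_lt_trans _ xk) // lerDr.
rewrite empD empZ emp_id ?dn_pos // mulr1.
move: h1; rewrite ltr_distlC => /andP[_ h1].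
by move: h1 k2; move: (emp _ _) (k.+1%:R^-1) => q z h1 k2; lra.
Unshelve. all: by end_near. Qed.

Lemma rhobar_n_le n t : (0 < n)%N -> 0 < t -> rhobar_n n t <= t^-1.
Proof.
move=> n0 t0; rewrite -[leRHS]mulr1 -(emp_id R (dn_pos n0)) -empZ.
apply: emp_le => //; first exact: dn_pos.
move=> x x0; case: ltP => tx /=; last by rewrite mulr_ge0 ?invr_ge0 // ltW.
by rewrite ler_pdivlMl // mulr1 ltW.
Qed.

(** Inherited from [rhobar_n_le]; it makes the generalized inverse finite. *)
Lemma rhobar_le t : 0 < t -> (rhobar rho t <= t^-1%:E)%E.
Proof.
move=> t0; rewrite leNgt; apply/negP => h.
have [n hn] : exists n, (0 < n)%N /\ t^-1 < rhobar_n n t.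
  near \oo => n; exists n; split; first by near: n.
  by near: n; exact: (rhobar_n_gt_near (ltW t0) h).
by have := rhobar_n_le hn.1 t0; rewrite leNgt hn.2.
Unshelve. all: by end_near. Qed.

End VagueLimit.

(** * Generalized inverses and degree profiles *)

Section Quantile.
Variables (R : realType) (rho : {measure set (measurableTypeR R) -> \bar R}).
Hypothesis rhobar_bound : forall t : R, 0 < t -> (rhobar rho t <= t^-1%:E)%E.
Implicit Types (s t x y : R).

Lemma rhobar_anti s t : s <= t -> (rhobar rho t <= rhobar rho s)%E.
Proof.
move=> st; apply: le_measure; rewrite ?inE; try exact: measurable_itv.
by move=> x /=; rewrite !in_itv /= !andbT; exact: le_lt_trans.
Qed.

Let S y := [set x : R | 0 <= x /\ (rhobar rho x <= y%:E)%E].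

Lemma rhobar_inv_lbound y : lbound (S y) 0.
Proof. by move=> x []. Qed.

Lemma rhobar_inv_ge0 y : 0 <= rhobar_inv rho y.
Proof.
rewrite /rhobar_inv -/(S y); case: eqP => // _.
have [->|S0] := eqVneq (S y) set0; first by rewrite inf0.
by apply: lb_le_inf; [exact/set0P|exact: rhobar_inv_lbound].
Qed.

Lemma rhobar_inv_neg y : y <= 0 -> rhobar_inv rho y = 0.
Proof.
rewrite /rhobar_inv; case: eqP => // /eqP y0 yle.
have ylt : y < 0 by rewrite lt_neqAle y0.
rewrite (_ : [set _ | _] = set0) ?inf0 //; apply/seteqP; split => // x [_].
by apply/negP; rewrite -ltNge (lt_le_trans _ (measure_ge0 _ _)) // lte_fin.
Qed.

Lemma rhobar_inv_gt y t : 0 < y -> 0 <= t -> t < rhobar_inv rho y -> (y%:E < rhobar rho t)%E.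
Proof.
move=> y0 t0; rewrite /rhobar_inv gt_eqF // => h; rewrite ltNge; apply/negP => ht.
have : inf (S y) <= t by apply: ge_inf; [exists 0; exact: rhobar_inv_lbound|split].
by rewrite leNgt h.
Qed.

Lemma rhobar_inv_lt y t : 0 < y -> rhobar_inv rho y < t -> (rhobar rho t <= y%:E)%E.
Proof.
move=> y0; rewrite /rhobar_inv gt_eqF // => h.
have hS : has_inf (S y).
  split; last by exists 0; exact: rhobar_inv_lbound.
  exists y^-1; split; first by rewrite invr_ge0 ltW.
  by have := rhobar_bound (_ : 0 < y^-1); rewrite invr_gt0 invrK; apply.
have e0 : 0 < t - inf (S y) by rewrite subr_gt0.
have [s [_ hs] st] := inf_adherent e0 hS.
by apply: le_trans hs; apply: rhobar_anti; rewrite subrKC in st; exact: ltW.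
Qed.

(** The upper level sets are intervals because the function is nonincreasing on the
    positive half-line and vanishes elsewhere. *)
Lemma measurable_rhobar_inv (D : set (measurableTypeR R)) : measurable D ->
  measurable_fun D (rhobar_inv rho : measurableTypeR R -> measurableTypeR R).
Proof.
move=> mD; apply: (@measurable_funS _ _ _ _ setT) => //.
apply: (measurability _ (RGenOInfty.measurableE R)) => //.
move=> _ [_ [t ->] <-]; rewrite setTI; have [t0|t0] := leP 0 t; last first.
  rewrite (_ : _ @^-1` _ = setT); first exact: measurableT.
  apply/seteqP; split => // y _ /=; rewrite in_itv /= andbT.
  exact: lt_le_trans (rhobar_inv_ge0 y).
apply: is_interval_measurable => a b /=; rewrite !in_itv /= !andbT => ha hb z /andP[az zb].
have a0 : 0 < a by rewrite ltNge; apply/negP => /rhobar_inv_neg h; move: ha; rewrite h ltNge t0.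
have [->|bz] := eqVneq z b; first by rewrite in_itv /= hb.
have z0 : 0 < z by exact: lt_le_trans az.
have b0 : 0 < b by exact: lt_le_trans zb.
rewrite in_itv /= andbT; apply: (lt_le_trans hb); rewrite leNgt; apply/negP => h.
have [q] := rat_in_itvoo h; rewrite in_itv /= => /andP[q1 q2].
have q0 : 0 <= ratr q :> R by apply: le_trans (rhobar_inv_ge0 z) (ltW q1).
have := rhobar_inv_gt b0 q0 q2; have := rhobar_inv_lt z0 q1 => h1 h2.
have := lt_le_trans h2 h1; rewrite lte_fin ltNge zb //.
Qed.

End Quantile.

Section SortedProfile.
Variables (R : realType) (n : nat) (d : n.-tuple nat).

Definition sorted_degree (k : nat) : nat := nth 0%N (sort geq d) k.

(** In a nonincreasing list the entries satisfying an upward closed predicate come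
    first. *)
Lemma nth_sorted_count (p : pred nat) (s : seq nat) k :
  (forall a b, (a <= b)%N -> p a -> p b) -> ~~ p 0%N -> sorted geq s ->
  p (nth 0%N s k) = (k < count p s)%N.
Proof.
move=> pm p0; elim: s k => [|a s IH] k ss; first by rewrite nth_nil ltn0 (negbTE p0).
have ss' : sorted geq s by move: ss => /=; case: s {IH} => //= b s /andP[].
have all_le : all (fun b => b <= a)%N s.
  have tr : transitive geq by move=> x y z /= h1 h2; exact: leq_trans h2 h1.
  by have := order_path_min tr ss.
have [pa|pa] := boolP (p a); first by case: k => [|k] /=; rewrite pa ?IH.
have -> : count p (a :: s) = 0%N.
  rewrite /= (negbTE pa) add0n; apply/eqP; rewrite -leqn0 leqNgt -has_count.
  apply/hasPn => b bs; apply: contra pa; apply: pm; exact: (allP all_le).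
apply/negP => h; case/negP: pa; case: k h => [//|k] /= h.
have [ks|ks] := ltnP k (size s); last by rewrite nth_default // (negbTE p0) in h.
by apply: pm h; apply: (allP all_le); rewrite mem_nth.
Qed.

Lemma sorted_degree_count (p : pred nat) k :
  (forall a b, (a <= b)%N -> p a -> p b) -> ~~ p 0%N ->
  p (sorted_degree k) = (k < \sum_(i < n) p (tnth d i))%N.
Proof.
move=> pm p0; rewrite /sorted_degree nth_sorted_count //; last first.
  by apply: sort_sorted => a b /=; exact: leq_total.
by rewrite count_sort -sum1_count big_tuple big_mkcond; congr (_ < _)%N; apply: eq_bigr => i _; case: p.
Qed.

Lemma sorted_degree_default k : (n <= k)%N -> sorted_degree k = 0%N.
Proof. by move=> nk; rewrite /sorted_degree nth_default // size_sort size_tuple. Qed.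

Lemma sum_sorted_degree (V : nmodType) (f : nat -> V) :
  \sum_(k < n) f (sorted_degree k) = \sum_(i < n) f (tnth d i).
Proof.
rewrite -(big_tuple _ _ d predT f) /=.
have pS : perm_eq (sort geq d) d by rewrite perm_sort.
rewrite -(perm_big _ pS) /= (big_nth 0%N) size_sort size_tuple big_mkord.
by [].
Qed.

(** The scaled degrees [d_i / sqrt ell] in decreasing order, as a step function
    with steps of width [1 / r]. *)
Definition profile (r x : R) : R :=
  (sorted_degree (Num.truncn (x * r)))%:R / Num.sqrt (ell d)%:R.

Lemma profile_ge0 r x : 0 <= profile r x.
Proof. by rewrite divr_ge0. Qed.

(** The profile is a generalized inverse of the tail function of [rho_n]. *)
Lemma profile_gt r x t : (0 < ell d)%N -> 0 <= t -> 0 <= x * r ->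
  (t < profile r x) = (x * r / Num.sqrt (ell d)%:R < emp d (fun y => (t < y)%R%:R)).
Proof.
move=> l0 t0 xr; have s0 : 0 < Num.sqrt (ell d)%:R :> R by rewrite sqrtr_gt0 ltr0n.
rewrite /profile.
rewrite (@sorted_degree_count (fun a => t < a%:R / Num.sqrt (ell d)%:R)).
- rewrite truncn_lt_nat // /emp ltr_pdivrMr // mulrAC mulVf ?gt_eqF // mul1r.
  by rewrite natr_sum.
- by move=> a b ab /lt_le_trans; apply; rewrite ler_pM2r ?invr_gt0 // ler_nat.
- by rewrite mul0r -leNgt.
Qed.

End SortedProfile.

Section PointwiseLimit.
Variables (R : realType) (d : forall n : nat, n.-tuple nat)
  (rho : {measure set (measurableTypeR R) -> \bar R}).
Hypothesis d_pos : forall (n : nat) (i : 'I_n), (0 < tnth (d n) i)%N.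
Hypothesis rho_cvg : vague_cvg (fun n => rho_n R (d n)) rho.
Variables (c : R) (r : nat -> R).
Hypothesis c0 : 0 < c.
Hypothesis r_ge0 : forall n, 0 <= r n.
Hypothesis r_cvg : r n / Num.sqrt (ell (d n))%:R @[n --> \oo] --> Num.sqrt c.

(** Outside this countable set, [sqrt c * x] is not a value of [rhobar rho] at any
    rational point; flat parts of [rhobar rho] contain rational points, so the
    generalized inverse is continuous there. *)
Definition flat_levels : set R :=
  [set x | x = 0 \/ exists q : rat, rhobar rho (ratr q) = (Num.sqrt c * x)%:E].

Lemma countable_flat_levels : countable flat_levels.
Proof.
pose f (o : option rat) :=
  if o is Some q then fine (rhobar rho (ratr q)) / Num.sqrt c else 0.
apply: (@sub_countable _ _ _ (range f)); last first.
  by apply: sub_countable (card_image_le f setT) _; exact: countableP.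
apply: subset_card_le => x [->|[q h]]; first by exists None.
exists (Some q) => //; rewrite /f h /= mulrC mulKf // gt_eqF // sqrtr_gt0 //.
Qed.

(** A rational [q] slightly above the limit [f] gives [rhobar rho q < sqrt c * x],
    strictly because [x] is not in [flat_levels], hence the same for the tail of
    [rho_n]; the lower bound starts directly from a strict inequality. *)
Lemma profile_cvg x : 0 <= x -> ~ flat_levels x ->
  profile (d n) (r n) x @[n --> \oo] --> rhobar_inv rho (Num.sqrt c * x).
Proof.
move=> x0 nx; have s0 : 0 < Num.sqrt c by rewrite sqrtr_gt0.
have xn0 : x != 0 by apply/eqP => xE; apply: nx; left.
have x1 : 0 < x by rewrite lt_neqAle eq_sym xn0.
set y := Num.sqrt c * x; have y0 : 0 < y by rewrite mulr_gt0.
set f := rhobar_inv rho y; have f0 : 0 <= f by exact: rhobar_inv_ge0.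
have hb := rhobar_le d_pos rho_cvg.
have zc : x * r n / Num.sqrt (ell (d n))%:R @[n --> \oo] --> y.
  rewrite /y mulrC; under eq_fun do rewrite -mulrA.
  by apply: cvgM; [exact: cvg_cst|exact: r_cvg].
have n0 : \forall n \near \oo, (0 < n)%N by exists 1%N.
have l0 n : (0 < n)%N -> (0 < ell (d n))%N by move=> n1; apply: (ell_gt0 d_pos).
apply/cvgrPdist_le => e e0.
have up : \forall n \near \oo, profile (d n) (r n) x <= f + e.
  have fe : f < f + e by rewrite ltrDl.
  have [q] := rat_in_itvoo fe.
  rewrite in_itv /= => /andP[q1 q2]; have q0 : 0 <= ratr q :> R by exact: le_trans f0 (ltW q1).
  have hq := rhobar_inv_lt hb y0 q1.
  have hq' : (rhobar rho (ratr q) < y%:E)%E.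
    by rewrite lt_neqAle hq andbT; apply/eqP => E; apply: nx; right; exists q.
  have fin : rhobar rho (ratr q) \is a fin_num.
    by rewrite ge0_fin_numE ?measure_ge0 // (lt_le_trans hq') // leey.
  have [z zq zy] : exists2 z : R, (rhobar rho (ratr q) < z%:E)%E & z < y.
    move: hq'; rewrite -(fineK fin) lte_fin => h; exists ((fine (rhobar rho (ratr q)) + y) / 2).
      by rewrite lte_fin midf_lt.
    by rewrite midf_lt.
  have h1 := rhobar_n_lt_near d_pos rho_cvg q0 q2 zq.
  have := zc; move/cvgrPdist_lt => /(_ (y - z)); rewrite subr_gt0 => /(_ zy) h2.
  near=> k; have kp : (0 < k)%N by near: k.
  rewrite leNgt profile_gt ?l0 ?mulr_ge0 //; last exact: le_trans f0 (ltW fe).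
  rewrite -leNgt ltW //; apply: (@lt_trans _ _ z); first by near: k.
  have : `|y - x * r k / Num.sqrt (ell (d k))%:R| < y - z by near: k.
  by rewrite ltr_norml => /andP[_]; rewrite ltrD2l ltrN2.
have lo : \forall n \near \oo, f - e <= profile (d n) (r n) x.
  have [fe|fe] := ltP f e.
    by apply: nearW => n; rewrite (le_trans _ (profile_ge0 _ _ _)) // subr_le0 ltW.
  have t0 : 0 <= f - e by rewrite subr_ge0.
  have ft : f - e < f by rewrite gtrBl.
  have := rhobar_inv_gt y0 t0 ft => hy.
  have [z [yz hz]] : exists z : R, y < z /\ (z%:E < rhobar rho (f - e))%E.
    case: (rhobar rho (f - e)) hy => [l| |//]; rewrite ?lte_fin => hy.
      by exists ((y + l) / 2); rewrite lte_fin !midf_lt.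
    by exists (y + 1); rewrite ltrDl ltry.
  have h1 := rhobar_n_gt_near d_pos rho_cvg t0 hz.
  have := zc; move/cvgrPdist_lt => /(_ (z - y)); rewrite subr_gt0 => /(_ yz) h2.
  near=> k; have kp : (0 < k)%N by near: k.
  apply: ltW; rewrite profile_gt ?l0 ?mulr_ge0 //.
  apply: (@lt_trans _ _ z); last by near: k.
  have : `|y - x * r k / Num.sqrt (ell (d k))%:R| < z - y by near: k.
  by rewrite ltr_distlC => /andP[_]; rewrite subrKC.
apply: filterS2 up lo => n h1 h2.
by rewrite ler_distlC h2.
Unshelve. all: by end_near. Qed.

End PointwiseLimit.

(** * Step kernels and the limiting graphon *)

Section Blocks.
Variable R : realType.
Notation borelR := (measurableTypeR R).
Notation leb := (@lebesgue_measure R).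
Notation leb2 := (leb \x leb)%E.
Implicit Types (r x : R) (X Y : set borelR) (k l n : nat).

Lemma measurable_trunc_eq r k : measurable ([set x : borelR | Num.truncn (x * r) = k]).
Proof.
pose L k := [set x : borelR | (Num.truncn (x * r) < k)%N].
have mL j : measurable (L j).
  case: j => [|j]; first by rewrite (_ : L 0%N = set0) ?measurable0 //; apply/seteqP; split.
  have -> : L j.+1 = setT `&` (fun x : borelR => x * r) @^-1` `]-oo, j.+1%:R[.
    by apply/seteqP; split => x /=; rewrite /L /= ltnS truncn_le_nat in_itv //= => -[].
  have mf : measurable_fun setT (fun x : borelR => x * r : borelR) by apply: measurable_funM.
  by apply: mf => //; exact: measurable_itv.
rewrite (_ : [set x | _] = L k.+1 `\` L k); first exact: measurableD.
apply/seteqP; split => x /=; rewrite /L /= ltnS; first by move=> ->; rewrite leqnn ltnn.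
by move=> [h1 /negP]; rewrite -leqNgt => h2; apply/eqP; rewrite eqn_leq h1.
Qed.

Lemma measurable_step r (F : nat -> nat -> R) (D : set (borelR * borelR)) : measurable D ->
  measurable_fun D (fun p => F (Num.truncn (p.1 * r)) (Num.truncn (p.2 * r)) : borelR).
Proof.
move=> mD; apply: (@measurable_funS _ _ _ _ setT) => // _ B mB; rewrite setTI.
have -> : (fun p : borelR * borelR => F (Num.truncn (p.1 * r)) (Num.truncn (p.2 * r))) @^-1` B =
  \bigcup_k \bigcup_(l in [set l | B (F k l)])
    ([set x : borelR | Num.truncn (x * r) = k] `*` [set x : borelR | Num.truncn (x * r) = l]).
  apply/seteqP; split => [p /= h|p [k _ [l /= h [/= -> ->]]] //].
  by exists (Num.truncn (p.1 * r)) => //; exists (Num.truncn (p.2 * r)).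
apply: bigcup_measurable => k _; apply: bigcup_measurable => l _.
by apply: measurableX; exact: measurable_trunc_eq.
Qed.

Lemma measurable_step1 r (F : nat -> R) (D : set borelR) : measurable D ->
  measurable_fun D (fun x => F (Num.truncn (x * r)) : borelR).
Proof.
move=> mD; apply: (@measurable_funS _ _ _ _ setT) => // _ B mB; rewrite setTI.
have -> : (fun x : borelR => F (Num.truncn (x * r))) @^-1` B =
  \bigcup_(k in [set k | B (F k)]) [set x : borelR | Num.truncn (x * r) = k].
  apply/seteqP; split => [x /= h|x [k /= h /= ->] //].
  by exists (Num.truncn (x * r)).
by apply: bigcup_measurable => k _; exact: measurable_trunc_eq.
Qed.

Definition block r k : set borelR := [set x | 0 <= x /\ Num.truncn (x * r) = k].

Lemma measurable_Rnneg : measurable (@Rnneg R : set borelR).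
Proof. exact: measurable_itv. Qed.

Lemma measurable_block r k : measurable (block r k).
Proof.
rewrite (_ : block r k = @Rnneg R `&` [set x | Num.truncn (x * r) = k]).
  by apply: measurableI; [exact: measurable_Rnneg|exact: measurable_trunc_eq].
by apply/seteqP; split => x /=; rewrite RnnegE /=.
Qed.

Lemma blockE r k : 0 < r -> block r k = `[k%:R / r, k.+1%:R / r[%classic.
Proof.
move=> r0; apply/seteqP; split => x /=; rewrite in_itv /= ler_pdivrMr // ltr_pdivlMr //.
  by move=> [x0 <-]; apply: truncn_itv; rewrite mulr_ge0 // ltW.
move=> h; have x0 : 0 <= x.
  by case/andP: h => h _; rewrite -(pmulr_lge0 _ r0); apply: le_trans h.
by split => //; exact: truncn_def.
Qed.

Lemma lebesgue_block r k : 0 < r -> leb (block r k) = (r^-1)%:E.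
Proof.
move=> r0; rewrite blockE // lebesgue_measure_itv /= lte_fin ltr_pM2r ?invr_gt0 //.
by rewrite ltr_nat ltnSn -EFinD -mulrBl -natrB // subSnn mul1r.
Qed.

Definition mass r X k : R := fine (leb (X `&` block r k)).

Lemma lebesgue_mass r X k : 0 < r -> measurable X ->
  leb (X `&` block r k) = (mass r X k)%:E.
Proof.
move=> r0 mX; rewrite /mass fineK // ge0_fin_numE //.
apply: (@le_lt_trans _ _ (leb (block r k))); last by rewrite lebesgue_block // ltry.
by apply: le_measure; rewrite ?inE; [apply: measurableI => //; exact: measurable_block|
  exact: measurable_block|exact: subIsetr].
Qed.

Lemma mass_ge0 r X k : 0 <= mass r X k.
Proof. by rewrite fine_ge0. Qed.

Lemma mass_le r X k : 0 < r -> measurable X -> mass r X k <= r^-1.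
Proof.
move=> r0 mX; rewrite -lee_fin -lebesgue_mass // -(lebesgue_block k) //.
by apply: le_measure; rewrite ?inE; [apply: measurableI => //; exact: measurable_block|
  exact: measurable_block|exact: subIsetr].
Qed.

Lemma mass_Rnneg r k : 0 < r -> mass r (@Rnneg R) k = r^-1.
Proof.
move=> r0; rewrite /mass setIidr ?lebesgue_block // => x [x0 _].
by rewrite RnnegE /=.
Qed.

Lemma mass0 r X k : X `&` block r k = set0 -> mass r X k = 0.
Proof. by move=> h; rewrite /mass h measure0. Qed.

(** Writes a step function as a linear combination of indicators of rectangles. *)
Lemma sum_pick n (F : nat -> nat -> R) k0 l0 :
  (forall k l, (n <= k)%N || (n <= l)%N -> F k l = 0) ->
  \sum_(k < n) \sum_(l < n) F k l * ((k0 == k) && (l0 == l))%:R = F k0 l0.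
Proof.
move=> F0; have [h|] := boolP ((n <= k0)%N || (n <= l0)%N).
  rewrite F0 // big1 // => k _; rewrite big1 // => l _.
  case: eqP => [kk|_] /=; last by rewrite mulr0.
  case: eqP => [ll|_]; last by rewrite mulr0.
  by move: h; rewrite kk ll => /orP[]; rewrite leqNgt ltn_ord.
rewrite negb_or -!ltnNge => /andP[kn ln].
rewrite (bigD1 (Ordinal kn)) //= (bigD1 (Ordinal ln)) //= !eqxx mulr1 big1 => [|l].
  rewrite addr0 big1 ?addr0 // => k; rewrite -val_eqE eq_sym /= => /negbTE kk.
  by rewrite big1 // => l _; rewrite kk mulr0.
by rewrite -val_eqE eq_sym /= => /negbTE ->; rewrite mulr0.
Qed.

Lemma integral_blocks r n (F : nat -> nat -> R) X Y : 0 < r ->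
  (forall k l, 0 <= F k l) -> (forall k l, (n <= k)%N || (n <= l)%N -> F k l = 0) ->
  measurable X -> measurable Y -> X `<=` @Rnneg R -> Y `<=` @Rnneg R ->
  (\int[leb2]_(p in X `*` Y) (F (Num.truncn (p.1 * r)) (Num.truncn (p.2 * r)))%:E =
   (\sum_(k < n) \sum_(l < n) F k l * (mass r X k * mass r Y l))%R%:E)%E.
Proof.
move=> r0 F0 Fn mX mY XR YR.
have mXY : measurable (X `*` Y) by apply: measurableX.
have mB k l : measurable (block r k `*` block r l).
  by apply: measurableX; exact: measurable_block.
transitivity (\int[leb2]_(p in X `*` Y) \sum_(k < n) \sum_(l < n)
    ((F k l)%:E * (\1_(block r k `*` block r l) p)%:E))%E.
  apply: eq_integral => p; rewrite inE => -[/XR p1 /YR p2].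
  have {}p1 : 0 <= p.1 by move: p1; rewrite RnnegE /=.
  have {}p2 : 0 <= p.2 by move: p2; rewrite RnnegE /=.
  rewrite -[in LHS](sum_pick _ _ Fn) -sumEFin; apply: eq_bigr => k _.
  rewrite -sumEFin; apply: eq_bigr => l _; rewrite EFinM; congr (_ * _%:E)%E.
  rewrite indicE; congr ((nat_of_bool _)%:R); apply/esym.
  apply/idP/andP => [|[/eqP hk /eqP hl]]; last by apply: mem_set.
  by rewrite in_setE => -[[_ ->] [_ ->]].
have mi k l : measurable_fun (X `*` Y) (fun p => (\1_(block r k `*` block r l) p : R)%:E).
  by apply/measurable_EFinP; apply: measurable_indic.
have mFi k l : measurable_fun (X `*` Y) (fun p => (F k l)%:E * (\1_(block r k `*` block r l) p : R)%:E)%E.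
  by apply: measurable_funeM.
have Fi0 k l p : (0 <= (F k l)%:E * (\1_(block r k `*` block r l) p : R)%:E)%E.
  by rewrite mule_ge0 // lee_fin.
rewrite ge0_integral_sum //; last 2 first.
- by move=> k; apply: emeasurable_sum.
- by move=> k p _; apply: sume_ge0.
rewrite -sumEFin; apply: eq_bigr => k _.
rewrite ge0_integral_sum // -sumEFin; apply: eq_bigr => l _.
rewrite ge0_integralZl_EFin //.
have E : (block r k `*` block r l) `&` (X `*` Y) = (X `&` block r k) `*` (Y `&` block r l).
  by apply/seteqP; split => -[x y] /=; tauto.
rewrite integral_indic // E.
transitivity ((F k l)%:E * (leb (X `&` block r k) * leb (Y `&` block r l)))%E.
  congr (_ * _)%E; apply: product_measure1E; apply: measurableI => //; exact: measurable_block.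
by rewrite !lebesgue_mass // -!EFinM.
Qed.

Lemma limn_einf_le (u : nat -> \bar R) (e : \bar R) :
  (\forall n \near \oo, (u n <= e)%E) -> (limn_einf u <= e)%E.
Proof.
move=> [N _ hN]; rewrite limn_einf_lim; apply: lime_le; first exact: is_cvg_einfs.
apply: nearW => k; apply: (@le_trans _ _ (u (maxn k N))).
  by apply: ereal_inf_lbound; exists (maxn k N) => //=; rewrite leq_maxl.
by apply: hN; rewrite /= leq_maxr.
Qed.

Lemma measurable_diagonal : measurable [set p : borelR * borelR | p.1 == p.2].
Proof.
have mf : measurable_fun setT (fun p : borelR * borelR => p.1 == p.2).
  by apply: measurable_fun_eqr.
by have := mf measurableT [set true] I; rewrite setTI.
Qed.

Lemma lebesgue_diagonal : leb2 [set p : borelR * borelR | p.1 == p.2] = 0%E.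
Proof.
rewrite /= /product_measure1; apply: integral0_eq => x _ /=.
rewrite (_ : xsection _ x = [set x]); first exact: lebesgue_measure_set1.
apply/seteqP; split => y; rewrite xsectionE /=; first by move=> /eqP ->.
by move=> ->.
Qed.

End Blocks.

Section L1Limit.
Variables (R : realType) (d : forall n : nat, n.-tuple nat)
  (rho : {measure set (measurableTypeR R) -> \bar R}).
Notation borelR := (measurableTypeR R).
Notation leb := (@lebesgue_measure R).
Notation leb2 := (leb \x leb)%E.
Hypothesis d_pos : forall (n : nat) (i : 'I_n), (0 < tnth (d n) i)%N.
Hypothesis rho_cvg : vague_cvg (fun n => rho_n R (d n)) rho.
Hypothesis tr : tail_regular R d.
Variables (c : R) (r : nat -> R).
Hypothesis c0 : 0 < c.
Hypothesis r_ge0 : forall n, 0 <= r n.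
Hypothesis r_cvg : r n / Num.sqrt (ell (d n))%:R @[n --> \oo] --> Num.sqrt c.
Hypothesis link_prob_cvg :
  (\sum_(i < n) \sum_(j < n) link_prob R (d n) i j) / (ell (d n))%:R @[n --> \oo] --> c.

Let W (p : borelR * borelR) : R := W_ECM_scaled rho c p.1 p.2.

Definition profile_graphon n (p : borelR * borelR) : R :=
  1 - expR (- (profile (d n) (r n) p.1 * profile (d n) (r n) p.2)).

Let Wn := profile_graphon.

Definition profile_kernel n k l : R := 1 - expR (-
  ((sorted_degree (d n) k)%:R / Num.sqrt (ell (d n))%:R *
   ((sorted_degree (d n) l)%:R / Num.sqrt (ell (d n))%:R))).

Lemma one_expR_ge0 (x : R) : 0 <= x -> 0 <= 1 - expR (- x).
Proof. by move=> x0; rewrite subr_ge0 -expR0 ler_expR oppr_le0. Qed.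

Lemma one_expR_le1 (x : R) : 1 - expR (- x) <= 1.
Proof. by rewrite gerBl expR_ge0. Qed.

Lemma profile_kernel_ge0 n k l : 0 <= profile_kernel n k l.
Proof. by apply: one_expR_ge0; rewrite mulr_ge0 // divr_ge0. Qed.

Lemma profile_kernel0 n k l : (n <= k)%N || (n <= l)%N -> profile_kernel n k l = 0.
Proof.
by rewrite /profile_kernel => /orP[] h; rewrite (sorted_degree_default _ h) mul0r
  ?mulr0 ?mul0r oppr0 expR0 subrr.
Qed.

Lemma profile_kernel_sym n k l : profile_kernel n k l = profile_kernel n l k.
Proof. by rewrite /profile_kernel mulrC. Qed.

Lemma sum_profile_kernel n : (0 < n)%N ->
  \sum_(k < n) \sum_(l < n) profile_kernel n k l = \sum_i \sum_j link_prob R (d n) i j.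
Proof.
move=> n0; pose h a b : R := 1 - expR (- (a%:R / Num.sqrt (ell (d n))%:R *
   (b%:R / Num.sqrt (ell (d n))%:R))).
have -> : \sum_(k < n) \sum_(l < n) profile_kernel n k l =
  \sum_(k < n) \sum_(l < n) h (sorted_degree (d n) k) (sorted_degree (d n) l) by [].
rewrite (eq_bigr (fun k : 'I_n => \sum_j h (sorted_degree (d n) k) (tnth (d n) j))); last first.
  by move=> k _; exact: (sum_sorted_degree _ (h _)).
rewrite (sum_sorted_degree _ (fun a => \sum_j h a (tnth (d n) j))).
apply: eq_bigr => i _; apply: eq_bigr => j _.
by rewrite /h /link_prob mulrACA -invfM -expr2 sqr_sqrtr.
Qed.

(** From [1 - exp (- u) <= u], the degrees adding up to [ell]. *)
Lemma row_profile_kernel n k : (0 < n)%N ->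
  \sum_(l < n) profile_kernel n k l <= (sorted_degree (d n) k)%:R.
Proof.
move=> n0; have l0 : 0 < (ell (d n))%:R :> R by rewrite ltr0n (ell_gt0 d_pos).
apply: (@le_trans _ _ (\sum_(l < n) (sorted_degree (d n) k)%:R * (sorted_degree (d n) l)%:R / (ell (d n))%:R)).
  apply: ler_sum => l _; rewrite /profile_kernel mulrACA -invfM -expr2 sqr_sqrtr //.
  by set x := _ / _; have := expR_ge1Dx (- x); lra.
rewrite -mulr_suml -mulr_sumr (sum_sorted_degree _ (fun a => a%:R)) -natr_sum.
by rewrite mulfK // gt_eqF.
Qed.

Lemma near_r_gt0 : \forall n \near \oo, 0 < r n.
Proof.
have s0 : 0 < Num.sqrt c by rewrite sqrtr_gt0.
have := r_cvg; move/cvgrPdist_lt => /(_ _ s0); apply: filterS => n.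
have [//|rn] := ltP 0 (r n).
have -> : r n = 0 by apply/eqP; rewrite eq_le rn r_ge0.
by rewrite mul0r subr0 gtr0_norm // ltxx.
Qed.

Lemma r2_cvg : r n ^+ 2 / (ell (d n))%:R @[n --> \oo] --> c.
Proof.
have -> : c = Num.sqrt c * Num.sqrt c by rewrite -expr2 sqr_sqrtr // ltW.
have -> : (fun n => r n ^+ 2 / (ell (d n))%:R) =
  (fun n => (r n / Num.sqrt (ell (d n))%:R) * (r n / Num.sqrt (ell (d n))%:R)).
  by apply/funext => n; rewrite mulrACA -invfM -!expr2 sqr_sqrtr.
exact: cvgM.
Qed.

Let near_n0 : \forall n \near \oo, (0 < n)%N. Proof. by exists 1%N. Qed.

Lemma measurable_profile_graphon n (D : set (borelR * borelR)) : measurable D -> measurable_fun D (Wn n).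
Proof. exact: (@measurable_step R (r n) (profile_kernel n)). Qed.

Lemma measurable_W_ECM_scaled (D : set (borelR * borelR)) : measurable D -> measurable_fun D W.
Proof.
move=> mD; apply: (@measurable_funS _ _ _ _ setT) => //.
have mf : measurable_fun setT (fun x : borelR => rhobar_inv rho (Num.sqrt c * x) : borelR).
  apply: (@measurableT_comp _ _ _ _ _ _ (rhobar_inv rho : borelR -> borelR)).
    exact: (measurable_rhobar_inv (rhobar_le d_pos rho_cvg)).
  by apply: measurable_funM.
have m1 : measurable_fun setT (fun p : borelR * borelR => rhobar_inv rho (Num.sqrt c * p.1) : borelR).
  by apply: (measurableT_comp mf); exact: measurable_fst.
have m2 : measurable_fun setT (fun p : borelR * borelR => rhobar_inv rho (Num.sqrt c * p.2) : borelR).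
  by apply: (measurableT_comp mf); exact: measurable_snd.
rewrite /W /W_ECM_scaled /W_ECM; apply: measurable_fun_ifT.
- by apply: measurable_fun_eqr; apply: measurable_funM.
- apply: measurable_funB => //; apply: measurableT_comp => //; apply: measurableT_comp => //.
  by apply: measurable_funM => //; apply: measurable_funX.
- apply: measurable_funB => //; apply: measurableT_comp => //; apply: measurableT_comp => //.
  by apply: measurable_funM.
Qed.

Lemma W_ECM_scaled_ge0 p : 0 <= W p.
Proof.
rewrite /W /W_ECM_scaled /W_ECM; case: ifP => _; apply: one_expR_ge0.
  by rewrite divr_ge0 // sqr_ge0.
by rewrite mulr_ge0 // rhobar_inv_ge0.
Qed.

Lemma W_ECM_scaled_le1 p : W p <= 1.
Proof. by rewrite /W /W_ECM_scaled /W_ECM; case: ifP => _; exact: one_expR_le1. Qed.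

Lemma profile_graphon_ge0 n p : 0 <= Wn n p.
Proof. by apply: one_expR_ge0; rewrite mulr_ge0 // profile_ge0. Qed.

Lemma profile_graphon_le1 n p : Wn n p <= 1.
Proof. exact: one_expR_le1. Qed.

(** The diagonal belongs to it because [W_ECM] is defined differently there. *)
Definition exceptional : set (borelR * borelR) :=
  (flat_levels rho c `*` setT) `|` (setT `*` flat_levels rho c) `|` [set p | p.1 == p.2].

Let mA : measurable (flat_levels rho c : set borelR).
Proof.
apply: countable_measurable; last exact: countable_flat_levels.
by move=> t; exact: measurable_set1.
Qed.

Let lA : leb (flat_levels rho c) = 0%E.
Proof. by apply: countable_lebesgue_measure0; exact: countable_flat_levels. Qed.

Lemma measurable_exceptional : measurable exceptional.
Proof.
apply: measurableU; last exact: measurable_diagonal.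
by apply: measurableU; apply: measurableX.
Qed.

Lemma exceptional0 : leb2 exceptional = 0%E.
Proof.
have m1 : measurable ((flat_levels rho c : set borelR) `*` (setT : set borelR)) by apply: measurableX.
have m2 : measurable ((setT : set borelR) `*` (flat_levels rho c : set borelR)) by apply: measurableX.
have e1 : leb2 ((flat_levels rho c : set borelR) `*` (setT : set borelR)) = 0%E.
  rewrite [LHS]product_measure1E //; apply: etrans (mul0e (leb setT)).
  by congr (_ * _)%E; exact: lA.
have e2 : leb2 ((setT : set borelR) `*` (flat_levels rho c : set borelR)) = 0%E.
  rewrite [LHS]product_measure1E //; apply: etrans (mule0 (leb setT)).
  by congr (_ * _)%E; exact: lA.
apply: null_set_setU; [exact: measurableU|exact: measurable_diagonal| |exact: lebesgue_diagonal].
by apply: null_set_setU.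
Qed.

Lemma profile_graphon_cvg p : 0 <= p.1 -> 0 <= p.2 -> ~ exceptional p -> Wn n p @[n --> \oo] --> W p.
Proof.
move=> p1 p2 np.
have n1 : ~ flat_levels rho c p.1 by move=> h; apply: np; left; left.
have n2 : ~ flat_levels rho c p.2 by move=> h; apply: np; left; right.
have n3 : p.1 != p.2 by apply/negP => h; apply: np; right.
have s0 : Num.sqrt c != 0 by rewrite gt_eqF // sqrtr_gt0.
rewrite /W /W_ECM_scaled /W_ECM (inj_eq (mulfI s0)) (negbTE n3).
apply: cvgB; first exact: cvg_cst.
have h : - (profile (d n) (r n) p.1 * profile (d n) (r n) p.2) @[n --> \oo] -->
   - (rhobar_inv rho (Num.sqrt c * p.1) * rhobar_inv rho (Num.sqrt c * p.2)).
  by apply: cvgN; apply: cvgM; apply: (profile_cvg d_pos rho_cvg c0 r_ge0 r_cvg).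
exact: cvg_comp h (@continuous_expR R _).
Qed.

(** Fatou's lemma, [profile_graphon] converging off a null set. *)
Lemma integral_W_ECM_scaled_le (T : set (borelR * borelR)) (e : \bar R) : measurable T -> T `<=` @quadrant R ->
  (\forall n \near \oo, \int[leb2]_(p in T) (Wn n p)%:E <= e)%E ->
  (\int[leb2]_(p in T) (W p)%:E <= e)%E.
Proof.
move=> mT TQ h; have mN := measurable_exceptional.
have mTN : measurable (T `\` exceptional) by apply: measurableD.
rewrite (ge0_negligible_integral mN mT _ _ exceptional0); first last.
- by move=> p _; rewrite lee_fin W_ECM_scaled_ge0.
- by apply/measurable_EFinP; apply: measurable_W_ECM_scaled.
have -> : (\int[leb2]_(p in T `\` exceptional) (W p)%:E =
  \int[leb2]_(p in T `\` exceptional) limn_einf (fun n => (Wn n p)%:E))%E.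
  apply: eq_integral => p; rewrite inE => -[/TQ [p1 p2] np].
  have cv : (Wn n p)%:E @[n --> \oo] --> (W p)%:E.
    apply: cvg_EFin; first exact: nearW.
    by apply: profile_graphon_cvg => //; [move: p1|move: p2]; rewrite RnnegE /=.
  by have [-> _] := cvg_limn_einf_sup cv.
apply: le_trans (fatou _ mTN _ _) _.
- by move=> n; apply/measurable_EFinP; apply: measurable_profile_graphon.
- by move=> n p _; rewrite lee_fin profile_graphon_ge0.
apply: limn_einf_le; apply: filterS h => n; apply: le_trans.
apply: ge0_subset_integral => //.
- by apply/measurable_EFinP; apply: measurable_profile_graphon.
- by move=> p _; rewrite lee_fin profile_graphon_ge0.
Qed.

Definition far (X0 : R) : set borelR := `[X0, +oo[%classic.

Definition far_rectangle (X0 : R) (X Y : set borelR) : Prop :=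
  [/\ measurable X, measurable Y, X `<=` @Rnneg R, Y `<=` @Rnneg R &
      X `<=` far X0 \/ Y `<=` far X0].

(** Beyond [X0] the profile is at most [delta], that is, the vertices have degree at
    most [delta * sqrt ell]; by [row_profile_kernel] the integral is bounded by
    their share of the half-edges, which tail regularity makes small. *)
Lemma profile_graphon_tail (e : R) : 0 < e -> exists2 X0 : R, 0 < X0 & \forall n \near \oo,
  forall X Y : set borelR, far_rectangle X0 X Y -> (\int[leb2]_(p in X `*` Y) (Wn n p)%:E <= e%:E)%E.
Proof.
move=> e0; have ec : 0 < e * (c / 2) by rewrite mulr_gt0 // divr_gt0.
have [delta d0 hd] := tr ec.
have s0 : 0 < Num.sqrt c by rewrite sqrtr_gt0.
(* By rhobar_n_le, at most sqrt ell / delta degrees exceed delta * sqrt ell, and the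
   profile has at least sqrt c / 2 * sqrt ell steps per unit of length. *)
exists (2 / (delta * Num.sqrt c)); first by rewrite divr_gt0 // mulr_gt0.
have h1 := r_cvg; move/cvgrPdist_lt : h1 => /(_ _ (divr_gt0 s0 (ltr0n _ 2))) h1.
have h2 := r2_cvg; move/cvgrPdist_lt : h2 => /(_ _ (divr_gt0 c0 (ltr0n _ 2))) h2.
near=> n => X Y [mX mY XR YR hXY].
have n0 : (0 < n)%N by near: n.
have lp := ell_gt0 d_pos n0.
have l0 : 0 < (ell (d n))%:R :> R by rewrite ltr0n.
have rn0 : 0 < r n by near: n; exact: near_r_gt0.
pose s : R := Num.sqrt (ell (d n))%:R; have sp : 0 < s by rewrite sqrtr_gt0.
have r1 : Num.sqrt c / 2 < r n / s.
  have : `|Num.sqrt c - r n / Num.sqrt (ell (d n))%:R| < Num.sqrt c / 2 by near: n.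
  by rewrite -/s ltr_norml => /andP[_]; lra.
have r2 : c / 2 * (ell (d n))%:R <= r n ^+ 2.
  have : `|c - r n ^+ 2 / (ell (d n))%:R| < c / 2 by near: n.
  rewrite ltr_norml => /andP[_ hh]; rewrite -ler_pdivlMr //; lra.
have small k (Z : set borelR) : measurable Z -> Z `<=` far (2 / (delta * Num.sqrt c)) -> mass (r n) Z k <=
    (if (sorted_degree (d n) k)%:R <= delta * s then (r n)^-1 else 0).
  move=> mZ Zf; case: ifPn => [_|hk]; first exact: mass_le.
  rewrite mass0 //; apply/seteqP; split => // x [/Zf xf [x0 xk]].
  case/negP: hk; rewrite -ler_pdivrMr //.
  have -> : (sorted_degree (d n) k)%:R / s = profile (d n) (r n) x by rewrite /profile xk.
  have xr : 0 <= x * r n by rewrite mulr_ge0.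
  rewrite leNgt profile_gt // ?ltW // -leNgt.
  apply: (le_trans (rhobar_n_le d_pos n0 d0)).
  move: xf; rewrite /far /= in_itv /= andbT => xf.
  rewrite -mulrA; apply: (@le_trans _ _ (2 / (delta * Num.sqrt c) * (Num.sqrt c / 2))).
    rewrite -subr_ge0 (_ : _ - _ = 0) //; field.
    by rewrite !gt_eqF.
  apply: ler_pM => //; last exact: ltW.
  by rewrite divr_ge0 // mulr_ge0 // ltW.
have key : \sum_(k < n) \sum_(l < n) profile_kernel n k l *
    ((if (sorted_degree (d n) k)%:R <= delta * s then (r n)^-1 else 0) * (r n)^-1) <= e.
  apply: (@le_trans _ _ (\sum_(k < n) (if (sorted_degree (d n) k)%:R <= delta * s
     then (sorted_degree (d n) k)%:R else 0) * (r n ^- 2))).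
    apply: ler_sum => k _; rewrite -mulr_suml; case: ifP => _; last by rewrite !mul0r mulr0.
    by rewrite -invfM -expr2 ler_wpM2r ?invr_ge0 ?sqr_ge0 // row_profile_kernel.
  rewrite -mulr_suml (sum_sorted_degree _ (fun a => if a%:R <= delta * s then a%:R else 0)).
  rewrite ler_pdivrMr ?exprn_gt0 // -big_mkcond.
  have : \sum_(i < n | (tnth (d n) i)%:R <= delta * Num.sqrt (ell (d n))%:R :> R)
       (tnth (d n) i)%:R <= e * (c / 2) * (ell (d n))%:R by near: n.
  by move=> /le_trans; apply; rewrite -mulrA ler_wpM2l // ltW.
have IB := integral_blocks rn0 (profile_kernel_ge0 n) (@profile_kernel0 n) mX mY XR YR.
rewrite [leLHS]IB lee_fin; apply: le_trans key; case: hXY => hf.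
  apply: ler_sum => k _; apply: ler_sum => l _; rewrite ler_wpM2l ?profile_kernel_ge0 //.
  by apply: ler_pM; rewrite ?mass_ge0 ?small ?mass_le.
rewrite exchange_big; apply: ler_sum => k _; apply: ler_sum => l _.
rewrite profile_kernel_sym ler_wpM2l ?profile_kernel_ge0 // mulrC.
by apply: ler_pM; rewrite ?mass_ge0 ?small ?mass_le.
Unshelve. all: by end_near. Qed.

Lemma integral_profile_graphon n : (0 < n)%N -> 0 < r n -> (\int[leb2]_(p in @quadrant R) (Wn n p)%:E =
  ((\sum_i \sum_j link_prob R (d n) i j) / r n ^+ 2)%R%:E)%E.
Proof.
move=> n0 rn0.
have mR := @measurable_Rnneg R.
have RR : @Rnneg R `<=` @Rnneg R by [].
have IB := integral_blocks rn0 (profile_kernel_ge0 n) (@profile_kernel0 n) mR mR RR RR.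
rewrite [LHS]IB -sum_profile_kernel // mulr_suml; congr EFin; apply: eq_bigr => k _.
rewrite mulr_suml; apply: eq_bigr => l _.
by rewrite !mass_Rnneg // -invfM -expr2.
Qed.

Lemma measurable_quadrant : measurable (@quadrant R).
Proof. by apply: measurableX; exact: measurable_Rnneg. Qed.

Definition profile_distance n (p : borelR * borelR) : R := `|Wn n p - W p|.

Lemma measurable_profile_distance n (D : set (borelR * borelR)) : measurable D -> measurable_fun D (profile_distance n).
Proof.
move=> mD; apply: measurableT_comp => //; apply: measurable_funB.
  exact: measurable_profile_graphon.
exact: measurable_W_ECM_scaled.
Qed.

Lemma profile_distance_le n p : profile_distance n p <= Wn n p + W p.
Proof.
by apply: (le_trans (ler_normB _ _)); rewrite !ger0_norm // ?W_ECM_scaled_ge0 // profile_graphon_ge0.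
Qed.

(** On a box the kernels are bounded by 1 and dominated convergence applies; the
    two remaining strips have small integral by [profile_graphon_tail], and the
    same bound holds for the limit by Fatou's lemma. *)
Lemma profile_graphon_cvg_L1 (e : R) : 0 < e ->
  \forall n \near \oo, (\int[leb2]_(p in @quadrant R) (profile_distance n p)%:E <= e%:E)%E.
Proof.
move=> e0; have e5 : 0 < e / 5 by rewrite divr_gt0.
have [X0 X00 hX] := profile_graphon_tail e5.
have mR := @measurable_Rnneg R.
pose B0 : set borelR := `[0, X0[%classic.
have mB0 : measurable B0 by exact: measurable_itv.
have mF : measurable (far X0) by exact: measurable_itv.
have B0R : B0 `<=` @Rnneg R by move=> x /=; rewrite /B0 /Rnneg /= !in_itv /= andbT => /andP[].
have FR : far X0 `<=` @Rnneg R.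
  by move=> x /=; rewrite /far /Rnneg /= !in_itv /= !andbT; apply: le_trans; exact: ltW.
have RE : @Rnneg R = B0 `|` far X0.
  apply/seteqP; split => x; rewrite /B0 /far /Rnneg /= !in_itv /= !andbT.
    by move=> x0; case: (ltP x X0) => h; [left|right]; rewrite ?x0.
  by case=> [/andP[]|] //; apply: le_trans; exact: ltW.
have disj : [disjoint B0 & far X0]%classic.
  apply/eqP/seteqP; split => // x []; rewrite /B0 /far /= !in_itv /= andbT => /andP[_ h].
  by rewrite leNgt h.
have QE : @quadrant R = (B0 `*` B0) `|` (B0 `*` far X0) `|` (far X0 `*` @Rnneg R).
  rewrite /quadrant {1}RE; apply/seteqP; split => -[x y] /=; rewrite RE /=; tauto.
have tailW (X Y : set borelR) : far_rectangle X0 X Y -> (\int[leb2]_(p in X `*` Y) (W p)%:E <= (e / 5)%:E)%E.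
  move=> h; have [mX mY XR YR _] := h; apply: integral_W_ECM_scaled_le; first exact: measurableX.
    by move=> p [/XR ? /YR ?]; split.
  by apply: filterS hX => n; apply.
have tailD n (X Y : set borelR) : far_rectangle X0 X Y -> (\int[leb2]_(p in X `*` Y) (Wn n p)%:E <= (e / 5)%:E)%E ->
   (\int[leb2]_(p in X `*` Y) (profile_distance n p)%:E <= (e / 5)%:E + (e / 5)%:E)%E.
  move=> h hW; have [mX mY XR YR _] := h; have mXY : measurable (X `*` Y) by apply: measurableX.
  apply: le_trans (leeD hW (tailW _ _ h)).
  rewrite -ge0_integralD //; first last.
  - by apply/measurable_EFinP; apply: measurable_W_ECM_scaled.
  - by move=> p _; rewrite lee_fin W_ECM_scaled_ge0.
  - by apply/measurable_EFinP; apply: measurable_profile_graphon.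
  - by move=> p _; rewrite lee_fin profile_graphon_ge0.
  apply: ge0_le_integral => //.
  - by move=> p _; rewrite lee_fin normr_ge0.
  - by apply/measurable_EFinP; apply: measurable_profile_distance.
  - by apply: emeasurable_funD; apply/measurable_EFinP; [apply: measurable_profile_graphon|apply: measurable_W_ECM_scaled].
  - by move=> p _; rewrite -EFinD lee_fin profile_distance_le.
have mBB : measurable (B0 `*` B0) by apply: measurableX.
have mBF : measurable (B0 `*` far X0) by apply: measurableX.
have mFR : measurable (far X0 `*` @Rnneg R) by apply: measurableX.
have box : (\int[leb2]_(p in B0 `*` B0) (profile_distance n p)%:E)%E @[n --> \oo] --> 0%E.
  have lB : (leb2 (B0 `*` B0) < +oo)%E.
    have lB0 : leb B0 = X0%:E.
      by rewrite /B0 lebesgue_measure_itv /= lte_fin X00 -EFinB subr0.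
    have -> : leb2 (B0 `*` B0) = (leb B0 * leb B0)%E by exact: product_measure1E.
    by rewrite lB0 -EFinM ltry.
  have := @dominated_convergence _ _ R leb2 _ mBB (fun n p => (Wn n p)%:E) (fun p => (W p)%:E) (cst 1%E).
  move=> /(_ _ _ _ _ _)[].
  - by move=> n; apply/measurable_EFinP; apply: measurable_profile_graphon.
  - by apply/measurable_EFinP; apply: measurable_W_ECM_scaled.
  - exists exceptional; split; [exact: measurable_exceptional|exact: exceptional0|].
    move=> p /= h; apply: contrapT => np; apply: h => -[/B0R p1 /B0R p2].
    apply: cvg_EFin; first exact: nearW.
    by apply: profile_graphon_cvg => //; [move: p1|move: p2]; rewrite RnnegE /=.
  - apply/integrableP; split; first exact: measurable_cst.
    have -> : (\int[leb2]_(x in B0 `*` B0) `|cst 1%E x| = \int[leb2]_(x in B0 `*` B0) cst 1%E x)%E.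
      by apply: eq_integral => x _; rewrite /= normr1.
    by rewrite integral_cst // mul1e.
  - apply: aeW => p n _; rewrite /= lee_fin ger0_norm ?profile_graphon_ge0 // profile_graphon_le1 //.
  move=> _ + _; apply: cvg_trans; apply: near_eq_cvg; apply: nearW => n.
  by apply: eq_integral => p _; rewrite /profile_distance.
have hbox : \forall n \near \oo, (\int[leb2]_(p in B0 `*` B0) (profile_distance n p)%:E <= (e / 5)%:E)%E.
  have /fine_cvgP[fn /cvgrPdist_le /(_ _ e5) fc] := box.
  apply: filterS2 fn fc => n hf /=; rewrite sub0r normrN => h.
  by rewrite -(fineK hf) lee_fin; apply: le_trans h; exact: ler_norm.
have iU (f : borelR * borelR -> R) (A B : set (borelR * borelR)) :
    measurable A -> measurable B -> measurable_fun (A `|` B) f -> (forall p, 0 <= f p) ->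
    [disjoint A & B]%classic ->
   (\int[leb2]_(p in A `|` B) (f p)%:E =
    \int[leb2]_(p in A) (f p)%:E + \int[leb2]_(p in B) (f p)%:E)%E.
  move=> mA' mB' mf f0 dAB; apply: ge0_integral_setU => //; first exact/measurable_EFinP.
  by move=> p _; rewrite lee_fin.
have D0 m p : 0 <= profile_distance m p by exact: normr_ge0.
have dj1 : [disjoint (B0 `*` B0) & (B0 `*` far X0)]%classic.
  apply/eqP/seteqP; split => // -[x y] [[_ /= h1] [_ /= h2]].
  by move/eqP/seteqP: disj => [+ _] => /(_ y); apply.
have dj2 : [disjoint (B0 `*` B0) `|` (B0 `*` far X0) & (far X0 `*` @Rnneg R)]%classic.
  apply/eqP/seteqP; split => // -[x y] [h1 [/= h2 _]].
  have h3 : B0 x by case: h1 => -[].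
  by move/eqP/seteqP: disj => [+ _] => /(_ x); apply.
have mU : measurable ((B0 `*` B0) `|` (B0 `*` far X0)) by exact: measurableU.
near=> n.
rewrite QE iU //; last by apply: measurable_profile_distance; exact: measurableU.
rewrite iU //; last exact: measurable_profile_distance.
have hXn : forall X Y : set borelR, far_rectangle X0 X Y -> (\int[leb2]_(p in X `*` Y) (Wn n p)%:E <= (e / 5)%:E)%E by near: n.
have FF : far X0 `<=` far X0 by [].
have t1 := tailD n B0 (far X0) (And5 mB0 mF B0R FR (or_intror FF))
   (hXn B0 (far X0) (And5 mB0 mF B0R FR (or_intror FF))).
have RR : @Rnneg R `<=` @Rnneg R by [].
have t2 := tailD n (far X0) (@Rnneg R) (And5 mF mR FR RR (or_introl FF))
   (hXn (far X0) (@Rnneg R) (And5 mF mR FR RR (or_introl FF))).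
have t0 : (\int[leb2]_(p in B0 `*` B0) (profile_distance n p)%:E <= (e / 5)%:E)%E by near: n.
apply: le_trans (leeD (leeD t0 t1) t2) _.
by rewrite -!EFinD lee_fin; lra.
Unshelve. all: by end_near. Qed.

Lemma integral_W_ECM_scaled : (\int[leb2]_(p in @quadrant R) (W p)%:E = 1%:E)%E.
Proof.
have mQ := measurable_quadrant.
have mW : measurable_fun (@quadrant R) (fun p => (W p)%:E) by apply/measurable_EFinP; apply: measurable_W_ECM_scaled.
have mWn n : measurable_fun (@quadrant R) (fun p => (Wn n p)%:E) by apply/measurable_EFinP; apply: measurable_profile_graphon.
have mD n : measurable_fun (@quadrant R) (fun p => (profile_distance n p)%:E) by apply/measurable_EFinP; apply: measurable_profile_distance.
pose a n : R := (\sum_(i < n) \sum_(j < n) link_prob R (d n) i j) / r n ^+ 2.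
have ac : a n @[n --> \oo] --> (1 : R).
  have -> : (1 : R) = c * c^-1 by rewrite mulfV // gt_eqF.
  have h : (\sum_(i < n) \sum_(j < n) link_prob R (d n) i j) / (ell (d n))%:R *
     (r n ^+ 2 / (ell (d n))%:R)^-1 @[n --> \oo] --> c * c^-1.
    by apply: cvgM => //; apply: cvgV; [rewrite gt_eqF|exact: r2_cvg].
  apply: cvg_trans h; apply: near_eq_cvg; near=> n.
  have n0 : (0 < n)%N by near: n.
  have l0 : (ell (d n))%:R != 0 :> R by rewrite gt_eqF // ltr0n (ell_gt0 d_pos).
  by rewrite /a invf_div mulrA divfK.
have step (e : R) : 0 < e -> ((1 - e)%:E <= \int[leb2]_(p in @quadrant R) (W p)%:E <= (1 + e)%:E)%E.
  move=> e0; have e2 : 0 < e / 2 by rewrite divr_gt0.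
  have h1 := profile_graphon_cvg_L1 e2; move/cvgrPdist_lt : ac => /(_ _ e2) h2.
  have [n [n0 rn0 h1n h2n]] : exists n, [/\ (0 < n)%N, 0 < r n,
     (\int[leb2]_(p in @quadrant R) (profile_distance n p)%:E <= (e / 2)%:E)%E & `|1 - a n| < e / 2].
    near \oo => n; exists n; split; first by near: n.
    - by near: n; exact: near_r_gt0.
    - by near: n.
    - by near: n.
  move: h2n; rewrite ltr_norml => /andP[a1 a2].
  have IWn := integral_profile_graphon n0 rn0.
  apply/andP; split.
    have : (\int[leb2]_(p in @quadrant R) (Wn n p)%:E <=
       \int[leb2]_(p in @quadrant R) (W p)%:E + \int[leb2]_(p in @quadrant R) (profile_distance n p)%:E)%E.
      rewrite -ge0_integralD //; first last.
      - by move=> p _; rewrite lee_fin normr_ge0.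
      - by move=> p _; rewrite lee_fin W_ECM_scaled_ge0.
      apply: ge0_le_integral => //.
      - by move=> p _; rewrite lee_fin profile_graphon_ge0.
      - exact: emeasurable_funD.
      - move=> p _; rewrite -EFinD lee_fin /profile_distance.
        by have := ler_norm (Wn n p - W p); lra.
    rewrite IWn -/(a n) => h.
    have := le_trans h (leeD2l _ h1n); rewrite -leeBlDr // -EFinB; apply: le_trans.
    by rewrite lee_fin; lra.
  have : (\int[leb2]_(p in @quadrant R) (W p)%:E <=
       \int[leb2]_(p in @quadrant R) (Wn n p)%:E + \int[leb2]_(p in @quadrant R) (profile_distance n p)%:E)%E.
    rewrite -ge0_integralD //; first last.
    - by move=> p _; rewrite lee_fin normr_ge0.
    - by move=> p _; rewrite lee_fin profile_graphon_ge0.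
    apply: ge0_le_integral => //.
    - by move=> p _; rewrite lee_fin W_ECM_scaled_ge0.
    - exact: emeasurable_funD.
    - move=> p _; rewrite -EFinD lee_fin /profile_distance.
      by have := ler_norm (W p - Wn n p); rewrite distrC; lra.
  rewrite IWn -/(a n) => /le_trans; apply; apply: le_trans (leeD2l _ h1n) _.
  by rewrite -EFinD lee_fin; lra.
apply/eqP; rewrite eq_le; apply/andP; split.
  by apply/lee_addgt0Pr => e /step /andP[_]; rewrite EFinD.
by apply/lee_subgt0Pr => e /step /andP[+ _]; rewrite EFinB.
Unshelve. all: by end_near. Qed.

End L1Limit.

(** * Coupling by block permutations *)

Section Pushed.
Context (d d' : measure_display) (T1 : measurableType d) (T2 : measurableType d') (R : realType).
Variables (m : {measure set T1 -> \bar R}) (f : T1 -> T2).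
Hypothesis mf : measurable_fun setT f.
Definition pushforward_measure : {measure set T2 -> \bar R} := @measure_function_pushforward__canonical__measure_function_Measure _ _ T1 T2 R m f mf.

Lemma integral_pushforward_measure (U : set T2) (g : T2 -> \bar R) : measurable U ->
  measurable_fun U g ->
  (\int[pushforward_measure]_(x in U) g x = \int[m]_(x in f @^-1` U) g (f x))%E.
Proof.
move=> mU mg; rewrite integralE [RHS]integralE; congr (_ - _)%E.
  rewrite (ge0_integral_pushforward mf) //; first by apply: eq_integral => x _; rewrite /= ?funeposE ?funenegE.
  exact: measurable_funepos.
rewrite (ge0_integral_pushforward mf) //; first by apply: eq_integral => x _; rewrite /= ?funeposE ?funenegE.
exact: measurable_funeneg.
Qed.
End Pushed.

Section Rearrangement.
Variable R : realType.
Notation borelR := (measurableTypeR R).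
Notation leb := (@lebesgue_measure R).

(** Checked on half-open intervals, which characterize Lebesgue measure. *)
Lemma lebesgue_shift (a : R) (B : set borelR) : measurable B ->
  leb ((fun x => x + a) @^-1` B) = leb B.
Proof.
have mf : measurable_fun setT (fun x : borelR => x + a : borelR) by apply: measurable_funD.
move=> mB; apply/esym; apply: (@lebesgue_measure_unique R (pushforward_measure leb mf)) => // X.
move=> [[x y] _ <-] /=; rewrite /pushforward.
rewrite (_ : (fun z => z + a) @^-1` `]x, y]%classic = `]x - a, y - a]%classic).
  rewrite !lebesgue_measure_itv /= !lte_fin ltrD2r; case: ifP => // _.
  by rewrite -!EFinB; congr EFin; lra.
by apply/seteqP; split => z /=; rewrite !in_itv /= ltrBlDr lerBrDr.
Qed.

Section Rank.
Variables (n : nat) (d : n.-tuple nat).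

Definition by_degree : seq nat := sort (relpre (nth 0%N d) geq) (iota 0 n).

Lemma perm_by_degree : perm_eq by_degree (iota 0 n).
Proof. by rewrite perm_sort. Qed.

Lemma size_by_degree : size by_degree = n.
Proof. by rewrite size_sort size_iota. Qed.

(** The position of the vertex [k] in the order of decreasing degrees, extended by
    the identity to a bijection of [nat]. *)
Definition rank k : nat := if (k < n)%N then index k by_degree else k.

Lemma rank_lt k : (rank k < n)%N = (k < n)%N.
Proof.
rewrite /rank; case: ifP => // kn.
by rewrite -[X in (_ < X)%N]size_by_degree index_mem (perm_mem perm_by_degree) mem_iota.
Qed.

Lemma sorted_degree_rank (i : 'I_n) : sorted_degree d (rank i) = tnth d i.
Proof.
rewrite /sorted_degree.
have -> : sort geq d = [seq nth 0%N d k | k <- by_degree].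
  rewrite -sort_map; congr (sort _ _).
  by rewrite -[in LHS](mkseq_nth 0%N d) size_tuple.
have h : (index (i : nat) by_degree < size by_degree)%N.
  by rewrite index_mem (perm_mem perm_by_degree) mem_iota /= ltn_ord.
rewrite /rank ltn_ord (nth_map 0%N) // nth_index ?(tnth_nth 0%N) //.
by rewrite (perm_mem perm_by_degree) mem_iota /= ltn_ord.
Qed.

Lemma rank_inj k l : rank k = rank l -> k = l.
Proof.
move=> kl; have := rank_lt k; rewrite kl rank_lt => lk.
move: kl; rewrite /rank lk; case: ifP => // kn.
have inb j : (j < n)%N -> j \in by_degree by move=> jn; rewrite (perm_mem perm_by_degree) mem_iota.
move=> /(congr1 (nth 0%N by_degree)).
by rewrite !nth_index ?inb // lk.
Qed.

Lemma sum_rank (V : nmodType) (a : nat -> V) : \sum_(k < n) a (rank k) = \sum_(k < n) a k.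
Proof.
have rl (k : 'I_n) : (rank k < n)%N by rewrite rank_lt.
rewrite [RHS](reindex_inj (h := fun k => Ordinal (rl k))) //.
by move=> k l [/rank_inj/val_inj].
Qed.
End Rank.

Section BlockPermutation.
Variables (r : R) (r0 : 0 < r) (n : nat) (q : nat -> nat).
Hypothesis q_id : forall k, (n <= k)%N -> q k = k.
Hypothesis q_sum : forall a : nat -> \bar R, (\sum_(k < n) a (q k) = \sum_(k < n) a k)%E.

(** Translates the block [[k / r, (k + 1) / r)] onto the block of index [q k]. *)
Definition permute_blocks (x : R) : R :=
  x + ((q (Num.truncn (x * r)))%:R - (Num.truncn (x * r))%:R) / r.
Let tau := permute_blocks.

Lemma measurable_permute_blocks : measurable_fun setT (tau : borelR -> borelR).
Proof.
apply: measurable_funD => //.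
exact: (@measurable_step1 R r (fun k => ((q k)%:R - k%:R) / r)).
Qed.

Lemma shift_block (k l : nat) (x : R) : block r k x <-> block r l (x + (l%:R - k%:R) / r).
Proof.
rewrite !blockE //= !in_itv /= !ler_pdivrMr // !ltr_pdivlMr // mulrDl divfK ?gt_eqF //.
by rewrite -!natr1; split => /andP[h1 h2]; apply/andP; split; lra.
Qed.

Lemma block_permute_blocks (x : R) : 0 <= x -> block r (q (Num.truncn (x * r))) (tau x).
Proof. by move=> x0; exact: (shift_block _ _ _).1 (conj x0 erefl). Qed.

Lemma permute_blocks_ge0 (x : R) : 0 <= x -> 0 <= tau x.
Proof. by move=> /block_permute_blocks[]. Qed.

Lemma trunc_permute_blocks (x : R) : 0 <= x -> Num.truncn (tau x * r) = q (Num.truncn (x * r)).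
Proof. by move=> /block_permute_blocks[]. Qed.

Let beyond m : set borelR := [set x | 0 <= x /\ (m <= Num.truncn (x * r))%N].

Let beyondE m : beyond m = block r m `|` beyond m.+1.
Proof.
apply/seteqP; split => x; rewrite /beyond /block /=.
  by move=> [x0]; rewrite leq_eqVlt => /orP[/eqP <-|h]; [left|right].
by move=> [[x0 <-]|[x0 /ltnW]].
Qed.

Let measurable_beyond m : measurable (beyond m).
Proof.
elim: m => [|m ih].
  rewrite (_ : beyond 0 = @Rnneg R); first exact: measurable_Rnneg.
  by apply/seteqP; split => x /=; rewrite RnnegE /= // => -[].
rewrite (_ : beyond m.+1 = beyond m `\` block r m); first exact: measurableD ih (measurable_block _ _).
apply/seteqP; split => x; rewrite /beyond /block /=.
  by move=> [x0 h]; split; [split => //; exact: ltnW|move=> [_ e]; move: h; rewrite e ltnn].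
move=> [[x0 h] h2]; split => //; rewrite ltn_neqAle h andbT; apply/eqP => e; exact: h2.
Qed.

Let split_blocks (B : set borelR) m : measurable B ->
  (leb (B `&` @Rnneg R) = \sum_(k < m) leb (B `&` block r k) + leb (B `&` beyond m))%E.
Proof.
move=> mB; elim: m => [|m ih].
  rewrite big_ord0 add0e; congr (leb (_ `&` _)); apply/seteqP; split => x /=; rewrite RnnegE /= //.
  by move=> -[].
rewrite ih big_ord_recr /= -addeA; congr (_ + _)%E.
rewrite {1}beyondE setIUr measureU //.
- by apply: measurableI => //; exact: measurable_block.
- by apply: measurableI => //; exact: measurable_beyond.
- by apply/seteqP; split => // x [[_ [_ e]] [_ [_]]]; rewrite e ltnn.
Qed.

(** Block by block, the map is a translation; beyond the first [n] blocks it is the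
    identity. *)
Lemma lebesgue_permute_blocks (B : set borelR) : measurable B ->
  leb ((tau : borelR -> borelR) @^-1` B `&` @Rnneg R) = leb (B `&` @Rnneg R).
Proof.
move=> mB; have mtB : measurable ((tau : borelR -> borelR) @^-1` B).
  by have := measurable_permute_blocks measurableT mB; rewrite setTI.
rewrite !(split_blocks n) //; congr (_ + _)%E.
  rewrite -(q_sum (fun k => leb (B `&` block r k))); apply: eq_bigr => k _.
  rewrite -[RHS](lebesgue_shift (((q k)%:R - k%:R) / r)); last first.
    by apply: measurableI => //; exact: measurable_block.
  congr (leb _); apply/seteqP; split => x /= [xB xk].
    by split; [case: xk xB => _ <-|exact: (shift_block _ _ _).1 xk].
  have {}xk := (shift_block _ _ _).2 xk.
  by split => //; rewrite /tau /permute_blocks; case: xk => _ ->.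
congr (leb _); apply/seteqP; split => x /= [xB [x0 xn]].
  by move: xB; rewrite /tau /permute_blocks q_id // subrr mul0r addr0.
by split => //; rewrite /tau /permute_blocks q_id // subrr mul0r addr0.
Qed.

(** The coupling carried by the graph of [permute_blocks]: integrals against it
    become integrals against Lebesgue measure. *)
Definition block_coupling_map (x : borelR) : borelR * borelR := (x, tau x).

Lemma measurable_block_coupling_map : measurable_fun setT block_coupling_map.
Proof.
by apply: measurable_fun_pair => //; exact: measurable_permute_blocks.
Qed.

Definition block_coupling : {measure set (borelR * borelR) -> \bar R} :=
  pushforward_measure (mrestr leb (@measurable_Rnneg R)) measurable_block_coupling_map.

Lemma coupling_block_coupling : coupling block_coupling.
Proof.
move=> A mA; rewrite /block_coupling /= /pushforward /mrestr; split.
  by congr (leb (_ `&` _)); apply/seteqP; split => x //= [].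
rewrite -lebesgue_permute_blocks //; congr (leb (_ `&` _)).
by apply/seteqP; split => x //= [].
Qed.

Lemma integral_block_coupling (U : set (borelR * borelR)) (g : borelR * borelR -> \bar R) :
  measurable U -> U `<=` @quadrant R -> measurable_fun U g ->
  (\int[block_coupling]_(p in U) g p =
   \int[leb]_(x in block_coupling_map @^-1` U) g (x, tau x))%E.
Proof.
move=> mU UQ mg; rewrite /block_coupling integral_pushforward_measure //.
apply: eq_measure_integral => A mA AU; rewrite /mrestr; congr (leb _).
by apply/setIidPl => x /AU/UQ[].
Qed.

Lemma integral_permute_blocks (f : borelR -> \bar R) :
  measurable_fun setT f -> (forall x, 0 <= f x)%E ->
  (\int[leb]_(x in @Rnneg R) f (tau x) = \int[leb]_(x in @Rnneg R) f x)%E.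
Proof.
move=> mf f0; have mR := @measurable_Rnneg R.
have mt := measurable_permute_blocks.
transitivity (\int[pushforward_measure (mrestr leb mR) mt]_(x in @Rnneg R) f x)%E; last first.
  apply: eq_measure_integral => A mA AR.
  rewrite /= /pushforward /mrestr lebesgue_permute_blocks //; congr (leb _).
  exact/setIidPl.
rewrite integral_pushforward_measure //; last exact: measurable_funTS.
have mD : measurable ((tau : borelR -> borelR) @^-1` @Rnneg R).
  by have := mt measurableT _ mR; rewrite setTI.
have mN : measurable (~` @Rnneg R : set borelR) by exact: measurableC.
have E := @ge0_negligible_integral _ borelR R (mrestr leb mR) _ _ (fun x => f (tau x)) mN mD.
rewrite [RHS]E.
- rewrite (_ : _ `\` _ = @Rnneg R).
    by apply: eq_measure_integral => A mA AR; rewrite /mrestr; congr (leb _); apply/esym/setIidPl.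
  rewrite setDE setCK; apply/setIidPr => x /=; rewrite /Rnneg /= !in_itv /= !andbT.
  exact: permute_blocks_ge0.
- by apply: measurable_funTS; exact: measurableT_comp.
- by move=> x _; exact: f0.
- by rewrite /= /mrestr (_ : _ `&` _ = set0) ?measure0 //; apply/seteqP; split => // x [].
Qed.

End BlockPermutation.
End Rearrangement.

Section BilinearForms.
Variables (R : realType) (n : nat).

(** A linear form on the cube with side [w] is largest in absolute value at a
    vertex. *)
Lemma sum_weight_le_subset (w : R) (v c : 'I_n -> R) : (forall l, 0 <= v l <= w) ->
  exists T : {set 'I_n}, `|\sum_l v l * c l| <= w * `|\sum_(l in T) c l|.
Proof.
move=> hv; have key (e : 'I_n -> R) : exists T : {set 'I_n}, \sum_l v l * e l <= w * `|\sum_(l in T) e l|.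
  exists [set l | 0 <= e l]%SET.
  rewrite ger0_norm; last by apply: sumr_ge0 => l; rewrite inE.
  rewrite mulr_sumr [leRHS]big_mkcond /=; apply: ler_sum => l _.
  have /andP[v0 vw] := hv l; rewrite inE; case: ifPn => h; first exact: ler_wpM2r.
  by rewrite mulr_ge0_le0 // ltW // ltNge.
have [h|h] := leP 0 (\sum_l v l * c l); first by rewrite ger0_norm.
have [T hT] := key (fun l => - c l); exists T; rewrite ltr0_norm //.
by move: hT; rewrite !sumrN normrN; under eq_bigr do rewrite mulrN; rewrite sumrN.
Qed.

Lemma bilinear_le (w B : R) (D : 'I_n -> 'I_n -> R) (u v : 'I_n -> R) : 0 <= w ->
  (forall l, 0 <= u l <= w) -> (forall l, 0 <= v l <= w) ->
  (forall S T : {set 'I_n}, `|\sum_(k in S) \sum_(l in T) D k l| <= B) ->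
  `|\sum_k \sum_l D k l * (u k * v l)| <= w ^+ 2 * B.
Proof.
move=> w0 hu hv hB.
have -> : \sum_k \sum_l D k l * (u k * v l) = \sum_l v l * \sum_k u k * D k l.
  rewrite exchange_big; apply: eq_bigr => l _; rewrite mulr_sumr; apply: eq_bigr => k _.
  by rewrite mulrC -mulrA mulrCA.
have [T hT] := sum_weight_le_subset (fun l => \sum_k u k * D k l) hv.
apply: (le_trans hT); rewrite expr2 -mulrA ler_wpM2l // exchange_big /=.
under eq_bigr do rewrite -mulr_sumr.
have [S hS] := sum_weight_le_subset (fun k => \sum_(l in T) D k l) hu.
by apply: (le_trans hS); rewrite ler_wpM2l.
Qed.
End BilinearForms.

(** * Cut discrepancy of step kernels *)

Section FubiniRectangles.
Context (d1 d2 : measure_display) (T1 : measurableType d1) (T2 : measurableType d2) (R : realType).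
Variables (m1 : {sigma_finite_measure set T1 -> \bar R}) (m2 : {sigma_finite_measure set T2 -> \bar R}).

Lemma fubini_F_restrict (X : set T1) (Y : set T2) (f : T1 * T2 -> \bar R) :
  fubini_F m2 (f \_ (X `*` Y)) = (fun x => \int[m2]_(y in Y) f (x, y))%E \_ X.
Proof.
apply/funext => x; rewrite /fubini_F /patch; case: ifPn => xX.
  rewrite [RHS]integral_mkcond; apply: eq_integral => y _; rewrite /patch.
  by congr (if _ then _ else _); rewrite in_setX xX.
by rewrite integral0_eq // => y _; rewrite in_setX (negbTE xX).
Qed.

Lemma measurable_fun_integral (Y : set T2) (f : T1 * T2 -> \bar R) :
  measurable Y -> measurable_fun setT f ->
  measurable_fun setT (fun x => \int[m2]_(y in Y) f (x, y))%E.
Proof.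
move=> mY mf.
have -> : (fun x => \int[m2]_(y in Y) f (x, y))%E =
  (fun x => \int[m2]_(y in Y) f^\+ (x, y) - \int[m2]_(y in Y) f^\- (x, y))%E.
  apply/funext => x; rewrite integralE.
  by congr (_ - _)%E; apply: eq_integral => y _; rewrite ?funeposE ?funenegE.
have mXY : measurable ([set: T1] `*` Y) by exact: measurableX.
have key (g : T1 * T2 -> \bar R) : measurable_fun setT g -> (forall p, 0 <= g p)%E ->
    measurable_fun setT (fun x => \int[m2]_(y in Y) g (x, y))%E.
  move=> mg g0; rewrite -(patch_setT (fun=> 0%E) (fun x => \int[m2]_(y in Y) g (x, y))%E).
  rewrite -fubini_F_restrict; apply: measurable_fun_fubini_tonelli_F.
    by apply/(measurable_restrictT _ mXY); exact: measurable_funTS.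
  by move=> p; rewrite /patch; case: ifP.
apply: emeasurable_funB.
  apply: (key (fun p => f^\+ p)%E); first exact: measurable_funepos.
  by move=> p; exact: funepos_ge0.
apply: (key (fun p => f^\- p)%E); first exact: measurable_funeneg.
by move=> p; exact: funeneg_ge0.
Qed.

Lemma tonelli_rect (X : set T1) (Y : set T2) (f : T1 * T2 -> \bar R) :
  measurable X -> measurable Y -> measurable_fun setT f -> (forall p, 0 <= f p)%E ->
  (\int[m1 \x m2]_(p in X `*` Y) f p = \int[m1]_(x in X) \int[m2]_(y in Y) f (x, y))%E.
Proof.
move=> mX mY mf f0; rewrite integral_mkcond fubini_tonelli1.
- by rewrite fubini_F_restrict -integral_mkcond.
- have mXY : measurable (X `*` Y) by exact: measurableX.
  by apply/(measurable_restrictT _ mXY); exact: measurable_funTS.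
- by move=> p; rewrite /patch; case: ifP.
Qed.

Lemma fubini_rect (X : set T1) (Y : set T2) (f : T1 * T2 -> \bar R) :
  measurable X -> measurable Y -> (m1 \x m2)%E.-integrable (X `*` Y) f ->
  (\int[m1 \x m2]_(p in X `*` Y) f p = \int[m1]_(x in X) \int[m2]_(y in Y) f (x, y))%E.
Proof.
move=> mX mY fi; rewrite integral_mkcond -integral12_prod_meas1.
  by rewrite fubini_F_restrict -integral_mkcond.
have mXY : measurable (X `*` Y) by exact: measurableX.
exact/(integrable_mkcond _ mXY).
Qed.
End FubiniRectangles.

(** [F] is the kernel of the graph in its given order and [P] the kernel of linking
    probabilities in the order of decreasing degrees.  The total error is the
    sum of the matrix error [F k l - P (q k) (q l)], tested on sets, and the L1
    distance between the step function of [P] and [W2]. *)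
Section CutBound.
Variable R : realType.
Notation borelR := (measurableTypeR R).
Notation leb := (@lebesgue_measure R).
Notation leb2 := (leb \x leb)%E.
Variables (r : R) (r0 : 0 < r) (n : nat) (q : nat -> nat).
Hypothesis q_id : forall k, (n <= k)%N -> q k = k.
Hypothesis q_sum : forall a : nat -> \bar R, (\sum_(k < n) a (q k) = \sum_(k < n) a k)%E.
Hypothesis q_lt : forall k, (q k < n)%N = (k < n)%N.
Variables (F P : nat -> nat -> R).
Hypothesis F_ge0 : forall k l, 0 <= F k l.
Hypothesis P_ge0 : forall k l, 0 <= P k l.
Hypothesis F0 : forall k l, (n <= k)%N || (n <= l)%N -> F k l = 0.
Hypothesis P0 : forall k l, (n <= k)%N || (n <= l)%N -> P k l = 0.
Variables (W1 W2 : R -> R -> R).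
Hypothesis W1E : forall x y, 0 <= x -> 0 <= y -> W1 x y = F (Num.truncn (x * r)) (Num.truncn (y * r)).
Hypothesis measurable_W2 : measurable_fun setT (fun p : borelR * borelR => W2 p.1 p.2).
Variables (B e : R).
Hypothesis hB : forall S T : {set 'I_n},
  `|\sum_(k in S) \sum_(l in T) (F k l - P (q k) (q l))| <= B.

Let H (p : borelR * borelR) : R :=
  P (Num.truncn (p.1 * r)) (Num.truncn (p.2 * r)) - W2 p.1 p.2.
Hypothesis he : (\int[leb2]_(p in @quadrant R) `|H p|%:E <= e%:E)%E.

Let tau := permute_blocks r q.
Let mtau : measurable_fun setT (tau : borelR -> borelR) := measurable_permute_blocks r q.
Let Htau (p : borelR * borelR) : R := H (tau p.1, tau p.2).
Let Fstep (p : borelR * borelR) : R := F (Num.truncn (p.1 * r)) (Num.truncn (p.2 * r)).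
Let Pstep (p : borelR * borelR) : R := P (q (Num.truncn (p.1 * r))) (q (Num.truncn (p.2 * r))).

Let measurable_H : measurable_fun setT (H : borelR * borelR -> borelR).
Proof.
by apply: measurable_funB => //; exact: (@measurable_step R r P).
Qed.

Let measurable_Htau : measurable_fun setT (Htau : borelR * borelR -> borelR).
Proof.
apply: (@measurableT_comp _ _ _ _ _ _ H _ (fun p => (tau p.1, tau p.2))) => //.
by apply: measurable_fun_pair; exact: measurableT_comp.
Qed.

Let integral_Htau : (\int[leb2]_(p in @quadrant R) `|Htau p|%:E <= e%:E)%E.
Proof.
have mR := @measurable_Rnneg R.
have mH : measurable_fun setT (fun p => `|H p|%:E).
  by apply/measurable_EFinP; exact: measurableT_comp.
have mHt : measurable_fun setT (fun p => `|Htau p|%:E).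
  by apply/measurable_EFinP; exact: measurableT_comp.
have H0 p : (0 <= `|H p|%:E)%E by rewrite lee_fin.
apply: le_trans he; rewrite /quadrant !tonelli_rect //.
pose K (x : borelR) := (\int[leb]_(y in @Rnneg R) `|H (x, y)|%:E)%E.
rewrite (_ : (\int[leb]_(x in _) _ = \int[leb]_(x in @Rnneg R) K (tau x))%E); last first.
  apply: eq_integral => x _; rewrite /K /Htau /=.
  apply: (integral_permute_blocks r0 q_id q_sum (f := fun y => `|H (tau x, y)|%:E)) => //.
  by apply: (measurable_comp (F := setT)  (f := fun p => `|H p|%:E) (g := fun y => (tau x, y))) => //; exact: pair1_measurable.
rewrite (integral_permute_blocks r0 q_id q_sum) //.
  exact: (@measurable_fun_integral _ _ _ _ R leb _ (fun p => `|H p|%:E)).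
by move=> x; apply: integral_ge0 => y _.
Qed.

Let integrable_step (Q : nat -> nat -> R) (X Y : set borelR) : (forall k l, 0 <= Q k l) ->
  (forall k l, (n <= k)%N || (n <= l)%N -> Q k l = 0) -> measurable X -> measurable Y ->
  X `<=` @Rnneg R -> Y `<=` @Rnneg R ->
  leb2.-integrable (X `*` Y) (fun p => (Q (Num.truncn (p.1 * r)) (Num.truncn (p.2 * r)))%:E).
Proof.
move=> Q_ge0 Q0 mX mY XR YR; have mXY : measurable (X `*` Y) by exact: measurableX.
apply/integrableP; split; first by apply/measurable_EFinP; exact: (@measurable_step R r Q).
have -> : (\int[leb2]_(p in X `*` Y) `|(Q (Num.truncn (p.1 * r)) (Num.truncn (p.2 * r)))%:E| =
  \int[leb2]_(p in X `*` Y) (Q (Num.truncn (p.1 * r)) (Num.truncn (p.2 * r)))%:E)%E.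
  by apply: eq_integral => p _; rewrite /= ger0_norm.
have E := integral_blocks r0 Q_ge0 Q0 mX mY XR YR.
by rewrite [ltLHS]E ltry.
Qed.

Let Q k l := P (q k) (q l).
Let Q_ge0 k l : 0 <= Q k l. Proof. exact: P_ge0. Qed.

Let Q0 k l : (n <= k)%N || (n <= l)%N -> Q k l = 0.
Proof.
move=> h; apply: P0; move: h.
by rewrite (leqNgt n k) (leqNgt n l) (leqNgt n (q k)) (leqNgt n (q l)) !q_lt.
Qed.

(** The integrals are bilinear forms in the masses of the blocks in [X] and [Y],
    which lie between 0 and [1 / r]. *)
Lemma integral_block_difference (X Y : set borelR) : measurable X -> measurable Y ->
  X `<=` @Rnneg R -> Y `<=` @Rnneg R ->
  (`|\int[leb2]_(p in X `*` Y) (Fstep p)%:E - \int[leb2]_(p in X `*` Y) (Pstep p)%:E| <=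
   (r ^- 2 * B)%:E)%E.
Proof.
move=> mX mY XR YR.
have E1 := integral_blocks r0 F_ge0 F0 mX mY XR YR.
have E2 := integral_blocks r0 Q_ge0 Q0 mX mY XR YR.
rewrite [X in (X - _)%E]E1 [X in (_ - X)%E]E2 -EFinB abse_EFin lee_fin -sumrB.
under eq_bigr do rewrite -sumrB.
under eq_bigr do under eq_bigr do rewrite -mulrBl.
rewrite -exprVn; apply: bilinear_le => //; first by rewrite invr_ge0 ltW.
  by move=> k; rewrite mass_ge0 mass_le.
by move=> k; rewrite mass_ge0 mass_le.
Qed.

(** The intermediate kernel [Pstep] is the step function of [P] seen through the
    block permutation, which is measure preserving. *)
Lemma integral_difference_le (X Y : set borelR) : measurable X -> measurable Y ->
  X `<=` @Rnneg R -> Y `<=` @Rnneg R ->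
  leb2.-integrable (X `*` Y) (fun p => (Fstep p - W2 (tau p.1) (tau p.2))%:E) /\
  (`|\int[leb2]_(p in X `*` Y) (Fstep p - W2 (tau p.1) (tau p.2))%:E| <=
   (r ^- 2 * B + e)%:E)%E.
Proof.
move=> mX mY XR YR; have mXY : measurable (X `*` Y) by exact: measurableX.
have iF : leb2.-integrable (X `*` Y) (EFin \o Fstep) := integrable_step F_ge0 F0 mX mY XR YR.
have iP : leb2.-integrable (X `*` Y) (EFin \o Pstep) := integrable_step Q_ge0 Q0 mX mY XR YR.
have XYQ : X `*` Y `<=` @quadrant R by move=> p [/XR ? /YR ?]; split.
have mHt : measurable_fun setT (fun p => `|Htau p|%:E).
  by apply/measurable_EFinP; exact: measurableT_comp.
have iH_le : (\int[leb2]_(p in X `*` Y) `|(Htau p)%:E| <= e%:E)%E.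
  apply: le_trans integral_Htau; apply: ge0_subset_integral => //.
  - exact: measurable_quadrant.
  - exact: measurable_funTS.
have iH : leb2.-integrable (X `*` Y) (EFin \o Htau).
  apply/integrableP; split; first by apply/measurable_EFinP; exact: measurable_funTS.
  by apply: le_lt_trans iH_le _; rewrite ltry.
have E p : (X `*` Y) p -> (Fstep p - W2 (tau p.1) (tau p.2))%:E =
    ((EFin \o Fstep) p - (EFin \o Pstep) p + (EFin \o Htau) p)%E.
  move=> /XYQ [p1 p2]; rewrite /= -EFinB -EFinD; congr EFin.
  have {}p1 : 0 <= p.1 by move: p1; rewrite RnnegE /=.
  have {}p2 : 0 <= p.2 by move: p2; rewrite RnnegE /=.
  by rewrite /Htau /H /= !(trunc_permute_blocks r0) // /Pstep addrA subrK.
have iFP : leb2.-integrable (X `*` Y) (fun p => (EFin \o Fstep) p - (EFin \o Pstep) p)%E.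
  exact: integrableB.
split.
  apply: (eq_integrable mXY (fun p => (EFin \o Fstep) p - (EFin \o Pstep) p + (EFin \o Htau) p)%E).
    by move=> p; rewrite inE => /E ->.
  exact: integrableD.
rewrite (eq_integral (fun p => (EFin \o Fstep) p - (EFin \o Pstep) p + (EFin \o Htau) p)%E); last first.
  by move=> p; rewrite inE => /E.
rewrite integralD // integralB // EFinD.
apply: le_trans (lee_abs_add _ _) _; apply: leeD; first exact: integral_block_difference.
apply: le_trans iH_le; apply: le_abse_integral => //.
by apply/measurable_EFinP; exact: measurable_funTS.
Qed.

(** Subsets of the quadrant enter only through their traces on the graph of the
    coupling, that is, through two subsets of the half-line. *)
Lemma cut_discrepancy_le (U V : set (borelR * borelR)) : measurable U -> measurable V ->
  U `<=` @quadrant R -> V `<=` @quadrant R ->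
  (cut_discrepancy W1 W2 (block_coupling r q) U V <= (r ^- 2 * B + e)%:E)%E.
Proof.
move=> mU mV UQ VQ; rewrite /cut_discrepancy.
pose phi := @block_coupling_map R r q.
have mphi := measurable_block_coupling_map r q.
pose X := phi @^-1` U; pose Y := phi @^-1` V.
have mX : measurable X by have := mphi measurableT _ mU; rewrite setTI.
have mY : measurable Y by have := mphi measurableT _ mV; rewrite setTI.
have XR : X `<=` @Rnneg R by move=> x /UQ[].
have YR : Y `<=` @Rnneg R by move=> x /VQ[].
have nng x : @Rnneg R x -> 0 <= x by rewrite RnnegE.
pose D (z : (borelR * borelR) * (borelR * borelR)) : R :=
  F (Num.truncn (z.1.1 * r)) (Num.truncn (z.2.1 * r)) - W2 z.1.2 z.2.2.
have mD : measurable_fun setT (D : _ -> borelR).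
  have m11 : measurable_fun setT (fun z : (borelR * borelR) * (borelR * borelR) => (z.1.1, z.2.1)).
    by apply: measurable_fun_pair; apply: measurableT_comp.
  have m22 : measurable_fun setT (fun z : (borelR * borelR) * (borelR * borelR) => (z.1.2, z.2.2)).
    by apply: measurable_fun_pair; apply: measurableT_comp.
  apply: measurable_funB; last exact: (measurableT_comp measurable_W2 m22).
  exact: (measurableT_comp (@measurable_step R r F _ measurableT) m11).
have -> : (\int[block_coupling r q]_(p in U) \int[block_coupling r q]_(s in V) (W1 p.1 s.1 - W2 p.2 s.2)%:E =
  \int[block_coupling r q]_(p in U) \int[leb]_(y in Y) (D (p, (y, tau y)))%:E)%E.
  apply: eq_integral => p; rewrite inE => /UQ[/nng p1 _].
  transitivity (\int[block_coupling r q]_(s in V) (D (p, s))%:E)%E.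
    by apply: eq_integral => s; rewrite inE => /VQ[/nng s1 _]; rewrite W1E.
  apply: integral_block_coupling => //; apply/measurable_EFinP.
  apply: measurable_funTS; apply: (measurableT_comp mD); exact: pair1_measurable.
rewrite integral_block_coupling //; last first.
  apply: measurable_funTS.
  apply: (@measurable_fun_integral _ _ _ _ R leb _ (fun z : (borelR * borelR) * borelR => (D (z.1, (z.2, tau z.2)))%:E)) => //.
  apply/measurable_EFinP; apply: (measurableT_comp mD).
  apply: measurable_fun_pair => //; apply: measurable_fun_pair => //.
  exact: measurableT_comp.
have [iD leD] := integral_difference_le mX mY XR YR.
by rewrite (fubini_rect mX mY iD) in leD.
Qed.

End CutBound.

(** * Canonical graphons and convergence in the stretched cut metric *)

Section CanonicalGraphon.
Variable R : realType.
Notation borelR := (measurableTypeR R).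
Notation leb := (@lebesgue_measure R).
Notation leb2 := (leb \x leb)%E.
Variables (n : nat) (G : multigraph n).

Definition adjacency (k l : nat) : R :=
  [exists i : 'I_n, exists j : 'I_n, [&& (0 < G i j)%N, k == i :> nat & l == j :> nat]]%:R.

Lemma adjacency_ge0 k l : 0 <= adjacency k l.
Proof. by rewrite /adjacency. Qed.

Lemma adjacency_ord (i j : 'I_n) : adjacency i j = (0 < G i j)%N%:R.
Proof.
congr (nat_of_bool _)%:R; apply/existsP/idP => [[a /existsP[b /and3P[h]]]|h].
  by move=> /eqP/val_inj -> /eqP/val_inj ->.
by exists i; apply/existsP; exists j; rewrite h !eqxx.
Qed.

Lemma adjacency0 k l : (n <= k)%N || (n <= l)%N -> adjacency k l = 0.
Proof.
move=> h; rewrite /adjacency; case: existsP => // -[i /existsP[j /and3P[_ /eqP ki /eqP lj]]].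
by move: h; rewrite ki lj (leqNgt n i) (leqNgt n j) !ltn_ord.
Qed.

Hypothesis n0 : (0 < n)%N.

Lemma canonical_graphonE (x y : R) : 0 <= x -> 0 <= y ->
  canonical_graphon G x y = adjacency (Num.truncn (x * n%:R)) (Num.truncn (y * n%:R)).
Proof.
have rn : 0 < n%:R :> R by rewrite ltr0n.
have blk (z : R) (i : nat) : 0 <= z ->
    (i%:R / n%:R <= z < i.+1%:R / n%:R) = (Num.truncn (z * n%:R) == i).
  move=> z0; have E := blockE i rn; apply/idP/eqP => [h|h].
    by have [] : block n%:R i z by rewrite E /= in_itv /=.
  have : block n%:R i z by split.
  by rewrite E /= in_itv.
move=> x0 y0; rewrite /canonical_graphon /adjacency; congr (nat_of_bool _)%:R.
by apply: eq_existsb => i; apply: eq_existsb => j; rewrite !blk.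
Qed.

Lemma L1norm_canonical_graphon :
  L1norm (@canonical_graphon R n G) = (nb_links G)%:R / n%:R ^+ 2.
Proof.
have rn : 0 < n%:R :> R by rewrite ltr0n.
have nng x : @Rnneg R x -> 0 <= x by rewrite RnnegE.
rewrite /L1norm /Rintegral.
have mR := @measurable_Rnneg R.
have RR : @Rnneg R `<=` @Rnneg R by [].
have E := integral_blocks rn adjacency_ge0 adjacency0 mR mR RR RR.
have -> : (\int[leb2]_(p in @quadrant R) `|canonical_graphon G p.1 p.2|%:E =
  \int[leb2]_(p in @quadrant R) (adjacency (Num.truncn (p.1 * n%:R)) (Num.truncn (p.2 * n%:R)))%:E)%E.
  apply: eq_integral => p; rewrite inE => -[/nng p1 /nng p2].
  by rewrite canonical_graphonE // ger0_norm // adjacency_ge0.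
rewrite [X in fine X]E /= /nb_links natr_sum mulr_suml; apply: eq_bigr => i _.
rewrite natr_sum mulr_suml; apply: eq_bigr => j _.
by rewrite adjacency_ord !mass_Rnneg // -invfM -expr2.
Qed.

(** Stretching replaces blocks of width [1 / n] by blocks of width
    [1 / sqrt (nb_links G)]. *)
Lemma stretch_canonical_graphonE (x y : R) : 0 <= x -> 0 <= y ->
  stretch (canonical_graphon G) x y =
  adjacency (Num.truncn (x * Num.sqrt (nb_links G)%:R)) (Num.truncn (y * Num.sqrt (nb_links G)%:R)).
Proof.
have rn : 0 < n%:R :> R by rewrite ltr0n.
move=> x0 y0; rewrite /stretch L1norm_canonical_graphon.
rewrite canonical_graphonE ?mulr_ge0 ?sqrtr_ge0 //.
have -> : Num.sqrt ((nb_links G)%:R / n%:R ^+ 2) = Num.sqrt (nb_links G)%:R / n%:R :> R.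
  by rewrite sqrtrM // sqrtrV ?sqr_ge0 // sqrtr_sqr gtr0_norm.
have s (z : R) : Num.sqrt (nb_links G)%:R / n%:R * z * n%:R = z * Num.sqrt (nb_links G)%:R.
  by rewrite mulrC mulrA mulrCA mulfV ?gt_eqF // mulr1 mulrC.
by rewrite !s.
Qed.

End CanonicalGraphon.

Section CutLimit.
Variables (R : realType) (d : forall n : nat, n.-tuple nat)
  (rho : {measure set (measurableTypeR R) -> \bar R}).
Notation borelR := (measurableTypeR R).
Notation leb := (@lebesgue_measure R).
Notation leb2 := (leb \x leb)%E.
Hypothesis d_pos : forall (n : nat) (i : 'I_n), (0 < tnth (d n) i)%N.
Hypothesis rho_cvg : vague_cvg (fun n => rho_n R (d n)) rho.
Hypothesis tr : tail_regular R d.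
Variables (c : R) (G : forall n, multigraph n).
Hypothesis c0 : 0 < c.
Hypothesis G01 : \forall n \near \oo, forall i j, G n i j = (0 < G n i j)%N.
Hypothesis links : uniform_links_near R d G.
Hypothesis link_prob_cvg :
  (\sum_(i < n) \sum_(j < n) link_prob R (d n) i j) / (ell (d n))%:R @[n --> \oo] --> c.
Hypothesis links_cvg : (nb_links (G n))%:R / (ell (d n))%:R @[n --> \oo] --> c.

Let r n : R := Num.sqrt (nb_links (G n))%:R.
Let r_ge0 n : 0 <= r n. Proof. exact: sqrtr_ge0. Qed.
Let W := W_ECM_scaled rho c.

Let r_cvg : r n / Num.sqrt (ell (d n))%:R @[n --> \oo] --> Num.sqrt c.
Proof.
have -> : (fun n => r n / Num.sqrt (ell (d n))%:R) =
    (fun n => Num.sqrt ((nb_links (G n))%:R / (ell (d n))%:R)).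
  by apply/funext => n; rewrite sqrtrM // sqrtrV.
apply: continuous_cvg links_cvg; exact: sqrt_continuous.
Qed.

Let W01 x y : 0 <= W x y <= 1.
Proof. by have := W_ECM_scaled_ge0 rho c (x, y); have := W_ECM_scaled_le1 rho c (x, y) => -> ->. Qed.

Let intW : (\int[leb2]_(p in @quadrant R) (W p.1 p.2)%:E = 1%:E)%E.
Proof. exact: (integral_W_ECM_scaled d_pos rho_cvg tr c0 r_ge0 r_cvg link_prob_cvg). Qed.

Lemma graphon_W_ECM_scaled : graphon W.
Proof.
split => [x y _ _|x y _ _|]; [|exact: W01|].
  rewrite /W /W_ECM_scaled /W_ECM eq_sym; case: eqP => [->//|_].
  by rewrite [X in 1 - expR (- X)]mulrC.
apply/integrableP; split.
  by apply/measurable_EFinP; exact: (measurable_W_ECM_scaled d_pos rho_cvg c (@measurable_quadrant R)).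
rewrite (_ : (\int[_]_(_ in _) _ = 1%:E)%E) ?ltry // -intW; apply: eq_integral => p _ /=.
by rewrite ger0_norm //; case/andP: (W01 p.1 p.2).
Qed.

(** The integral is 1 by [integral_W_ECM_scaled]; this is the role of the scaling
    by [sqrt c]. *)
Lemma stretch_W_ECM_scaled : stretch W = W.
Proof.
apply/funext => x; apply/funext => y; rewrite /stretch.
suff -> : L1norm W = 1 by rewrite sqrtr1 !mul1r.
rewrite /L1norm /Rintegral (_ : (\int[_]_(_ in _) _ = 1%:E)%E) // -intW.
by apply: eq_integral => p _; rewrite ger0_norm //; case/andP: (W01 p.1 p.2).
Qed.

Lemma cut_distance_ge0 (W1 W2 : R -> R -> R) : (0 <= cut_distance W1 W2)%E.
Proof.
apply: le_ereal_inf_tmp => _ [gamma _ <-].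
apply: (@le_trans _ _ (cut_discrepancy W1 W2 gamma set0 set0)); first exact: abse_ge0.
by apply: ereal_sup_ubound; exists set0, set0; split.
Qed.

(** The matrix error is [O (eps * ell)] by [ECM_uniform_links], and it is divided
    by the number of links, which is about [c * ell]. *)
Lemma stretched_cut_distance_near (eps : R) : 0 < eps ->
  \forall n \near \oo, (stretched_cut_distance (@canonical_graphon R n (G n)) W <= eps%:E)%E.
Proof.
move=> e0; have e2 : 0 < eps / 2 by rewrite divr_gt0.
have ec : 0 < c / 2 * (eps / 2) by rewrite mulr_gt0 // divr_gt0.
have L1 := profile_graphon_cvg_L1 d_pos rho_cvg tr c0 r_ge0 r_cvg e2.
have r2c := r2_cvg c0 r_cvg; move/cvgrPdist_lt : r2c => /(_ _ (divr_gt0 c0 (ltr0n _ 2))) r2c.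
have lk := links ec.
near=> n.
have n0 : (0 < n)%N by near: n; exists 1%N.
have l0 : 0 < (ell (d n))%:R :> R by rewrite ltr0n (ell_gt0 d_pos).
have rn0 : 0 < r n by near: n; exact: (near_r_gt0 c0 r_ge0 r_cvg).
have g01 : forall i j, G n i j = (0 < G n i j)%N by near: n.
have r2 : c / 2 * (ell (d n))%:R <= r n ^+ 2.
  have : `|c - r n ^+ 2 / (ell (d n))%:R| < c / 2 by near: n.
  rewrite ltr_norml => /andP[_ hh]; rewrite -ler_pdivlMr //; lra.
pose q := rank (d n).
have q_id k : (n <= k)%N -> q k = k by rewrite /q /rank ltnNge => ->.
have q_sum (a : nat -> \bar R) : (\sum_(k < n) a (q k) = \sum_(k < n) a k)%E by exact: sum_rank.
have hB (S T : {set 'I_n}) : `|\sum_(k in S) \sum_(l in T)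
     (adjacency R (G n) k l - profile_kernel R d n (q k) (q l))| <= c / 2 * (eps / 2) * (ell (d n))%:R.
  rewrite (eq_bigr (fun i => \sum_(j in T) ((G n i j)%:R - link_prob R (d n) i j))); last first.
    move=> i _; apply: eq_bigr => j _; rewrite adjacency_ord -g01 /profile_kernel /q !sorted_degree_rank.
    by rewrite /link_prob mulrACA -invfM -expr2 sqr_sqrtr.
  by move: S T; near: n.
have W1E (x y : R) : 0 <= x -> 0 <= y -> stretch (canonical_graphon (G n)) x y =
    adjacency R (G n) (Num.truncn (x * r n)) (Num.truncn (y * r n)).
  by move=> x0 y0; rewrite stretch_canonical_graphonE.
have he : (\int[leb2]_(p in @quadrant R) (profile_distance d rho c r n p)%:E <= (eps / 2)%:E)%E by near: n.
have mW : measurable_fun setT (fun p : borelR * borelR => W p.1 p.2).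
  exact: (measurable_W_ECM_scaled d_pos rho_cvg c measurableT).
rewrite /stretched_cut_distance stretch_W_ECM_scaled.
apply: ge_ereal_inf; exists (ereal_sup [set z | exists U V : set (borelR * borelR),
         [/\ measurable U, measurable V, U `<=` @quadrant R, V `<=` @quadrant R &
             z = cut_discrepancy (stretch (canonical_graphon (G n))) W (block_coupling (r n) q) U V]]).
  by exists (block_coupling (r n) q) => //; exact: (coupling_block_coupling rn0 q_id q_sum).
apply: ge_ereal_sup => _ [U [V [mU mV UQ VQ ->]]].
have := cut_discrepancy_le rn0 q_id q_sum (rank_lt (d n)) (adjacency_ge0 R (G n))
   (profile_kernel_ge0 R d n) (@adjacency0 R n (G n)) (@profile_kernel0 R d n) W1E mW hB he mU mV UQ VQ.
move=> /le_trans; apply; rewrite lee_fin [leRHS](splitr eps) lerD2r.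
rewrite ler_pdivrMl ?exprn_gt0 // mulrAC ler_wpM2r //; first exact: ltW.
Unshelve. all: by end_near. Qed.

Lemma ECM_stretched_cut_cvg : stretched_cut_cvg G W.
Proof.
split; first exact: graphon_W_ECM_scaled.
apply/fine_cvgP; split.
  apply: filterS (stretched_cut_distance_near ltr01) => n h.
  by rewrite ge0_fin_numE ?(le_lt_trans h) ?ltry // cut_distance_ge0.
apply/cvgrPdist_le => eps e0; apply: filterS (stretched_cut_distance_near e0) => n h /=.
have u0 := cut_distance_ge0 (stretch (canonical_graphon (G n))) (stretch W).
rewrite sub0r normrN ger0_norm ?fine_ge0 // -lee_fin fineK //.
by rewrite ge0_fin_numE ?(le_lt_trans h) ?ltry.
Qed.

End CutLimit.

Theorem corollary1p4 (R : realType) (d : forall n : nat, n.-tuple nat)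
  (rho : {measure set (measurableTypeR R) -> \bar R}) (b : R)
  (d_pos : forall (n : nat) (i : 'I_n), (0 < tnth (d n) i)%N)
  (ell_even : forall n : nat, ~~ odd (ell (d n)))
  (max_degree_small :
    (fun n : nat => (max_degree (d n))%:R : R) =o_\oo
    (fun n : nat => (ell (d n))%:R : R))
  (ell_large :
    (fun n : nat => ln n%:R : R) =o_\oo (fun n : nat => (ell (d n))%:R : R))
  (rho_pos : rho `]-oo, 0]%classic = 0%E)
  (rho_cvg : vague_cvg (fun n => rho_n R (d n)) rho)
  (b_ge0 : 0 <= b)
  (b_cvg : b_n R (d n) @[n --> \oo] --> b) :
  (forall P_CM : probability graph_seq R,
     is_product_law P_CM (fun n => CM_law R (d n)) ->
     (I_CM b rho = 0 <->
      {ae P_CM, forall G, uniformly_tail_regular R G}))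
  /\
  (I_CM b rho = 0 ->
   forall c : R, 0 < c ->
   edge_intensity (rho_n R (d n)) @[n --> \oo] --> c%:E ->
   forall P_ECM : probability graph_seq R,
     is_product_law P_ECM (fun n => ECM_law R (d n)) ->
     {ae P_ECM, forall G, uniformly_tail_regular R G} /\
     {ae P_ECM, forall G, stretched_cut_cvg G (W_ECM_scaled rho c)}).
Proof.
have IE := I_CM_tail_regular d_pos rho_cvg b_cvg.
split => [P hP|I0 c c0 hc P hP].
  have good := CM_ae_good_degrees d_pos ell_even max_degree_small hP.
  split => [/IE tr|reg].
    by apply: filterS good => G hG; exact/(tail_regular_CM d_pos hG).
  have [G [hG regG]] : exists G : graph_seq,
      (\forall n \near \oo, good_degrees R d (G n)) /\ uniformly_tail_regular R G.
    have proper : ProperFilter (almost_everywhere P).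
      apply: ae_properfilter_algebraOfSetsType.
      by rewrite [ltRHS](_ : _ = 1%E) ?lte01 //; exact: probability_setT.
    by apply: (@filter_ex _ _ proper); exact: filterI.
  by apply/IE; exact/(tail_regular_CM d_pos hG).
have tr := IE.1 I0.
have pc : (\sum_(i < n) \sum_(j < n) link_prob R (d n) i j) / (ell (d n))%:R @[n --> \oo] --> c.
  have /fine_cvgP[_] := hc; apply: cvg_trans; apply: near_eq_cvg.
  exists 1%N => // n n0 /=; by rewrite edge_intensityE // (ell_gt0 d_pos).
have good := ECM_ae_good_links d_pos ell_even max_degree_small hP.
split; apply: filterS good => G hG.
  exact: (ECM_uniformly_tail_regular d_pos tr hG c0 pc).
apply: (ECM_stretched_cut_cvg d_pos rho_cvg tr c0 _ _ pc).
- apply: filterS (hG 0) => n [[M _ ->] _] i j; by rewrite !collapseE; case: (_ < _)%N.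
- exact: (ECM_uniform_links d_pos tr hG).
- exact: (nb_links_cvg d_pos tr hG pc).
Qed.
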